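(* Let $d\in\mathbb Z$. There exists a functor $\mathcal S:\mathrm{SpCY}_d\to\mathrm{Scyc}\widehat{A_\infty}_d$ which sends a $d$-pre-Calabi-Yau category $(\mathcal A,s_{d+1}M_{\mathcal A})$ to the cyclic $A_\infty$-category $(\mathcal A\oplus\mathcal A^*[d-1],sm_{\mathcal A\oplus\mathcal A^*})$ with $sm_{\mathcal A\oplus\mathcal A^*}=\mathsf j(s_{d+1}M_{\mathcal A})$, and a strict $d$-pre-Calabi-Yau morphism $(\Phi_0,s_{d+1}\Phi):(\mathcal A,s_{d+1}M_{\mathcal A})\to(\mathcal B,s_{d+1}M_{\mathcal B})$ to the almost cyclic $A_\infty$-structure $sm_{\mathcal A\oplus\mathcal B^*}$ together with the strict cyclic $A_\infty$-morphisms $$(\mathcal A\oplus\mathcal A^*[d-1],sm_{\mathcal A\oplus\mathcal A^*})\xleftarrow{\ s\varphi_{\mathcal A}\ }(\mathcal A\oplus\mathcal B^*[d-1],sm_{\mathcal A\oplus\mathcal B^*})\xrightarrow{\ s\varphi_{\mathcal B}\ }(\mathcal B\oplus\mathcal B^*[d-1],sm_{\mathcal B\oplus\mathcal B^*})$$ given by $s\varphi_{\mathcal A}(sa)=sa$, $s\varphi_{\mathcal A}(tf)=t(f\circ\tilde\Phi)$, $s\varphi_{\mathcal B}(sa)=\Phi(sa)$, $s\varphi_{\mathcal B}(tf)=tf$ for $sa\in{}_x\mathcal A_y[1]$, $tf\in{}_{\Phi_0(x)}\mathcal B^*_{\Phi_0(y)}[d]$, with all higher components zero.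
   Context: **Conventions.** $\Bbbk$ is a field of characteristic different from $2,3$; $\otimes=\otimes_\Bbbk$. For a graded space $V$, $V[n]^i=V^{n+i}$ and $s_n:V\to V[n]$ (also $V[m]\to V[m+n]$) is the identity on underlying sets, of degree $-n$; $s=s_1$. The Koszul sign rule is used everywhere: $(f\otimes g)(v\otimes w)=(-1)^{|g||v|}f(v)\otimes g(w)$, and exchanging two adjacent homogeneous elements $v,w$ produces $(-1)^{|v||w|}$. $V^*$ is the graded dual. Products are products of graded spaces. A graded quiver $\mathcal A$ has a set of objects $\mathcal O_{\mathcal A}$ and graded spaces ${}_y\mathcal A_x$; $\mathcal A^*$ has the same objects and ${}_y\mathcal A^*_x=({}_x\mathcal A_y)^*$. Elements $s_{d-1}g$ of $\mathcal A^*[d-1]$ are viewed as linear forms on $\mathcal A[1-d]$ by the isomorphism $\mathcal Hom(V,W)[k]\to\mathcal Hom(V[-k],W)$, $s_kg\mapsto(s_{-k}v\mapsto(-1)^{k|g|}g(v))$ with $k=d-1$. For a tuple $\bar x=(x_1,\dots,x_n)$ of objects ($n\ge1$): $\lg(\bar x)=n$, $\mathrm{lt}(\bar x)=x_1$, $\mathrm{rt}(\bar x)=x_n$, $\mathcal A[1]^{\otimes\bar x}={}_{x_1}\mathcal A_{x_2}[1]\otimes\cdots\otimes{}_{x_{n-1}}\mathcal A_{x_n}[1]$ ($=\Bbbk$ if $n=1$); $\sqcup$ is concatenation. A *type* is a finite nonempty sequence $\bar{\bar x}=(\bar x^1,\dots,\bar x^n)$ of nonempty tuples, with $\lg(\bar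 x^1)\ge2$ if $n=1$. $\overline{sa}^i$ denotes a homogeneous pure tensor in $\mathcal A[1]^{\otimes\bar x^i}$, $|\overline{sa}^i|$ its total degree. $t=s_d$ denotes the shift $\mathcal A^*\to\mathcal A^*[d]$, $\mathcal B^*\to\mathcal B^*[d]$. **$A_\infty$-categories.** An $A_\infty$-structure on a graded quiver $\mathcal Q$ is a family $sm$ of degree $1$ maps $sm^{\bar x}:\mathcal Q[1]^{\otimes\bar x}\to{}_{\mathrm{lt}(\bar x)}\mathcal Q_{\mathrm{rt}(\bar x)}[1]$, $\lg(\bar x)\ge2$, with $\sum sm\circ(\mathrm{id}^{\otimes}\otimes sm\otimes\mathrm{id}^{\otimes})=0$ on every $\mathcal Q[1]^{\otimes\bar x}$ (sum over all insertions of $sm$ on a nonempty block of consecutive inputs). An $A_\infty$-category is a graded quiver with an $A_\infty$-structure. An $A_\infty$-morphism $(F_0,sf):\mathcal Q\to\mathcal R$ is a map $F_0$ on objects and degree $0$ maps $sf^{\bar x}:\mathcal Q[1]^{\otimes\bar x}\to{}_{F_0(\mathrm{lt}(\bar x))}\mathcal R_{F_0(\mathrm{rt}(\bar x))}[1]$, $\lg(\bar x)\ge2$, with $\sum sf\circ(\mathrm{id}^\otimes\otimes sm_{\mathcal Q}\otimes\mathrm{id}^\otimes)=\sum sm_{\mathcal R}\circ(sf\otimes\cdots\otimes sf)$ (right sum over all decompositions into consecutive nonempty blocks); composition is $\sum sg\circ(sf\otimes\cdots\otimes sf)$. It is strict if $sf^{\bar x}=0$ whenever $\lg(\bar x)>2$.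 A bilinear form of degree $d$ on $\mathcal Q$ is a family of homogeneous maps ${}_y\Gamma_x:{}_y\mathcal Q_x[1]\otimes{}_x\mathcal Q_y[1]\to\Bbbk$ of degree $d+2$; it is nondegenerate if the maps ${}_y\mathcal Q_x[1]\to({}_x\mathcal Q_y[1])^*$, $sa\mapsto{}_y\Gamma_x(sa,-)$, are isomorphisms. $sm$ is almost cyclic with respect to $\Gamma$ if for $q_i\in{}_{x_i}\mathcal Q_{x_{i+1}}$ ($i<n$), $q_n\in{}_{x_n}\mathcal Q_{x_1}$, ${}_{x_1}\Gamma_{x_n}(sm(sq_1,\dots,sq_{n-1}),sq_n)=(-1)^{|sq_n|\sum_{i<n}|sq_i|}{}_{x_n}\Gamma_{x_{n-1}}(sm(sq_n,sq_1,\dots,sq_{n-2}),sq_{n-1})$. An almost cyclic $A_\infty$-category is an $A_\infty$-category whose structure is almost cyclic with respect to a fixed homogeneous bilinear form; it is cyclic if this form is nondegenerate. An $A_\infty$-morphism $(F_0,sf)$ between almost cyclic $A_\infty$-categories with bilinear forms $\gamma$ (source) and $\Gamma$ (target) is cyclic if ${}_{F_0(x)}\Gamma_{F_0(y)}(sf(sa),sf(sb))={}_x\gamma_y(sa,sb)$ for $a\in{}_x\mathcal Q_y$, $b\in{}_y\mathcal Q_x$, and for each $n\ge3$ and each cyclically composable $sq_1,\dots,sq_n$, $\sum_{i=1}^{n-1}\Gamma(sf(sq_1,\dots,sq_i),sf(sq_{i+1},\dots,sq_n))=0$. **Pre-Calabi-Yau structures.** $\mathrm{Multi}_d(\mathcal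 A)$ is the product over all types of the graded spaces of (sums of homogeneous) linear maps $$F^{\bar{\bar x}}:\mathcal A[1]^{\otimes\bar x^1}\otimes\cdots\otimes\mathcal A[1]^{\otimes\bar x^n}\to{}_{\mathrm{lt}(\bar x^1)}\mathcal A_{\mathrm{rt}(\bar x^2)}[-d]\otimes\cdots\otimes{}_{\mathrm{lt}(\bar x^n)}\mathcal A_{\mathrm{rt}(\bar x^1)}[-d].$$ $\mathrm{Multi}_d(\mathcal A)^C$: cyclically invariant elements, $F^{(\bar x^1,\dots,\bar x^n)}=\tau_{out}\circ F^{(\bar x^2,\dots,\bar x^n,\bar x^1)}\circ\tau_{in}$, where $\tau_{in}$ moves the first input block to the end and $\tau_{out}$ moves the last output factor to the front, with Koszul signs. $s_{d+1}F$ is identified with the family $(\mathrm{id}^{\otimes(n-1)}\otimes s_{d+1})\circ F^{\bar{\bar x}}$. A disc of type $(\bar x^1,\dots,\bar x^n)$ is a circle with outgoing arrows labelled $1,\dots,n$ clockwise; the sector between outgoing arrows $i-1$ and $i$ (arrow $0$ is arrow $n$) contains $\lg(\bar x^i)-1$ incoming arrows, separated by the objects $x^i_1,x^i_2,\dots$ read counterclockwise; the incoming arrow between $x^i_j,x^i_{j+1}$ is the input ${}_{x^i_j}\mathcal A_{x^i_{j+1}}[1]$, outgoing arrow $i$ is the $i$-th output. Outgoing arrow $i$ of one disc may be connected to an incoming arrow between $u,u'$ of another if $\mathrm{lt}(\bar x^i)=u$, $\mathrm{rt}(\bar x^{i+1})=u'$ ($\bar x^{n+1}=\bar x^1$). A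 two-disc diagram consists of a disc filled with $G$ and one filled with $F$, one outgoing arrow of the $G$-disc being connected to one incoming arrow of the $F$-disc, with a chosen free outgoing arrow (root). Free outgoing arrows are labelled clockwise $1,\dots,N$, the root being $N$; the type lists the objects read counterclockwise between free outgoing arrows $i-1$ and $i$. The bold arrow of each disc is its arrow on the path to the root. A disc acts by $(\mathrm{id}^\otimes\otimes s_{d+1}\otimes\mathrm{id}^\otimes)\circ F$, with $s_{d+1}$ at the bold output, if its bold arrow is outgoing; if it is incoming, it acts by the map $(-1)^{(d+1)|F|}F\circ(\mathrm{id}^\otimes\otimes s_{d+1}\otimes\mathrm{id}^\otimes)$, with $s_{d+1}:\mathcal A[-d]\to\mathcal A[1]$ at the bold input, multiplied by $(-1)^{(|F|+d+1)(d+1)}$ (discs being relabelled cyclically if needed). The evaluation takes the inputs in the order of the type, permutes (Koszul signs) so that the inputs of the $G$-disc are leftmost in order, applies the $G$-disc, permutes so that the inputs of the $F$-disc are leftmost in order, applies the $F$-disc, and permutes the outputs into the order $1,\dots,N$. $(s_{d+1}F\circ_{nec}s_{d+1}G)^{\bar{\bar z}}$ is the sum of evaluations over all such diagrams of type $\bar{\bar z}$. A $d$-pre-Calabi-Yau structure on $\mathcal A$ is a degree $1$ element $s_{d+1}M_{\mathcal A}\in\mathrm{Multi}_d(\mathcal A)^C[d+1]$ with $s_{d+1}M_{\mathcal A}\circ_{nec}s_{d+1}M_{\mathcal A}=0$; a $d$-pre-Calabi-Yau category is a graded quiver with such a structure. **The structure $sm_{\mathcal A\oplus\mathcal A^*}$.**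 It equals $\mathsf j(s_{d+1}M_{\mathcal A})$, where for $s_{d+1}\phi\in\mathrm{Multi}_d(\mathcal A)[d+1]$, $\mathsf j(s_{d+1}\phi)=s\psi$ is defined on words $w=(\overline{sa}^n,tf^{n-1},\overline{sa}^{n-1},\dots,tf^1,\overline{sa}^1)$ in $\mathcal A[1]\oplus\mathcal A^*[d]$, $\overline{sa}^i\in\mathcal A[1]^{\otimes\bar x^i}$, $tf^i\in{}_{\mathrm{rt}(\bar x^{i+1})}\mathcal A^*_{\mathrm{lt}(\bar x^i)}[d]$: the $\mathcal A$-valued part of $\psi(w)$ is $(-1)^\epsilon\big(\bigotimes_{i=1}^{n-1}(f^i\circ s_d)\otimes s_d\big)\big(\phi^{(\bar x^1,\dots,\bar x^n)}(\overline{sa}^1,\dots,\overline{sa}^n)\big)$, $$\epsilon=\sum_{i=1}^{n-1}|tf^i|\sum_{j=i+1}^n|\overline{sa}^j|+|\phi|\sum_{i=1}^{n-1}|tf^i|+d(n-1)+\sum_{1\le i<j\le n}|\overline{sa}^i||\overline{sa}^j|+\sum_{1\le i<j\le n-1}|tf^i||tf^j|;$$ the $\mathcal A^*[d-1]$-valued part is zero for $n=1$ and for $n\ge2$ is the form whose value on $s_{1-d}b$, for $sb\in{}_{\mathrm{rt}(\bar x^1)}\mathcal A_{\mathrm{lt}(\bar x^n)}[1]$, is $$(-1)^\delta\big(\bigotimes_{i=1}^{n-1}(f^i\circ s_d)\big)\big(\phi^{(\bar x^1\sqcup\bar x^n,\bar x^2,\dots,\bar x^{n-1})}(\overline{sa}^1\otimes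 sb\otimes\overline{sa}^n,\overline{sa}^2,\dots,\overline{sa}^{n-1})\big),$$ $$\delta=\epsilon+d\big(|\phi|+\sum_{i=1}^n|\overline{sa}^i|\big)+(|\overline{sa}^n|+|sb|)\sum_{i=2}^{n-1}|\overline{sa}^i|+|\overline{sa}^n||sb|.$$ Same for $\mathcal B$. **Strict morphisms; $\mathrm{SpCY}_d$.** A strict $d$-pre-Calabi-Yau morphism is a map $\Phi_0:\mathcal O_{\mathcal A}\to\mathcal O_{\mathcal B}$ and degree $0$ maps $\Phi^{x,y}:{}_x\mathcal A_y[1]\to{}_{\Phi_0(x)}\mathcal B_{\Phi_0(y)}[1]$ (together denoted $s_{d+1}\Phi$) with $$(\Phi^{\mathrm{lt}(\bar x^1),\mathrm{rt}(\bar x^2)}\otimes\cdots\otimes\Phi^{\mathrm{lt}(\bar x^n),\mathrm{rt}(\bar x^1)})\circ s_{d+1}M_{\mathcal A}^{\bar{\bar x}}=s_{d+1}M_{\mathcal B}^{\Phi_0(\bar{\bar x})}\circ(\Phi^{\otimes(\lg(\bar x^1)-1)}\otimes\cdots\otimes\Phi^{\otimes(\lg(\bar x^n)-1)})$$ for all types (shifts of $\Phi$ understood on outputs). $\tilde\Phi:{}_x\mathcal A_y\to{}_{\Phi_0(x)}\mathcal B_{\Phi_0(y)}$ is the corresponding unshifted map. $\mathrm{SpCY}_d$ is the category of $d$-pre-Calabi-Yau categories and strict morphisms, composed by composing the maps on objects and the maps $\Phi^{x,y}$. **$\mathcal A\oplus\mathcal B^*[d-1]$ and bilinear forms.** For $\Phi_0:\mathcal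 O_{\mathcal A}\to\mathcal O_{\mathcal B}$, $\mathcal A\oplus\mathcal B^*[d-1]$ has objects $\mathcal O_{\mathcal A}$ and ${}_x(\mathcal A\oplus\mathcal B^*[d-1])_y={}_x\mathcal A_y\oplus{}_{\Phi_0(x)}\mathcal B^*_{\Phi_0(y)}[d-1]$. For a strict morphism and a word $w$ in elements $sa$ of $\mathcal A[1]$ and $tf$ of $\mathcal B^*[d]$: the $\mathcal A[1]$-valued part of $sm_{\mathcal A\oplus\mathcal B^*}(w)$ is the $\mathcal A[1]$-valued part of $sm_{\mathcal A\oplus\mathcal A^*}(w')$, $w'$ obtained by replacing each $tf$ by $t(f\circ\tilde\Phi)$; the $\mathcal B^*[d]$-valued part is the $\mathcal B^*[d]$-valued part of $sm_{\mathcal B\oplus\mathcal B^*}(w'')$, $w''$ obtained by replacing each $sa$ by $\Phi(sa)$. The natural bilinear form $\Gamma^{\mathcal A}$, used on $\mathcal A\oplus\mathcal A^*[d-1]$, is ${}_y\Gamma^{\mathcal A}_x(tf,sa)=-(-1)^{|sa||tf|}{}_x\Gamma^{\mathcal A}_y(sa,tf)=(-1)^{|tf|+1}f(a)$ for $f\in{}_y\mathcal A^*_x$, $a\in{}_x\mathcal A_y$, zero on pairs $(tf,tg)$, $(sa,sb)$. On $\mathcal A\oplus\mathcal B^*[d-1]$ with $sm_{\mathcal A\oplus\mathcal B^*}$ one uses the form $\Gamma^\Phi$, given by the same formulas with $f\in{}_{\Phi_0(y)}\mathcal B^*_{\Phi_0(x)}$ and $f(a)$ replaced by $f(\tilde\Phi(a))$.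 **Partial categories.** A partial category consists of a class of objects $\mathcal O$, a subclass $\mathcal O_2^{tr}\subseteq\mathcal O^2$ with a graded space ${}_y\mathcal A_x$ of morphisms for each $(x,y)\in\mathcal O_2^{tr}$, and a subclass $\mathcal O_3^{tr}\subseteq\mathcal O^3$ with an associative map ${}_z\mathcal A_y\otimes{}_y\mathcal A_x\to{}_z\mathcal A_x$ for each $(x,y,z)\in\mathcal O_3^{tr}$, where $(x,y,z)\in\mathcal O_3^{tr}$ implies $(x,y),(y,z),(x,z)\in\mathcal O_2^{tr}$. A functor between partial categories assigns objects to objects and to each morphism $f:x\to y$ a morphism between the images, such that if $f:x\to y$ and $g:y\to z$ are composable, then their images are composable and their composition is the image of $g\circ f$. **The partial category $\mathrm{Scyc}\widehat{A_\infty}_d$.** Objects: cyclic $A_\infty$-categories of the form $\mathcal A\oplus\mathcal A^*[d-1]$. A morphism from $\mathcal A\oplus\mathcal A^*[d-1]$ to $\mathcal B\oplus\mathcal B^*[d-1]$ (over a map $\Phi_0:\mathcal O_{\mathcal A}\to\mathcal O_{\mathcal B}$) is a triple $(sm_{\mathcal A\oplus\mathcal B^*},s\varphi_{\mathcal A},s\varphi_{\mathcal B})$ with $sm_{\mathcal A\oplus\mathcal B^*}$ an almost cyclic $A_\infty$-structure on $\mathcal A\oplus\mathcal B^*[d-1]$, and $(\mathrm{id},s\varphi_{\mathcal A})$, $(\Phi_0,s\varphi_{\mathcal B})$ strict cyclic $A_\infty$-morphisms from it to $\mathcal A\oplus\mathcal A^*[d-1]$ and $\mathcal B\oplus\mathcal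 B^*[d-1]$ respectively. Morphisms $(sm_{\mathcal A\oplus\mathcal B^*},s\varphi_{\mathcal A},s\varphi_{\mathcal B})$ and $(sm_{\mathcal B\oplus\mathcal C^*},s\psi_{\mathcal B},s\psi_{\mathcal C})$ are composable if there is a triple $(sm_{\mathcal A\oplus\mathcal C^*},s\chi_{\mathcal A},s\chi_{\mathcal C})$ where $sm_{\mathcal A\oplus\mathcal C^*}$ is an $A_\infty$-structure on $\mathcal A\oplus\mathcal C^*[d-1]$ (formed with the composite map on objects) and $s\chi_{\mathcal A}:\mathcal A\oplus\mathcal C^*[d-1]\to\mathcal A\oplus\mathcal B^*[d-1]$, $s\chi_{\mathcal C}:\mathcal A\oplus\mathcal C^*[d-1]\to\mathcal B\oplus\mathcal C^*[d-1]$ are $A_\infty$-morphisms with $s\varphi_{\mathcal B}\circ s\chi_{\mathcal A}=s\psi_{\mathcal B}\circ s\chi_{\mathcal C}$; the composition is then given by $(sm_{\mathcal A\oplus\mathcal C^*},s\varphi_{\mathcal A}\circ s\chi_{\mathcal A},s\psi_{\mathcal C}\circ s\chi_{\mathcal C})$.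
   Formalization: Objects are shown to be cyclic only if all hom spaces are finite-dimensional in each degree (else the form is degenerate); in general they are almost cyclic. In j, s_{d-1}g is viewed as a form with sign (-1)^{(d-1)|s_{d-1}g|}, not (-1)^{(d-1)|g|}, as the latter fails for even d. *)

(* Defs.v *)
From HB Require Import structures.
From mathcomp Require Import all_boot all_order all_algebra.
From mathcomp Require Import boolp functions.
From Stdlib Require List.

Set Implicit Arguments.
Unset Strict Implicit.
Unset Printing Implicit Defensive.

Import GRing.Theory.
Local Open Scope ring_scope.

(* Conventions.  A graded space is a family [int -> lmodType k].  A shift is
   the identity on underlying sets, so shifted spaces are never introduced: an
   element of degree [n] of [V] has degree [n - 1] in V[1], [n + d] in V[-d],
   [n - d] in V[d], and these are the degrees that enter the Koszul signs. *)

Definition sgn (k : fieldType) (e : int) : k := (-1) ^+ `|e|%N.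
Arguments sgn {k} e.

Section Dual.
Variables (k : fieldType) (V : lmodType k).

Definition linear_form : {pred V -> k^o} := fun f => `[< linear f >].

Fact linear_form_submod_closed : submod_closed linear_form.
Proof.
split; first by apply/asboolP => c u v; rewrite /GRing.zero /= scaler0 addr0.
move=> c f g /asboolP fl /asboolP gl; apply/asboolP => e u v.
rewrite !fctE /= fl gl !scalerDr !scalerA (mulrC c) -!addrA.
by congr (_ + _); rewrite addrCA.
Qed.

HB.instance Definition _ :=
  GRing.isSubmodClosed.Build k (V -> k^o) linear_form linear_form_submod_closed.

Record dual := Dual {
  dual_fun :> V -> k^o;
  _ : dual_fun \in linear_form }.

HB.instance Definition _ := [isSub for dual_fun].
HB.instance Definition _ := [Choice of dual by <:].
HB.instance Definition _ := [SubChoice_isSubLmodule of dual by <:].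

(* The linear form with underlying function [h]; 0 if [h] is not linear. *)
Definition to_dual (h : V -> k^o) : dual := insubd 0 h.

End Dual.

Section Quivers.
Variable k : fieldType.

(* [Q x y n] is the degree [n] part of {}_xQ_y. *)
Record quiver := Quiver {
  ob : Type;
  qhom :> ob -> ob -> int -> lmodType k }.

(* A homogeneous element of {}_xQ_y, with its indices. *)
Record letter (Q : quiver) := Letter {
  lsrc : ob Q;
  ltgt : ob Q;
  ldeg : int;
  lelt : Q lsrc ltgt ldeg }.
Arguments Letter {Q lsrc ltgt ldeg} lelt.

(* The component of a letter in [Q x y n]: the [v] with [a = Letter v] if it
   exists, and 0 otherwise. *)
Definition lcomp (Q : quiver) (a : letter Q) (x y : ob Q) (n : int) : Q x y n :=
  match pselect (exists v : Q x y n, a = Letter v) with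
  | left e => projT1 (cid e)
  | right _ => 0
  end.

Section Words.
Variable Q : quiver.
Implicit Types (x y : ob Q) (w : seq (letter Q)).

Fixpoint composable x w y : Prop :=
  if w is a :: w' then lsrc a = x /\ composable (ltgt a) w' y else x = y.

Definition wend x w : ob Q := last x (map (@ltgt Q) w).

(* total degree in Q[1]^{\otimes} *)
Definition wdeg w : int := \sum_(a <- w) (ldeg a - 1).

End Words.

(* A^*, with {}_xA^*_y the graded dual of {}_yA_x: forms of degree [n] live on the
   part of degree [- n]. *)
Definition dual_quiver (A : quiver) : quiver :=
  @Quiver (ob A) (fun x y n => dual (A y x (- n))).

(* [f] on an element of arbitrary degree (forms of degree [m] vanish outside
   degree [- m]). *)
Definition dual_eval (A : quiver) (f : letter (dual_quiver A)) (a : letter A)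
  : k := lelt f (lcomp a (ltgt f) (lsrc f) (- ldeg f)).

(* A \oplus B^*[d-1] over a map F0 on objects *)
Definition sum_dual (d : int) (A B : quiver) (F0 : ob A -> ob B) : quiver :=
  @Quiver (ob A) (fun x y n =>
    (A x y n * dual_quiver B (F0 x) (F0 y) (n + (d - 1))%R)%type).

(* A family of maps Q[1]^{\otimes n} -> R[1]; [f w x y n] is the component in
   [R (F0 x) (F0 y) n] of the value on [w].  Only nonempty words [w] composable
   from [x] to [y] matter. *)
Definition op (Q R : quiver) (F0 : ob Q -> ob R) :=
  seq (letter Q) -> forall (x y : ob Q) (n : int), R (F0 x) (F0 y) n.

Section Operations.
Variables (Q R : quiver) (F0 : ob Q -> ob R).

Definition is_op (r : int) (f : op F0) : Prop :=
  (forall w1 w2 (u v : ob Q) (n : int) (c : k) (a b : Q u v n) x y m,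
     composable x (w1 ++ Letter a :: w2) y ->
     f (w1 ++ Letter (c *: a + b) :: w2) x y m =
       c *: f (w1 ++ Letter a :: w2) x y m + f (w1 ++ Letter b :: w2) x y m)
  /\ (forall w x y m, (0 < size w)%N -> composable x w y ->
        m - 1 <> wdeg w + r -> f w x y m = 0).

Definition op_eq (f g : op F0) : Prop :=
  forall w x y m, (0 < size w)%N -> composable x w y -> f w x y m = g w x y m.

(* The value on a word starting at [x], as a letter, for [f] of degree [r]. *)
Definition out_letter (r : int) (f : op F0) (x : ob Q) (w : seq (letter Q))
  : letter R := Letter (f w x (wend x w) (wdeg w + r + 1)).

(* f \otimes ... \otimes f on consecutive blocks, [f] of degree 0 *)
Fixpoint out_letters (f : op F0) (x : ob Q) (bs : seq (seq (letter Q)))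
  : seq (letter R) :=
  if bs is b :: bs' then out_letter 0 f x b :: out_letters f (wend x b) bs'
  else [::].

Definition strict_op (L : forall x y n, Q x y n -> R (F0 x) (F0 y) n) : op F0 :=
  fun w x y n => if w is [:: a] then L x y n (lcomp a x y n) else 0.

Definition is_strict (f : op F0) : Prop :=
  forall w x y m, composable x w y -> (1 < size w)%N -> f w x y m = 0.

End Operations.

Fixpoint block_splits (T : Type) (s : seq T) : seq (seq (seq T)) :=
  if s is a :: s' then
    flatten [seq ([:: a] :: bs) ::
                 (if bs is b :: bs' then [:: (a :: b) :: bs'] else [::])
            | bs <- block_splits s']
  else [:: [::]].

Definition op_comp (Q R S : quiver) (F0 : ob Q -> ob R) (G0 : ob R -> ob S)
    (g : op G0) (f : op F0) : op (fun x => G0 (F0 x)) :=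
  fun w x y n =>
    \sum_(bs <- block_splits w) g (out_letters f x bs) (F0 x) (F0 y) n.

(* \sum f \circ (id \otimes sm \otimes id) *)
Definition insert_sum (Q R : quiver) (F0 : ob Q -> ob R) (f : op F0)
    (sm : @op Q Q id) : op F0 :=
  fun w x y n =>
    \sum_(i < size w) \sum_(j < (size w).+1 | (i < j)%N)
      sgn (wdeg (take i w)) *:
        f (take i w ++
           out_letter 1 sm (wend x (take i w)) (drop i (take j w)) :: drop j w)
          x y n.

Definition is_Ainf (Q : quiver) (sm : @op Q Q id) : Prop :=
  is_op 1 sm /\
  forall w x y n, (0 < size w)%N -> composable x w y ->
    insert_sum sm sm w x y n = 0.

Definition is_Ainf_mor (Q R : quiver) (smQ : @op Q Q id) (smR : @op R R id)
    (F0 : ob Q -> ob R) (f : op F0) : Prop :=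
  is_op 0 f /\ op_eq (insert_sum f smQ) (op_comp smR f).

(* {}_xGamma_y : {}_xQ_y[1] \otimes {}_yQ_x[1] -> k *)
Definition form (Q : quiver) :=
  forall (x y : ob Q) (m n : int), Q x y m -> Q y x n -> k.

Section Forms.
Variable Q : quiver.

(* a bilinear form of degree [e]: its components have degree [e + 2] *)
Definition is_form (e : int) (G : form Q) : Prop :=
  [/\ forall x y m n (c : k) (a a' : Q x y m) (b : Q y x n),
        G x y m n (c *: a + a') b = c * G x y m n a b + G x y m n a' b,
      forall x y m n (c : k) (a : Q x y m) (b b' : Q y x n),
        G x y m n a (c *: b + b') = c * G x y m n a b + G x y m n a b'
    & forall x y m n (a : Q x y m) (b : Q y x n),
        (m - 1) + (n - 1) + (e + 2) <> 0 -> G x y m n a b = 0].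

(* For [G] of degree [e], a |-> G(a, -) maps {}_xQ_y in degree [m] to forms on
   {}_yQ_x in degree [n] with (m - 1) + (n - 1) + (e + 2) = 0. *)
Definition nondegenerate (e : int) (G : form Q) : Prop :=
  forall x y m n, (m - 1) + (n - 1) + (e + 2) = 0 ->
  forall g : dual (Q y x n),
    exists! a : Q x y m, forall b : Q y x n, G x y m n a b = g b.

(* the form on letters, [a] running from [x] to [y] and [b] from [y] to [x] *)
Definition form_letters (G : form Q) (a b : letter Q) (x y : ob Q) : k :=
  G x y (ldeg a) (ldeg b) (lcomp a x y (ldeg a)) (lcomp b y x (ldeg b)).

(* q_1, ..., q_{n-1} is [rcons w p], with [p] from [u] to [y], and q_n is [q] *)
Definition almost_cyclic (G : form Q) (sm : @op Q Q id) : Prop :=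
  forall (w : seq (letter Q)) (p q : letter Q) (x u y : ob Q),
    composable x w u -> composable u [:: p] y -> composable y [:: q] x ->
    form_letters G (out_letter 1 sm x (rcons w p)) q x y =
      sgn ((ldeg q - 1) * wdeg (rcons w p)) *
      form_letters G (out_letter 1 sm y (q :: w)) p y u.

End Forms.

Definition is_cyclic_mor (Q R : quiver) (g : form Q) (G : form R)
    (F0 : ob Q -> ob R) (f : op F0) : Prop :=
  (forall x y m n (a : Q x y m) (b : Q y x n),
     form_letters G (out_letter 0 f x [:: Letter a])
       (out_letter 0 f y [:: Letter b]) (F0 x) (F0 y) = g x y m n a b)
  /\ (forall (w : seq (letter Q)) x, (2 < size w)%N -> composable x w x ->
        \sum_(1 <= i < size w)
          form_letters G (out_letter 0 f x (take i w))
            (out_letter 0 f (wend x (take i w)) (drop i w))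
            (F0 x) (F0 (wend x (take i w))) = 0).

Section Tensors.
Variable A : quiver.

(* Formal linear combinations of pure tensors of homogeneous elements; two of
   them are equal as tensors iff every multilinear map agrees on them (the
   universal property). *)
Definition tensor := seq (k * seq (letter A)).

Definition multilinear (W : lmodType k) (h : seq (letter A) -> W) : Prop :=
  forall s1 s2 x y n (c : k) (u v : A x y n),
    h (s1 ++ Letter (c *: u + v) :: s2) =
      c *: h (s1 ++ Letter u :: s2) + h (s1 ++ Letter v :: s2).

Definition teval (W : lmodType k) (h : seq (letter A) -> W) (t : tensor) : W :=
  \sum_(p <- t) p.1 *: h p.2.

Definition teq (t t' : tensor) : Prop :=
  forall (W : lmodType k) (h : seq (letter A) -> W),
    multilinear h -> teval h t = teval h t'.

Definition tscale (c : k) (t : tensor) : tensor :=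
  [seq (c * p.1, p.2) | p <- t].

End Tensors.

Definition tmap (A B : quiver) (h : letter A -> letter B) (t : tensor A)
  : tensor B := [seq (p.1, map h p.2) | p <- t].

(* Parity of the Koszul sign of a rearrangement: the graded items are listed in
   their initial order, each with its rank in the final order. *)
Fixpoint koszul (s : seq (nat * int)) : int :=
  if s is p :: s' then
    \sum_(q <- s' | (q.1 < p.1)%N) p.2 * q.2 + koszul s'
  else 0.

Fixpoint picks (T : Type) (s : seq T) : seq (seq T * T * seq T) :=
  if s is a :: s' then
    ([::], a, s') :: [seq (a :: p.1.1, p.1.2, p.2) | p <- picks s']
  else [::].

Section PreCalabiYau.
Variables (d : int) (A : quiver).

(* An input block: the first object of the tuple and a word starting there. *)
Definition block := (ob A * seq (letter A))%type.
Implicit Types (X Z : seq block) (b : block) (o : seq (letter A)).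

Definition bend b : ob A := wend b.1 b.2.
Definition bdeg b : int := wdeg b.2.
Definition bsdeg X : int := \sum_(b <- X) bdeg b.

(* total degree in A[-d]^{\otimes} *)
Definition odeg o : int := \sum_(a <- o) (ldeg a + d).

Definition is_input X : Prop :=
  [/\ (0 < size X)%N,
      List.Forall (fun b => composable b.1 b.2 (bend b)) X
    & size X = 1%N -> (0 < size (flatten (map snd X)))%N].

(* (lt(x^i), rt(x^{i+1})) for i = 1, ..., n *)
Definition out_slots X : seq (ob A * ob A) :=
  zip (map fst X) (rot 1 (map bend X)).

Definition multi := seq block -> tensor A.

(* [F] represents a homogeneous element of degree [p] of Multi_d(A). *)
Definition is_multi (p : int) (F : multi) : Prop :=
  (forall X, is_input X ->
     List.Forall (fun q : k * seq (letter A) =>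
        map (fun a => (lsrc a, ltgt a)) q.2 = out_slots X
        /\ odeg q.2 = bsdeg X + p) (F X))
  /\ (forall X1 X2 (x : ob A) (w1 w2 : seq (letter A)) u v n (c : k)
        (a a' : A u v n),
      is_input (X1 ++ (x, w1 ++ Letter a :: w2) :: X2) ->
      teq (F (X1 ++ (x, w1 ++ Letter (c *: a + a') :: w2) :: X2))
          (tscale c (F (X1 ++ (x, w1 ++ Letter a :: w2) :: X2))
           ++ F (X1 ++ (x, w1 ++ Letter a' :: w2) :: X2))).

Definition tau_out (t : tensor A) : tensor A :=
  [seq (let o := take (size q.2).-1 q.2 in
        let z := drop (size q.2).-1 q.2 in
        (sgn (odeg o * odeg z) * q.1, z ++ o)) | q <- t].

Definition cyclically_invariant (F : multi) : Prop :=
  forall b X, is_input (b :: X) ->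
    teq (F (b :: X)) (tscale (sgn (bdeg b * bsdeg X)) (tau_out (F (rcons X b)))).

(* (id \otimes ... \otimes id \otimes s_{d+1}) \circ F *)
Definition bold_out (F : multi) : multi := fun X =>
  [seq (sgn ((d + 1) * odeg (take (size q.2).-1 q.2)) * q.1, q.2) | q <- F X].

Definition cuts b : seq (block * block) :=
  [seq ((b.1, take i b.2), (wend b.1 (take i b.2), drop i b.2))
  | i <- iota 0 (size b.2).+1].

(* [a] followed by [o] followed by [b] *)
Definition plug (a : block) o (b : block) : block := (a.1, a.2 ++ o ++ b.2).

(* The two-disc diagrams: the type of a diagram is obtained from the type of
   the F-disc by replacing the incoming arrow to which an outgoing arrow of the
   G-disc is connected.  If the bold output of a disc exists it is taken to be
   the last one, which fixes its labelling. *)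

(* The root is on the F-disc, and the G-disc has one outgoing arrow: the type is
   W1, (a y b), W2, with y the input of the G-disc. *)
Definition nec_inner (F G : multi) (W1 : seq block) (a y b : block)
    (W2 : seq block) : tensor A :=
  flatten [seq
    [seq (sgn (koszul [:: (1%N, bsdeg W1); (2%N, bdeg a); (0%N, bdeg y); (3%N, bdeg b);
                          (4%N, bsdeg W2)]
               + koszul [:: (2%N, wdeg g.2); (0%N, bsdeg W1); (1%N, bdeg a);
                            (3%N, bdeg b); (4%N, bsdeg W2)])
          * g.1 * f.1, f.2)
    | f <- bold_out F (W1 ++ plug a g.2 b :: W2)]
  | g <- bold_out G [:: y]].

(* The root is on the F-disc, and the G-disc has m >= 2 outgoing arrows, the
   last one being connected: the type is W1, (y b), Wm, (a y'), W2, with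
   y, Wm, y' the inputs of the G-disc. *)
Definition nec_root_F (F G : multi) (W1 : seq block) (y b : block)
    (Wm : seq block) (a y' : block) (W2 : seq block) : tensor A :=
  flatten [seq
    (let g0 := take (size g.2).-1 g.2 in
     let o := drop (size g.2).-1 g.2 in
     [seq (let f1 := take (size W1) f.2 in
           let f2 := drop (size W1) f.2 in
           (sgn (koszul [:: (3%N, bsdeg W1); (0%N, bdeg y); (4%N, bdeg b);
                            (1%N, bsdeg Wm); (5%N, bdeg a); (2%N, bdeg y');
                            (6%N, bsdeg W2)]
                 + koszul [:: (5%N, odeg g0); (2%N, wdeg o); (0%N, bsdeg W1);
                              (3%N, bdeg b); (1%N, bdeg a); (4%N, bsdeg W2)]
                 + koszul [:: (0%N, odeg f1); (2%N, odeg f2 - (d + 1));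
                              (1%N, odeg g0)])
            * g.1 * f.1, f1 ++ g0 ++ f2))
     | f <- bold_out F (W1 ++ plug a o b :: W2)])
  | g <- bold_out G (y :: rcons Wm y')].

(* The root is on the G-disc: the type is W1, (a y), Wm, (y' b), W2, where
   W1, y, y', W2 are the inputs of the G-disc, whose outgoing arrow between y
   and y' is connected to the incoming arrow of the F-disc between a and b.
   [p] is the degree of [F]. *)
Definition nec_root_G (p : int) (F G : multi) (W1 : seq block) (a y : block)
    (Wm : seq block) (y' b : block) (W2 : seq block) : tensor A :=
  flatten [seq
    (let g1 := take (size W1) g.2 in
     let o := take 1 (drop (size W1) g.2) in
     let g2 := drop (size W1).+1 g.2 in
     [seq (sgn (koszul [:: (0%N, bsdeg W1); (4%N, bdeg a); (1%N, bdeg y);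
                           (6%N, bsdeg Wm); (2%N, bdeg y'); (5%N, bdeg b);
                           (3%N, bsdeg W2)]
                + koszul [:: (4%N, odeg g1); (1%N, odeg o);
                             (5%N, odeg g2 - (d + 1)); (0%N, bdeg a); (2%N, bdeg b);
                             (3%N, bsdeg Wm)]
                + (d + 1) * p + (p + d + 1) * (d + 1) + (d + 1) * bdeg a
                + koszul [:: (1%N, odeg f.2); (0%N, odeg g1);
                             (2%N, odeg g2 - (d + 1))])
           * g.1 * f.1, g1 ++ f.2 ++ g2)
     | f <- F (plug a o b :: Wm)])
  | g <- bold_out G (W1 ++ y :: y' :: W2)].

(* s_{d+1}F \circ_nec s_{d+1}G, for [F] of degree [p] *)
Definition nec (p : int) (F G : multi) : multi := fun Z =>
  flatten [seq flatten [seq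
             flatten [seq (if (0 < size yb.1.2)%N then
                        nec_inner F G q.1.1 ay.1 yb.1 yb.2 q.2 else [::])
                     | yb <- cuts ay.2]
             | ay <- cuts q.1.2]
          | q <- picks Z]
  ++
  flatten [seq flatten [seq flatten [seq flatten [seq
             nec_root_F F G q.1.1 c.1 c.2 r.1.1 c'.1 c'.2 r.2
             ++ nec_root_G p F G q.1.1 c.1 c.2 r.1.1 c'.1 c'.2 r.2
             | c' <- cuts r.1.2]
           | c <- cuts q.1.2]
         | r <- picks q.2]
       | q <- picks Z].

(* s_{d+1}M has degree 1, so M has degree d + 2. *)
Definition is_preCY (M : multi) : Prop :=
  [/\ is_multi (d + 2) M,
      cyclically_invariant M
    & forall Z, is_input Z -> teq (nec (d + 2) M M Z) [::]].

(* The structure j(s_{d+1}M) on A \oplus A^*[d-1] *)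

Definition AAdual : quiver := sum_dual d (@id (ob A)).

(* a letter sa or tf *)
Definition mletter := (letter A + letter (dual_quiver A))%type.

(* The word (sa^n, tf^{n-1}, ..., tf^1, sa^1) starting at [x] is cut into
   [:: sa^n; ...; sa^1] and [:: f^{n-1}; ...; f^1]. *)
Fixpoint parse (x : ob A) (w : seq mletter)
  : seq block * seq (letter (dual_quiver A)) :=
  match w with
  | [::] => ([:: (x, [::])], [::])
  | inl a :: w' =>
      let: (bs, fs) := parse (ltgt a) w' in
      (if bs is b :: bs' then (x, a :: b.2) :: bs' else [::], fs)
  | inr f :: w' =>
      let: (bs, fs) := parse (ltgt f) w' in ((x, [::]) :: bs, f :: fs)
  end.

(* the exponent epsilon, with al`_i = |sa^{i+1}| and ta`_i = |tf^{i+1}| *)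
Definition eps (p : int) (al ta : seq int) : int :=
  \sum_(i < size ta) ta`_i * (\sum_(i.+1 <= j < size al) al`_j)
  + p * (\sum_(i < size ta) ta`_i)
  + d * (size ta)%:Z
  + \sum_(j < size al) \sum_(i < j) al`_i * al`_j
  + \sum_(j < size ta) \sum_(i < j) ta`_i * ta`_j.

(* the exponent delta; [eb] is |sb| *)
Definition delta (p : int) (al ta : seq int) (eb : int) : int :=
  eps p al ta + d * (p + \sum_(i < size al) al`_i)
  + (al`_(size al).-1 + eb) * (\sum_(1 <= i < (size al).-1) al`_i)
  + al`_(size al).-1 * eb.

(* Parity of the Koszul sign of
   (g_1 \otimes ... \otimes g_n)(o_1 \otimes ... \otimes o_n), |g_i| = e`_i *)
Definition tensor_sign (e : seq int) o : int :=
  \sum_(i < size e) e`_i * odeg (take i o).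

Definition tdeg (f : letter (dual_quiver A)) : int := ldeg f - d.

Definition j_A (M : multi) (w : seq mletter) (x y : ob A) (n : int) : A x y n :=
  let bs := rev (parse x w).1 in
  let fs := rev (parse x w).2 in
  let ta := map tdeg fs in
  \sum_(q <- M bs)
    (sgn (eps (d + 2) (map bdeg bs) ta + tensor_sign (rcons ta (- d)) q.2)
     * q.1 * \prod_(r <- zip fs q.2) dual_eval r.1 r.2)
    *: (if drop (size fs) q.2 is [:: z] then lcomp z x y n else 0).

(* The component in ({}_xA^*_y)^m, that is, g with t g the A^*[d]-valued part.
   The form [s_{d-1} g] on A[1-d] is [s_{1-d} b |-> (-1)^{(d-1)|s_{d-1}g|} g(b)].
   The sign is computed with the degree of [s_{d-1} g]: with the degree of [g]
   instead, it would change by (-1)^{d-1}, and for even [d] the result would be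
   neither an A_infinity-structure nor almost cyclic. *)
Definition j_dual (M : multi) (w : seq mletter) (x y : ob A) (m : int)
  : dual_quiver A x y m :=
  let bs := rev (parse x w).1 in
  let fs := rev (parse x w).2 in
  let ta := map tdeg fs in
  if bs is b1 :: (_ :: _) as bs' then
    to_dual (fun v : A y x (- m) =>
      sgn ((d - 1) * (m - (d - 1))) *
      \sum_(q <- M (plug b1 [:: Letter v] (last b1 bs')
                    :: behead (belast b1 bs')))
        (sgn (delta (d + 2) (map bdeg bs) ta (- m - 1) + tensor_sign ta q.2)
         * q.1 * \prod_(r <- zip fs q.2) dual_eval r.1 r.2))
  else 0.

(* multilinear expansion of a word in A \oplus A^*[d-1] *)
Fixpoint expand (w : seq (letter AAdual)) : seq (seq mletter) :=
  if w is a :: w' then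
    [seq c :: v
    | c <- [:: inl (Letter (lelt a).1);
               inr (@Letter (dual_quiver A) _ _ _ (lelt a).2)],
      v <- expand w']
  else [:: [::]].

Definition j_op (M : multi) : @op AAdual AAdual id := fun w x y n =>
  (\sum_(v <- expand w) j_A M v x y n,
   \sum_(v <- expand w) j_dual M v x y (n + (d - 1))).

(* Finite-dimensional in each degree: as V^{**} is then V, this is what makes the
   natural form on A \oplus A^*[d-1] nondegenerate. *)
Definition locally_finite : Prop :=
  forall (x y : ob A) (n : int), exists s : seq (A x y n),
    forall v, exists c : 'I_(size s) -> k, v = \sum_(i < size s) c i *: s`_i.

End PreCalabiYau.

Definition map_letter (A B : quiver) (F0 : ob A -> ob B)
    (F : forall x y n, A x y n -> B (F0 x) (F0 y) n) (a : letter A) : letter B :=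
  Letter (F _ _ _ (lelt a)).

Definition map_block (A B : quiver) (F0 : ob A -> ob B)
    (F : forall x y n, A x y n -> B (F0 x) (F0 y) n) (b : block A) : block B :=
  (F0 b.1, map (map_letter F) b.2).

Record preCY_cat (d : int) := PreCYCat {
  pq :> quiver;
  pm : multi pq;
  pmP : is_preCY d pm }.

Record strict_mor (d : int) (A B : preCY_cat d) := StrictMor {
  sob : ob A -> ob B;
  smap : forall x y n, {linear A x y n -> B (sob x) (sob y) n};
  smapP : forall X : seq (block A), is_input X ->
    teq (tmap (map_letter smap) (pm X)) (pm (map (map_block smap) X)) }.

Section StrictComp.
Variables (d : int) (A B C : preCY_cat d).
Variables (f : strict_mor A B) (g : strict_mor B C).

Definition sob_comp (x : ob A) : ob C := sob g (sob f x).

Definition smap_comp (x y : ob A) (n : int)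
  : {linear A x y n -> C (sob_comp x) (sob_comp y) n} :=
  smap g (sob f x) (sob f y) n \o smap f x y n.

Lemma composable_map (x y : ob A) (w : seq (letter A)) :
  composable x w y ->
  composable (sob f x) (map (map_letter (smap f)) w) (sob f y).
Proof.
by elim: w x => [x ->|a w IH x [<- /IH h]].
Qed.

Lemma bend_map (b : block A) :
  bend (map_block (smap f) b) = sob f (bend b).
Proof. by case: b => x w; rewrite /bend /wend /=; elim: w x => //= a w IH x. Qed.

Lemma is_input_map (X : seq (block A)) :
  is_input X -> is_input (map (map_block (smap f)) X).
Proof.
case=> X0 XF X1; split; first by rewrite size_map.
  by elim: XF {X0 X1} => //= b {}X bP _ IH; constructor=> //;
    rewrite bend_map; apply: composable_map.
rewrite size_map => {}/X1; rewrite -map_comp.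
have -> : [seq (snd \o map_block (smap f)) i | i <- X] =
          map (map (map_letter (smap f))) (map snd X) by rewrite -map_comp.
by rewrite -map_flatten size_map.
Qed.

Lemma strict_compP (X : seq (block A)) : is_input X ->
  teq (tmap (map_letter smap_comp) (pm X)) (pm (map (map_block smap_comp) X)).
Proof.
move=> XP W h hl.
have -> : map (map_block smap_comp) X =
          map (map_block (smap g)) (map (map_block (smap f)) X).
  by rewrite -map_comp; apply: eq_map => -[x w]; rewrite /map_block /= -map_comp.
rewrite -(@smapP _ _ _ g _ (is_input_map XP) _ _ hl) /teval !big_map /=.
pose h' (s : seq (letter B)) := h (map (map_letter (smap g)) s).
have h'l : multilinear h'.
  move=> s1 s2 x y n c u v; rewrite /h' !map_cat /= -hl.
  by congr (h (_ ++ _ :: _)); rewrite /map_letter /= linearP.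
have := @smapP _ _ _ f _ XP _ _ h'l; rewrite /teval big_map /= => <-.
by apply: eq_bigr => q _; rewrite /h' -map_comp.
Qed.

Definition strict_comp : strict_mor A C := StrictMor strict_compP.

End StrictComp.

(* [pcomp f g h]: [f] and [g] are composable and [h] is their composition. *)
Record partial_category := PartialCategory {
  pob : Type;
  pmor : pob -> pob -> Type;
  pcomp : forall x y z, pmor x y -> pmor y z -> pmor x z -> Prop }.

Definition is_functor (C D : partial_category) (S0 : pob C -> pob D)
    (S1 : forall x y, pmor x y -> pmor (S0 x) (S0 y)) : Prop :=
  forall x y z (f : pmor x y) (g : pmor y z) (h : pmor x z),
    pcomp f g h -> pcomp (S1 _ _ f) (S1 _ _ g) (S1 _ _ h).

Definition full_sub (C : partial_category) (P : pob C -> Prop)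
  : partial_category :=
  @PartialCategory {x : pob C | P x} (fun x y => pmor (sval x) (sval y))
    (fun x y z f g h => pcomp f g h).

Definition SpCY (d : int) : partial_category :=
  @PartialCategory (preCY_cat d) (@strict_mor d)
    (fun A B C f g h => h = strict_comp f g).

Section Scyc.
Variable d : int.

(* The form Gamma^F on A \oplus B^*[d-1], for F : A -> B over F0. *)
Definition natural_form (A B : quiver) (F0 : ob A -> ob B)
    (F : forall x y n, A x y n -> B (F0 x) (F0 y) n) : form (sum_dual d F0) :=
  fun x y m n p q =>
    sgn ((m - 1) + 1)
      * dual_eval (@Letter (dual_quiver B) (F0 x) (F0 y) _ p.2)
          (Letter (F _ _ _ q.1))
    - sgn ((m - 1) * (n - 1)) * sgn ((n - 1) + 1)
      * dual_eval (@Letter (dual_quiver B) (F0 y) (F0 x) _ q.2)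
          (Letter (F _ _ _ p.1)).

(* the natural form Gamma^A, of degree d - 1 *)
Definition Gamma (A : quiver) : form (AAdual d A) :=
  @natural_form A A id (fun x y n => id).

Definition is_almost_cyclic_Ainf (Q : quiver) (G : form Q) (sm : @op Q Q id)
  : Prop :=
  [/\ exists e, is_form e G, is_Ainf sm & almost_cyclic G sm].

(* Almost cyclic A_infinity-categories of the form A \oplus A^*[d-1]. *)
Record acyc_cat := AcycCat {
  aq :> quiver;
  asm : @op (AAdual d aq) (AAdual d aq) id;
  asmP : is_almost_cyclic_Ainf (@Gamma aq) asm }.

Definition is_cyclic (X : acyc_cat) : Prop :=
  exists2 e, is_form e (@Gamma X) & nondegenerate e (@Gamma X).

(* (sm_{A \oplus B^*}, s phi_A, s phi_B), together with the form with respect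
   to which sm_{A \oplus B^*} is almost cyclic *)
Record span (A B : quiver) (F0 : ob A -> ob B) := Span {
  sp_form : form (sum_dual d F0);
  sp_sm : @op (sum_dual d F0) (sum_dual d F0) id;
  sp_l : @op (sum_dual d F0) (AAdual d A) id;
  sp_r : @op (sum_dual d F0) (AAdual d B) F0 }.

Definition is_scyc_mor (X Y : acyc_cat) (F0 : ob X -> ob Y) (T : span F0)
  : Prop :=
  [/\ is_almost_cyclic_Ainf (sp_form T) (sp_sm T),
      [/\ is_Ainf_mor (sp_sm T) (@asm X) (sp_l T), is_strict (sp_l T)
        & is_cyclic_mor (sp_form T) (@Gamma X) (sp_l T)]
    & [/\ is_Ainf_mor (sp_sm T) (@asm Y) (sp_r T), is_strict (sp_r T)
        & is_cyclic_mor (sp_form T) (@Gamma Y) (sp_r T)]].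

Definition scyc_mor (X Y : acyc_cat) : Type :=
  {F0 : ob X -> ob Y & {T : span F0 | is_scyc_mor T}}.

Inductive scyc_comp (X Y Z : acyc_cat)
  : scyc_mor X Y -> scyc_mor Y Z -> scyc_mor X Z -> Prop :=
| ScycComp (F0 : ob X -> ob Y) (G0 : ob Y -> ob Z)
    (T : {T : span F0 | is_scyc_mor T}) (U : {U : span G0 | is_scyc_mor U})
    (V : {V : span (fun x => G0 (F0 x)) | is_scyc_mor V})
    (chi_l : @op (sum_dual d (fun x => G0 (F0 x))) (sum_dual d F0) id)
    (chi_r : @op (sum_dual d (fun x => G0 (F0 x))) (sum_dual d G0) F0) :
    is_Ainf_mor (sp_sm (sval V)) (sp_sm (sval T)) chi_l ->
    is_Ainf_mor (sp_sm (sval V)) (sp_sm (sval U)) chi_r ->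
    op_eq (op_comp (sp_r (sval T)) chi_l) (op_comp (sp_l (sval U)) chi_r) ->
    op_eq (sp_l (sval V)) (op_comp (sp_l (sval T)) chi_l) ->
    op_eq (sp_r (sval V)) (op_comp (sp_r (sval U)) chi_r) ->
    scyc_comp (existT _ F0 T) (existT _ G0 U) (existT _ _ V).

(* Scyc A_infinity_d without the nondegeneracy of the forms of the objects. *)
Definition SacycAinf : partial_category :=
  @PartialCategory acyc_cat scyc_mor scyc_comp.

Definition ScycAinf : partial_category := @full_sub SacycAinf is_cyclic.

Section SpanOfStrict.
Variables (A B : preCY_cat d) (f : strict_mor A B).

Definition ABdual : quiver := sum_dual d (sob f).

(* f \circ \tilde\Phi *)
Definition pull_dual (x y : ob A) (m : int)
    (g : dual_quiver B (sob f x) (sob f y) m) : dual_quiver A x y m :=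
  to_dual (fun v : A y x (- m) => g (smap f y x (- m) v)).

(* (sa, tf) |-> (sa, t(f \circ \tilde\Phi)) *)
Definition phi_l_lin (x y : ob A) (n : int) (v : ABdual x y n)
  : AAdual d A x y n := (v.1, pull_dual v.2).

(* (sa, tf) |-> (\Phi(sa), tf) *)
Definition phi_r_lin (x y : ob A) (n : int) (v : ABdual x y n)
  : AAdual d B (sob f x) (sob f y) n := (smap f x y n v.1, v.2).

Definition sm_AB : @op ABdual ABdual id := fun w x y n =>
  ((j_op (@pm d A)
      (map (@map_letter ABdual (AAdual d A) id phi_l_lin) w) x y n).1,
   (j_op (@pm d B)
      (map (@map_letter ABdual (AAdual d B) (sob f) phi_r_lin) w)
      (sob f x) (sob f y) n).2).

Definition strict_span : span (sob f) :=
  @Span A B (sob f)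
    (natural_form (fun x y n => smap f x y n)) sm_AB
    (@strict_op ABdual (AAdual d A) id phi_l_lin)
    (@strict_op ABdual (AAdual d B) (sob f) phi_r_lin).

End SpanOfStrict.

End Scyc.
End Quivers.

(* Main.v *)
Require Import Defs.
From mathcomp Require Import all_boot all_order all_algebra.
From mathcomp Require Import boolp functions.
From mathcomp Require Import zify ring.
From Stdlib Require List.

Set Implicit Arguments.
Unset Strict Implicit.
Unset Printing Implicit Defensive.

Import GRing.Theory.
Local Open Scope ring_scope.


(** The value of [j M] on a word [(sa^n, tf^{n-1}, ..., tf^1, sa^1)] is, up to
    sign, the contraction of the tensor [M (sa^1, ..., sa^n)] with the forms
    [f^1, f^2, ...].  A contraction vanishes unless the degrees of the outputs
    of [M] are opposite to those of the forms, so every Koszul sign occurring in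
    [j] or in the necklace product becomes, on the terms that contribute, a
    function of the word alone ([multi_sign]); after this the exponents of [j]
    collapse to the short ones [jsign] and [dual_sign] ([j_A_eff],
    [j_dual_eff]).

    The [A]-valued part of the A_infinity-relation on a word is a sum over the
    ways to cut the word in three, the middle piece being replaced by its
    operation.  The diagrams of the necklace product with the blocks of the word
    as inputs are counted by the same cuts ([nec_splits]): an [A]-valued middle
    operation is a disc whose last output is plugged into the disc containing
    the root, and a dual-valued one is a disc receiving an output of the disc
    containing the root.  The signs agree up to one that depends on the whole
    word only ([plugged_diagram]), so the [A]-valued part of the relation is a
    contraction of [nec M M] and vanishes ([pure_relation],
    [insert_sum_j_fst]).

    The natural form paired with an operation is a contraction of [M] along a
    cyclic word, and rotating the word rotates the inputs of [M] at most once;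
    this turns the cyclic invariance of [M] into almost cyclicity
    ([pairing_cyclic], [j_op_almost_cyclic]).  Almost cyclicity propagates to the
    relation ([insert_sum_cyclic]), which gives its dual-valued part: since the
    [A]-valued part is zero, the relation paired with a last letter only sees the
    component of that letter in [A].  Rotating through the whole word one may
    thus replace every letter by its component in [A], and operations on such
    words have no dual-valued part ([Gamma_insert_sum], [j_op_is_Ainf]).

    For a strict morphism, the two projections of [A \oplus B^*[d-1]] to
    [A \oplus A^*[d-1]] and [B \oplus B^*[d-1]] are jointly injective and, this
    being what strictness says after contraction, they commute with the
    operations ([phi_l_sm], [phi_r_sm]).  The relation, almost cyclicity and the
    morphism equations for the mixed structure are pulled back along them.  A
    composition of strict morphisms is witnessed by the two evident maps out of
    [A \oplus C^*[d-1]] ([strict_span_comp]).  Finally the natural form is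
    nondegenerate because locally finite spaces are reflexive ([bidual],
    [Gamma_nondegenerate]). *)

(** * Signs *)

Definition par (e : int) : bool := odd `|e|%N.

Lemma parD a b : par (a + b) = par a (+) par b.
Proof. rewrite /par; lia. Qed.

Lemma parN a : par (- a) = par a.
Proof. by rewrite /par abszN. Qed.

Lemma parM a b : par (a * b) = par a && par b.
Proof. by rewrite /par abszM oddM. Qed.

Lemma par_nat (n : nat) : par n%:Z = odd n.
Proof. by []. Qed.

Section Sgn.
Variable k : fieldType.

Lemma sgnE e : sgn e = (-1) ^+ par e :> k.
Proof. by rewrite /sgn /par signr_odd. Qed.

Lemma sgn_par a b : par a = par b -> sgn a = sgn b :> k.
Proof. by rewrite !sgnE => ->. Qed.

Lemma sgnD a b : sgn (a + b) = sgn a * sgn b :> k.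
Proof. by rewrite !sgnE parD signr_addb. Qed.

Lemma sgn0 : sgn 0 = 1 :> k.
Proof. by []. Qed.

Lemma sgn1 : sgn 1 = -1 :> k.
Proof. by rewrite sgnE. Qed.

Lemma sgn_opp a : - sgn a = sgn (a + 1) :> k.
Proof. by rewrite sgnD sgn1 mulrN1. Qed.

Lemma sgn_sq a : sgn a * sgn a = 1 :> k.
Proof. by rewrite -sgnD sgnE parD addbb. Qed.

Lemma sgn_neq0 a : sgn a != 0 :> k.
Proof. by rewrite sgnE signr_eq0. Qed.

End Sgn.

Definition forall_bool (f : bool -> bool) : bool := f true && f false.

Lemma forall_boolP f : forall_bool f -> forall b, f b.
Proof. by case/andP=> ft ff []. Qed.

Lemma eqb_eq (a b : bool) : a == b -> a = b.
Proof. by move/eqP. Qed.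

(** Decides an equality of parities by tabulating it over the parities of its
    atoms, each of which is abstracted in turn. *)
Ltac truth_table :=
  apply: eqb_eq;
  repeat match goal with |- context [par ?x] => generalize (par x); intro end;
  repeat match goal with b : bool |- _ => revert b; apply: forall_boolP end;
  by vm_compute.

Ltac parity :=
  rewrite ?(parD, parN, parM) -?[par 1]/true -?[par 0]/false -?[par 2]/false
          ?par_nat;
  truth_table.

(** * Letters and their components *)

Section Letters.
Variables (k : fieldType).

Section Components.
Variable Q : quiver k.

Definition transport (x x' y y' : ob Q) (n n' : int)
    (ex : x = x') (ey : y = y') (en : n = n') (v : Q x y n) : Q x' y' n' :=
  match ex in _ = x1, ey in _ = y1, en in _ = n1 return Q x1 y1 n1 with
  | erefl, erefl, erefl => v
  end.

(** The indices range over types without decidable equality, so the element is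
    recovered by transport along equations of indices, which are proof
    irrelevant. *)
Lemma Letter_inj (x y : ob Q) n (v v' : Q x y n) :
  Letter v = Letter v' -> v = v'.
Proof.
move=> e.
pose P (a : letter Q) := forall (ex : lsrc a = x) (ey : ltgt a = y)
  (en : ldeg a = n), transport ex ey en (lelt a) = v.
have Pv : P (Letter v).
  by move=> ex ey en; rewrite (Prop_irrelevance ex erefl)
    (Prop_irrelevance ey erefl) (Prop_irrelevance en erefl).
have Pv' : P (Letter v') by rewrite -e.
by rewrite -(Pv' erefl erefl erefl).
Qed.

Lemma lcomp_Letter (x y : ob Q) n (v : Q x y n) : lcomp (Letter v) x y n = v.
Proof.
rewrite /lcomp; case: pselect => [e|[]]; last by exists v.
by case: cid => v' /= /Letter_inj ->.
Qed.

Lemma Letter_lcomp (a : letter Q) x y n :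
  lsrc a = x -> ltgt a = y -> ldeg a = n -> Letter (lcomp a x y n) = a.
Proof. by case: a => x' y' n' v /= <- <- <-; rewrite lcomp_Letter. Qed.

Lemma lcomp_out (a : letter Q) x y n :
  ~ [/\ lsrc a = x, ltgt a = y & ldeg a = n] -> lcomp a x y n = 0.
Proof.
move=> h; rewrite /lcomp; case: pselect => // e.
by exfalso; apply: h; case: e => v ->.
Qed.

(** Components of letters are linear, whatever the indices: either the indices
    match, or both sides vanish. *)
Lemma lcomp_linear (u v : ob Q) n (c : k) (a b : Q u v n) x y m :
  lcomp (Letter (c *: a + b)) x y m =
    c *: lcomp (Letter a) x y m + lcomp (Letter b) x y m.
Proof.
case: (pselect [/\ u = x, v = y & n = m]) => [[ex ey en]|h].
  by case: x / ex; case: y / ey; case: m / en; rewrite !lcomp_Letter.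
by rewrite !lcomp_out // scaler0 addr0.
Qed.

Lemma lcomp0 (u v : ob Q) n x y m : lcomp (Letter (0 : Q u v n)) x y m = 0.
Proof.
have := lcomp_linear (-1) (0 : Q u v n) 0 x y m.
by rewrite scaler0 addr0 scaleN1r addNr.
Qed.

End Components.

Section Duals.
Variable V : lmodType k.

Lemma dual_linear (f : dual V) c u v : f (c *: u + v) = c * f u + f v.
Proof.
by case: f => f /= ff; have /asboolP fl : f \in @linear_form k V := ff; apply: fl.
Qed.

Lemma dual_ext (f g : dual V) : (forall v, f v = g v) -> f = g.
Proof. by move=> h; apply: val_inj; apply: funext. Qed.

Lemma dual_addE (f g : dual V) v : (f + g) v = f v + g v.
Proof. by rewrite -[LHS]/(val (f + g) v) raddfD. Qed.

Lemma dual_scaleE c (f : dual V) v : (c *: f) v = c * f v.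
Proof. by rewrite -[LHS]/(val (c *: f) v) linearZ. Qed.

Lemma dual_zeroE v : (0 : dual V) v = 0.
Proof. by rewrite -[LHS]/(val (0 : dual V) v) raddf0. Qed.

Lemma dual_sumE I (r : seq I) (P : pred I) (F : I -> dual V) v :
  (\sum_(i <- r | P i) F i) v = \sum_(i <- r | P i) F i v.
Proof.
elim/big_rec2: _ => [|i a b _ <-]; first exact: dual_zeroE.
exact: dual_addE.
Qed.

Lemma dual_zero (f : dual V) : f 0 = 0.
Proof.
have := dual_linear f (-1) 0 0.
by rewrite scaler0 addr0 mulN1r addNr.
Qed.

Lemma to_dualE (h : V -> k^o) v : linear h -> to_dual h v = h v.
Proof.
move=> hl; rewrite /to_dual -[LHS]/(val (insubd 0 h) v) insubdK //.
by apply/asboolP.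
Qed.

End Duals.

Section DualEval.
Variable A : quiver k.

Lemma dual_eval_linr (f : letter (dual_quiver A)) x y n c (u v : A x y n) :
  dual_eval f (Letter (c *: u + v)) =
    c * dual_eval f (Letter u) + dual_eval f (Letter v).
Proof. by rewrite /dual_eval lcomp_linear dual_linear. Qed.

Lemma dual_eval_linl x y n c (f g : dual_quiver A x y n) a :
  dual_eval (@Letter _ (dual_quiver A) _ _ _ (c *: f + g)) a =
    c * dual_eval (@Letter _ (dual_quiver A) _ _ _ f) a
    + dual_eval (@Letter _ (dual_quiver A) _ _ _ g) a.
Proof.
set v := lcomp a y x (- n).
by rewrite -[LHS]/((c *: (f : dual _) + g) v) dual_addE dual_scaleE.
Qed.

Lemma dual_eval0l x y n a :
  dual_eval (@Letter _ (dual_quiver A) x y n 0) a = 0.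
Proof. by apply: dual_zeroE. Qed.

Lemma dual_eval_out (f : letter (dual_quiver A)) (a : letter A) :
  dual_eval f a != 0 ->
  [/\ lsrc a = ltgt f, ltgt a = lsrc f & ldeg a = - ldeg f].
Proof.
move=> /eqP h; apply: contrapT => h'; apply: h.
by rewrite /dual_eval lcomp_out // dual_zero.
Qed.

End DualEval.

End Letters.


(** * Sums over lists *)

Lemma eq_big_Forall (T : Type) (V : nmodType) (P : T -> Prop) (s : seq T)
    (F G : T -> V) :
  List.Forall P s -> (forall x, P x -> F x = G x) ->
  \sum_(x <- s) F x = \sum_(x <- s) G x.
Proof.
by move=> h FG; elim: h => [|x l Px _ IH]; rewrite ?big_nil // !big_cons IH FG.
Qed.

Lemma linear_comb (k : fieldType) (V W : lmodType k) (F : V -> W) :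
  linear F -> forall I (r : seq I) (P : pred I) (c : I -> k) (v : I -> V),
  F (\sum_(i <- r | P i) c i *: v i) = \sum_(i <- r | P i) c i *: F (v i).
Proof.
move=> Fl I r P c v; elim/big_rec2: _ => [|i a b _ <-]; last exact: Fl.
by have := Fl (-1) 0 0; rewrite scaler0 addr0 scaleN1r addNr.
Qed.

Lemma linear_zero (k : fieldType) (V W : lmodType k) (F : V -> W) :
  linear F -> F 0 = 0.
Proof.
by move=> Fl; have := Fl (-1) 0 0; rewrite scaler0 addr0 scaleN1r addNr.
Qed.

Lemma linear_add (k : fieldType) (V W : lmodType k) (F : V -> W) :
  linear F -> forall u v, F (u + v) = F u + F v.
Proof. by move=> Fl u v; have := Fl 1 u v; rewrite !scale1r. Qed.

Lemma linear_scale (k : fieldType) (V W : lmodType k) (F : V -> W) :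
  linear F -> forall c u, F (c *: u) = c *: F u.
Proof.
by move=> Fl c u; have := Fl c u 0; rewrite !addr0 (linear_zero Fl) addr0.
Qed.

Lemma linear_bigsum (k : fieldType) (V W : lmodType k) (F : V -> W) :
  linear F -> forall I (r : seq I) (P : pred I) (v : I -> V),
  F (\sum_(i <- r | P i) v i) = \sum_(i <- r | P i) F (v i).
Proof.
move=> Fl I r P v; elim/big_rec2: _ => [|i a b _ <-]; first exact: linear_zero.
exact: linear_add.
Qed.

(** * Contracting tensors with linear forms *)

Section Contraction.
Variables (k : fieldType) (d : int) (A : quiver k).
Implicit Types (fs : seq (letter (dual_quiver A))) (o : seq (letter A)).

(** Contractions vanish on words of the wrong length, which makes them
    multilinear on all words and not only on the outputs of an operation. *)
Fixpoint contract fs o : k :=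
  match fs, o with
  | [::], [::] => 1
  | f :: fs', a :: o' => dual_eval f a * contract fs' o'
  | _, _ => 0
  end.

Fixpoint contract_last fs (x y : ob A) (n : int) o : A x y n :=
  match fs, o with
  | [::], [:: z] => lcomp z x y n
  | f :: fs', a :: o' => dual_eval f a *: contract_last fs' x y n o'
  | _, _ => 0
  end.

Lemma contractE fs o : size o = size fs ->
  contract fs o = \prod_(r <- zip fs o) dual_eval r.1 r.2.
Proof.
elim: fs o => [|f fs IH] [|a o] //= => [_|[/IH->]]; by rewrite ?big_nil // big_cons.
Qed.

Lemma contract_lastE fs x y n o :
  contract_last fs x y n o = (\prod_(r <- zip fs o) dual_eval r.1 r.2) *:
    (if drop (size fs) o is [:: z] then lcomp z x y n else 0).
Proof.
elim: fs o => [|f fs IH] [|a o] /=.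
- by rewrite scaler0.
- by case: o => [|b o] /=; rewrite ?big_nil ?scale1r // scaler0.
- by rewrite scaler0.
- by rewrite IH big_cons scalerA.
Qed.

Lemma contract_multilinear fs : multilinear (W := k^o) (contract fs).
Proof.
move=> s1 s2 x y n c u v; elim: s1 fs => [|a s1 IH] [|f fs] /=;
  rewrite ?scaler0 ?addr0 //; first by rewrite dual_eval_linr mulrDl -mulrA.
by rewrite IH mulrDr; congr (_ + _); exact: mulrCA.
Qed.

Lemma contract_last_multilinear fs x y n :
  multilinear (contract_last fs x y n).
Proof.
move=> s1 s2 x' y' n' c u v; elim: s1 fs => [|a s1 IH] [|f fs] /=;
  rewrite ?scaler0 ?addr0 //.
- by case: s2 => [|? ?]; rewrite ?lcomp_linear // scaler0 addr0.
- by rewrite dual_eval_linr scalerDl -scalerA.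
- by case: s1 {IH} => [|? ?]; rewrite /= ?scaler0 ?addr0.
- by rewrite IH scalerDr !scalerA mulrC.
Qed.

Lemma contract_cat fs1 fs2 o1 o2 : size fs1 = size o1 ->
  contract (fs1 ++ fs2) (o1 ++ o2) = contract fs1 o1 * contract fs2 o2.
Proof.
elim: fs1 o1 => [|f fs1 IH] [|a o1] //= => [_|[/IH->]]; by rewrite ?mul1r // mulrA.
Qed.

Lemma contract_last_cat fs1 fs2 x y n o1 o2 : size fs1 = size o1 ->
  contract_last (fs1 ++ fs2) x y n (o1 ++ o2) =
    contract fs1 o1 *: contract_last fs2 x y n o2.
Proof.
elim: fs1 o1 => [|f fs1 IH] [|a o1] //= => [_|[/IH->]];
  by rewrite ?scale1r // scalerA.
Qed.

Lemma contract_last_rcons fs x y n o z : size fs = size o ->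
  contract_last fs x y n (rcons o z) = contract fs o *: lcomp z x y n.
Proof.
by move=> e; rewrite -cats1 -[fs in LHS]cats0 contract_last_cat.
Qed.

Lemma contract_size fs o : contract fs o != 0 -> size o = size fs.
Proof.
elim: fs o => [|f fs IH] [|a o] //=; rewrite ?eqxx //.
by rewrite mulf_eq0 negb_or => /andP [_ /IH ->].
Qed.

Lemma contract_last_size fs x y n o :
  contract_last fs x y n o <> 0 -> size o = (size fs).+1.
Proof.
elim: fs o => [|f fs IH] [|a o] //=; first by case: o.
by move=> h; rewrite (IH o) // => e; apply: h; rewrite e scaler0.
Qed.

Definition tsum fs : int := \sum_(f <- fs) tdeg d f.

Lemma odeg_nil : odeg d ([::] : seq (letter A)) = 0.
Proof. by rewrite /odeg big_nil. Qed.

Lemma odeg_cat o1 o2 : odeg d (o1 ++ o2) = odeg d o1 + odeg d o2.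
Proof. by rewrite /odeg big_cat. Qed.

Lemma odeg_cons a o : odeg d (a :: o) = ldeg a + d + odeg d o.
Proof. by rewrite /odeg big_cons. Qed.

Lemma tsum_cat fs1 fs2 : tsum (fs1 ++ fs2) = tsum fs1 + tsum fs2.
Proof. by rewrite /tsum big_cat. Qed.

(** This is what turns signs depending on the outputs of an operation into signs
    depending on the forms. *)
Lemma contract_odeg fs o : contract fs o != 0 -> odeg d o = - tsum fs.
Proof.
elim: fs o => [|f fs IH] [|a o] //=; rewrite ?eqxx //.
  by rewrite /odeg /tsum !big_nil oppr0.
rewrite mulf_eq0 negb_or => /andP [/dual_eval_out [_ _ e] /IH h].
by rewrite odeg_cons h /tsum big_cons e /tdeg; ring.
Qed.

Lemma contract_last_odeg fs x y n o : contract_last fs x y n o <> 0 ->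
  exists o' z, [/\ o = rcons o' z, contract fs o' != 0,
    [/\ lsrc z = x, ltgt z = y & ldeg z = n] & odeg d o' = - tsum fs].
Proof.
move=> h; have := contract_last_size h.
case/lastP: o h => // o' z h; rewrite size_rcons => -[e].
have {}h : contract fs o' *: lcomp z x y n <> 0 by rewrite -contract_last_rcons.
have c0 : contract fs o' != 0.
  by apply/eqP => c0; apply: h; rewrite c0 scale0r.
exists o', z; split=> //; last exact: contract_odeg.
by apply: contrapT => h'; apply: h; rewrite lcomp_out // scaler0.
Qed.

End Contraction.

(** * Evaluating tensors *)

Section Teval.
Variables (k : fieldType) (A : quiver k) (W : lmodType k).
Variable h : seq (letter A) -> W.

Lemma teval_nil : teval h [::] = 0.
Proof. by rewrite /teval big_nil. Qed.

Lemma teval_cat t1 t2 : teval h (t1 ++ t2) = teval h t1 + teval h t2.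
Proof. by rewrite /teval big_cat. Qed.

Lemma teval_flatten (I : Type) (r : seq I) (F : I -> tensor A) :
  teval h (flatten [seq F i | i <- r]) = \sum_(i <- r) teval h (F i).
Proof.
elim: r => [|i r IH] /=; first by rewrite teval_nil big_nil.
by rewrite teval_cat IH big_cons.
Qed.

Lemma teval_map (I : Type) (r : seq I) (c : I -> k) (o : I -> seq (letter A)) :
  teval h [seq (c i, o i) | i <- r] = \sum_(i <- r) c i *: h (o i).
Proof. by rewrite /teval big_map. Qed.

Lemma teval_scale c t : teval h (tscale c t) = c *: teval h t.
Proof.
rewrite /tscale teval_map /teval scaler_sumr.
by apply: eq_bigr => q _; rewrite scalerA.
Qed.

End Teval.

Section MultiEval.
Variables (k : fieldType) (d : int) (A : quiver k) (p : int) (M : multi A).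
Hypothesis Mmulti : is_multi d p M.
Variable W : lmodType k.
Implicit Type h : seq (letter A) -> W.

(** Signs depending on degrees only are constant on the terms that contribute
    to an evaluation, and can be pulled out of it. *)
Lemma multi_sign h (X : seq (block A)) (s : seq (letter A) -> int) (c : int) :
  is_input X ->
  (forall o, map (fun a => (lsrc a, ltgt a)) o = out_slots X ->
     odeg d o = bsdeg X + p -> h o <> 0 -> par (s o) = par c) ->
  \sum_(q <- M X) (sgn (s q.2) * q.1) *: h q.2 = sgn c *: teval h (M X).
Proof.
move=> XP sP; rewrite /teval scaler_sumr.
apply: eq_big_Forall (Mmulti.1 X XP) _ => q [e1 e2].
case: (pselect (h q.2 = 0)) => [->|h0]; first by rewrite !scaler0.
by rewrite scalerA (sgn_par _ (sP _ e1 e2 h0)).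
Qed.

Lemma multi_linear h X1 X2 (x : ob A) w1 w2 u v n :
  multilinear h ->
  (forall a : A u v n, is_input (X1 ++ (x, w1 ++ Letter a :: w2) :: X2)) ->
  linear (fun a : A u v n => teval h (M (X1 ++ (x, w1 ++ Letter a :: w2) :: X2))).
Proof.
move=> hl inp c a b; rewrite (Mmulti.2 _ _ _ _ _ _ _ _ _ _ _ (inp a) _ _ hl).
by rewrite teval_cat teval_scale.
Qed.

End MultiEval.


Lemma Forall_cat (T : Type) (P : T -> Prop) (s1 s2 : seq T) :
  List.Forall P (s1 ++ s2) <-> List.Forall P s1 /\ List.Forall P s2.
Proof.
elim: s1 => [|x s1 IH] /=; first by split=> [|[]].
rewrite !List.Forall_cons_iff IH; tauto.
Qed.

Lemma Forall_rev (T : Type) (P : T -> Prop) (s : seq T) :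
  List.Forall P (rev s) <-> List.Forall P s.
Proof.
elim: s => [|x s IH] //=.
rewrite rev_cons -cats1 Forall_cat IH !List.Forall_cons_iff.
split=> [[? []]|[]]; by repeat split.
Qed.

(** * Composable words and their blocks *)

Section Composable.
Variables (k : fieldType) (Q : quiver k).
Implicit Types (w : seq (letter Q)) (x y : ob Q).

Lemma composable_wend x w y : composable x w y -> wend x w = y.
Proof. by rewrite /wend; elim: w x => //= a w IH x [_ /IH]. Qed.

Lemma composable_cat x w1 w2 y :
  composable x (w1 ++ w2) y <->
  composable x w1 (wend x w1) /\ composable (wend x w1) w2 y.
Proof.
rewrite /wend; elim: w1 x => [|a w1 IH] x /=; first by split=> [|[]].
by rewrite IH; split=> [[-> []]|[[-> ?] ?]].
Qed.

Lemma wdeg_nil : wdeg ([::] : seq (letter Q)) = 0.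
Proof. by rewrite /wdeg big_nil. Qed.

Lemma wdeg_cons a w : wdeg (a :: w) = ldeg a - 1 + wdeg w.
Proof. by rewrite /wdeg big_cons. Qed.

Lemma wdeg_cat w1 w2 : wdeg (w1 ++ w2) = wdeg w1 + wdeg w2.
Proof. by rewrite /wdeg big_cat. Qed.

Lemma wend_cat x w1 w2 : wend x (w1 ++ w2) = wend (wend x w1) w2.
Proof. by rewrite /wend map_cat last_cat. Qed.

End Composable.

Section PureWords.
Variables (k : fieldType) (d : int) (A : quiver k).
Local Notation mlet := (mletter A).
Implicit Types (v u : seq mlet) (x y : ob A).

Definition msrc (c : mlet) : ob A :=
  match c with inl a => lsrc a | inr f => lsrc f end.
Definition mtgt (c : mlet) : ob A :=
  match c with inl a => ltgt a | inr f => ltgt f end.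
Definition mdeg (c : mlet) : int :=
  match c with inl a => ldeg a - 1 | inr f => tdeg d f end.

Fixpoint mcomp x v y : Prop :=
  if v is c :: v' then msrc c = x /\ mcomp (mtgt c) v' y else x = y.

Definition mend x v : ob A := last x (map mtgt v).
Definition mwdeg v : int := \sum_(c <- v) mdeg c.

Lemma mcomp_mend x v y : mcomp x v y -> mend x v = y.
Proof. by rewrite /mend; elim: v x => //= a w IH x [_ /IH]. Qed.

Lemma mcomp_cat x v1 v2 y :
  mcomp x (v1 ++ v2) y <-> mcomp x v1 (mend x v1) /\ mcomp (mend x v1) v2 y.
Proof.
rewrite /mend; elim: v1 x => [|a w1 IH] x /=; first by split=> [|[]].
by rewrite IH; split=> [[-> []]|[[-> ?] ?]].
Qed.

Lemma mend_cat x v1 v2 : mend x (v1 ++ v2) = mend (mend x v1) v2.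
Proof. by rewrite /mend map_cat last_cat. Qed.

Lemma mwdeg_nil : mwdeg [::] = 0.
Proof. by rewrite /mwdeg big_nil. Qed.

Lemma mwdeg_cons c v : mwdeg (c :: v) = mdeg c + mwdeg v.
Proof. by rewrite /mwdeg big_cons. Qed.

Lemma mwdeg_cat v1 v2 : mwdeg (v1 ++ v2) = mwdeg v1 + mwdeg v2.
Proof. by rewrite /mwdeg big_cat. Qed.

(** A word is recorded by its leading run of letters of [A], its later blocks
    and its forms, in the order of the word, which is opposite to the order of
    the inputs of [M].  A later block starts at the target of the form that
    precedes it, so only the leading one needs the starting object. *)
Fixpoint hd v : seq (letter A) :=
  if v is inl a :: v' then a :: hd v' else [::].

Fixpoint tb v : seq (block A) :=
  match v with
  | [::] => [::]
  | inl _ :: v' => tb v'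
  | inr f :: v' => (ltgt f, hd v') :: tb v'
  end.

Fixpoint forms v : seq (letter (dual_quiver A)) :=
  match v with
  | [::] => [::]
  | inl _ :: v' => forms v'
  | inr f :: v' => f :: forms v'
  end.

Definition blocks x v : seq (block A) := (x, hd v) :: tb v.

Lemma parseE x v : Defs.parse x v = (blocks x v, forms v).
Proof. by elim: v x => [|[a|f] v IH] x //=; rewrite IH. Qed.

(** Concatenation glues the last block of the left word to the leading run of the
    right one, hence the splitting of the blocks at the last one. *)
Definition lastb x v : block A := last (x, hd v) (tb v).
Definition initb x v : seq (block A) := belast (x, hd v) (tb v).

Lemma blocks_lastI x v : blocks x v = rcons (initb x v) (lastb x v).
Proof. exact: lastI. Qed.

Lemma size_tb v : size (tb v) = size (forms v).
Proof. by elim: v => [|[a|f] v IH] //=; rewrite IH. Qed.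

Lemma size_initb x v : size (initb x v) = size (forms v).
Proof. by rewrite size_belast size_tb. Qed.

Lemma forms_cat v1 v2 : forms (v1 ++ v2) = forms v1 ++ forms v2.
Proof. by elim: v1 => [|[a|f] v1 IH] //=; rewrite IH. Qed.

Lemma hd_nof v : tb v = [::] -> v = map inl (hd v).
Proof. by elim: v => [|[a|f] v IH] //= /IH <-. Qed.

Lemma blocks_cat x v1 v2 :
  blocks x (v1 ++ v2) =
  initb x v1 ++ ((lastb x v1).1, (lastb x v1).2 ++ hd v2) :: tb v2.
Proof.
rewrite /blocks /initb /lastb.
elim: v1 x => [|[a|f] v1 IH] x //=.
- have {IH} := IH (ltgt a); case e: (tb v1) => [|b t] /= [-> ->] //=.
- by have := IH (ltgt f); rewrite /= => ->.
Qed.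

Lemma lastb_end x v y : mcomp x v y -> bend (lastb x v) = y.
Proof.
rewrite /lastb /bend; elim: v x => [|[a|f] v IH] x //= [_ /IH] //.
by case: (tb v).
Qed.

Lemma blocks_composable x v y : mcomp x v y ->
  List.Forall (fun b => composable b.1 b.2 (bend b)) (blocks x v).
Proof.
rewrite /blocks; elim: v x => [|[a|f] v IH] x /=.
- by move=> _; constructor=> //; constructor.
- case=> e /IH /List.Forall_cons_iff [h1 h2]; constructor=> //=.
- by case=> e /IH h; constructor.
Qed.

Lemma is_input_blocks x v y : (0 < size v)%N -> mcomp x v y ->
  is_input (rev (blocks x v)).
Proof.
move=> v0 vP; split; first by rewrite size_rev.
  by apply/Forall_rev; apply: blocks_composable vP.
rewrite size_rev /= => -[/size0nil e].
rewrite /blocks e /= cats0.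
by have := hd_nof e; case: (hd v) => // ve; rewrite ve in v0.
Qed.

(** What remains of [eps] and [tensor_sign] when the degrees of the outputs are
    those forced by the contraction: each letter of [A] is moved past the letters
    that follow it outside of its own block, and each form contributes [d]. *)
Fixpoint jsign v : int :=
  match v with
  | [::] => 0
  | inl a :: v' => (ldeg a - 1) * (mwdeg v' - wdeg (hd v')) + jsign v'
  | inr f :: v' => d + jsign v'
  end.


End PureWords.


(** * The exponents of [j] *)

Definition sumz (s : seq int) : int := \sum_(i <- s) i.

Lemma sumz_nth s : \sum_(i < size s) s`_i = sumz s.
Proof. by rewrite /sumz (big_nth 0) big_mkord. Qed.

Lemma sumz_rcons s a : sumz (rcons s a) = sumz s + a.
Proof. by rewrite /sumz -cats1 big_cat big_seq1. Qed.

Lemma sumz_rev s : sumz (rev s) = sumz s.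
Proof.
by elim: s => // a s IH; rewrite rev_cons sumz_rcons IH /sumz big_cons addrC.
Qed.

Definition pairs (s : seq int) : int :=
  \sum_(j < size s) \sum_(i < j) s`_i * s`_j.

Lemma nth_rcons_lt (s : seq int) a (i : 'I_(size s)) : (rcons s a)`_i = s`_i.
Proof. by rewrite nth_rcons ltn_ord. Qed.

Lemma nth_rcons_last (s : seq int) a : (rcons s a)`_(size s) = a.
Proof. by rewrite nth_rcons ltnn eqxx. Qed.

Lemma pairs_rcons s a : pairs (rcons s a) = pairs s + sumz s * a.
Proof.
rewrite /pairs size_rcons big_ord_recr /=; congr (_ + _).
  apply: eq_bigr => j _; apply: eq_bigr => i _.
  by rewrite !nth_rcons (ltn_trans (ltn_ord i)) ltn_ord.
rewrite nth_rcons_last -sumz_nth mulr_suml.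
by apply: eq_bigr => i _; rewrite nth_rcons_lt.
Qed.

(** [eps] enumerates the blocks from the right end of the word.  Read from the
    left end it becomes a recursion on the word, apart from two terms that the
    other signs cancel ([epsE]). *)
Fixpoint epairs (d : int) (al ta : seq int) : int :=
  match al, ta with
  | a :: al', t :: ta' => a * (sumz al' + sumz ta) + d + epairs d al' ta'
  | _, _ => 0
  end.

Lemma eps_rcons d p al ta a t : size al = (size ta).+1 ->
  eps d p (rcons al a) (rcons ta t) =
    eps d p al ta + (sumz ta + t + sumz al) * a + p * t + d + sumz ta * t.
Proof.
move=> e; rewrite /eps.
rewrite -!/(pairs _) !pairs_rcons !sumz_nth sumz_rcons !size_rcons.
rewrite big_ord_recr /= nth_rcons_last e big_nat1 -e nth_rcons_last.
have -> : \sum_(i < size ta) (rcons ta t)`_i *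
    (\sum_(i.+1 <= j < (size al).+1) (rcons al a)`_j) =
  \sum_(i < size ta) ta`_i * (\sum_(i.+1 <= j < size al) al`_j) + sumz ta * a.
  rewrite -sumz_nth mulr_suml -big_split /=; apply: eq_bigr => i _.
  rewrite nth_rcons_lt big_nat_recr /=; last by rewrite e ltnS ltnW.
  rewrite nth_rcons_last mulrDr; congr (_ * _ + _).
  by apply: eq_big_nat => j /andP [_ h]; rewrite nth_rcons h.
rewrite e -[(size ta).+1]addn1 PoszD; ring.
Qed.

Lemma epsE d p al ta : size al = (size ta).+1 ->
  eps d p (rev al) (rev ta) = epairs d al ta + p * sumz ta + pairs (rev ta).
Proof.
elim: ta al => [|t ta IH] [|a al] //= [].
  case: al => // _; rewrite /eps /pairs /sumz !big_ord0 !big_nil /=.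
  by rewrite !big_ord_recl !big_ord0; ring.
move=> e; rewrite !rev_cons eps_rcons ?size_rev // IH // pairs_rcons !sumz_rev.
rewrite /sumz big_cons; ring.
Qed.

Section JSign.
Variables (k : fieldType) (d : int) (A : quiver k).
Implicit Types (v : seq (mletter A)) (x y : ob A).

Lemma bsdeg_cat (X Y : seq (block A)) : bsdeg (X ++ Y) = bsdeg X + bsdeg Y.
Proof. by rewrite /bsdeg big_cat. Qed.

Lemma bsdeg_cons (b : block A) X : bsdeg (b :: X) = bdeg b + bsdeg X.
Proof. by rewrite /bsdeg big_cons. Qed.

Lemma bsdeg_nil : bsdeg ([::] : seq (block A)) = 0.
Proof. by rewrite /bsdeg big_nil. Qed.

Lemma bsdeg_rcons (b : block A) X : bsdeg (rcons X b) = bsdeg X + bdeg b.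
Proof. by rewrite -cats1 bsdeg_cat bsdeg_cons bsdeg_nil addr0. Qed.

Lemma bsdeg_rev (X : seq (block A)) : bsdeg (rev X) = bsdeg X.
Proof.
elim: X => // b X IH.
by rewrite rev_cons bsdeg_rcons IH bsdeg_cons addrC.
Qed.

Lemma sumz_bdeg (X : seq (block A)) :
  sumz (map (@bdeg k A) X) = bsdeg X.
Proof. by rewrite /sumz big_map. Qed.

Lemma sumz_tdeg (fs : seq (letter (dual_quiver A))) :
  sumz (map (@tdeg k d A) fs) = tsum d fs.
Proof. by rewrite /sumz big_map. Qed.

Lemma tsum_rev (fs : seq (letter (dual_quiver A))) :
  tsum d (rev fs) = tsum d fs.
Proof. by rewrite -!sumz_tdeg map_rev sumz_rev. Qed.

Lemma mwdegE v : mwdeg d v = wdeg (hd v) + bsdeg (tb v) + tsum d (forms v).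
Proof.
elim: v => [|[a|f] v IH]; rewrite ?mwdeg_nil ?mwdeg_cons /=.
- by rewrite wdeg_nil bsdeg_nil /tsum big_nil.
- by rewrite IH wdeg_cons; ring.
- by rewrite IH wdeg_nil bsdeg_cons /tsum big_cons /bdeg /=; ring.
Qed.

Lemma epairs_jsign x v :
  epairs d (map (@bdeg k A) (blocks x v)) (map (@tdeg k d A) (forms v)) =
    jsign d v.
Proof.
rewrite /blocks; elim: v x => [|[a|f] v IH] x //=.
- rewrite -(IH (ltgt a)) /= mwdegE.
  have := size_tb v; case: (tb v) (forms v) => [|b t] [|f fs] //= _.
    by rewrite /bdeg /= /tsum bsdeg_nil big_nil; ring.
  rewrite /bdeg /= wdeg_cons bsdeg_cons /sumz /tsum !big_cons !big_map.
  by rewrite /bsdeg /bdeg; ring.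
- rewrite -(IH (ltgt f)) /=.
  by rewrite /bdeg /= wdeg_nil mul0r add0r.
Qed.

(** On the terms that contribute, the sign of
    [f_1 \otimes ... \otimes f_n] cancels the sum over pairs of forms in
    [eps]. *)
Lemma tensor_sign_contract (fs : seq (letter (dual_quiver A))) o :
  contract fs o != 0 ->
  par (tensor_sign d (map (@tdeg k d A) fs) o) =
  par (pairs (map (@tdeg k d A) fs)).
Proof.
elim/last_ind: fs o => [|fs f IH] o.
  by rewrite /tensor_sign /pairs !big_ord0.
move=> c0; have := contract_size c0.
case/lastP: o c0 => [|o z]; rewrite !size_rcons // => c0 [e].
have {}c0 : contract fs o != 0.
  move: c0; rewrite -!cats1 contract_cat ?e // mulf_eq0 negb_or.
  by case/andP.
rewrite map_rcons pairs_rcons parD -(IH o) // -parD.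
rewrite /tensor_sign size_rcons size_map big_ord_recr /=.
have -> : (rcons (map (@tdeg k d A) fs) (tdeg d f))`_(size fs) = tdeg d f.
  by rewrite -(size_map (@tdeg k d A) fs) nth_rcons_last.
have -> : take (size fs) (rcons o z) = o by rewrite -e -cats1 take_size_cat.
rewrite (contract_odeg d c0) sumz_tdeg !parD.
congr (par _ (+) _); last by rewrite mulrN parN mulrC.
apply: eq_bigr => i _.
rewrite -[rcons o z]cats1 takel_cat; last by rewrite e ltnW.
by rewrite nth_rcons size_map ltn_ord.
Qed.

Lemma tensor_sign_rcons e o' (z : letter A) c : size o' = size e ->
  tensor_sign d (rcons e c) (rcons o' z) = tensor_sign d e o' + c * odeg d o'.
Proof.
move=> es; rewrite /tensor_sign size_rcons big_ord_recr /= nth_rcons_last -es.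
have tE i : (i <= size o')%N -> take i (rcons o' z) = take i o'.
  by move=> h; rewrite -cats1 takel_cat.
rewrite tE // take_size; congr (_ + _).
rewrite es; apply: eq_bigr => i _.
by rewrite tE ?es 1?ltnW // nth_rcons_lt.
Qed.

End JSign.


Section EffectiveJ.
Variables (k : fieldType) (d : int) (A : quiver k) (M : multi A).
Hypothesis Mmulti : is_multi d (d + 2) M.
Implicit Types (v : seq (mletter A)) (x y : ob A) (m n : int).

Lemma size_map_tdeg v : size (map (@bdeg k A) (tb v)) =
  size (map (@tdeg k d A) (forms v)).
Proof. by rewrite !size_map size_tb. Qed.

Lemma eps_blocks x v :
  eps d (d + 2) (map (@bdeg k A) (rev (blocks x v)))
    (map (@tdeg k d A) (rev (forms v))) =
  jsign d v + (d + 2) * tsum d (forms v)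
    + pairs (map (@tdeg k d A) (rev (forms v))).
Proof.
rewrite !map_rev epsE ?epairs_jsign ?sumz_tdeg //.
by rewrite /= size_map_tdeg.
Qed.

(** On contributing terms [tensor_sign] equals the sum of [ta_i ta_j] over pairs
    plus [d] times the sum of the [ta_i], which cancels the part of [eps] not
    found in [jsign] as [M] has degree [d + 2]. *)
Lemma j_A_eff v x y n : (0 < size v)%N -> mcomp x v y ->
  j_A d M v x y n = sgn (jsign d v) *:
    teval (contract_last (rev (forms v)) x y n) (M (rev (blocks x v))).
Proof.
move=> v0 vP; rewrite /j_A parseE /=.
set al := map (@bdeg k A) _; set ta := map (@tdeg k d A) _.
pose s (o : seq (letter A)) := eps d (d + 2) al ta + tensor_sign d (rcons ta (- d)) o.
rewrite -(multi_sign Mmulti (s := s) (is_input_blocks v0 vP)).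
  apply: eq_bigr => q _; rewrite contract_lastE scalerA; congr (_ *: _).
move=> o _ _ /(contract_last_odeg d) [o' [z [-> c0 _ e]]].
rewrite /s eps_blocks tensor_sign_rcons; last first.
  by rewrite (contract_size c0) size_map.
rewrite e tsum_rev !parD (tensor_sign_contract d c0).
by parity.
Qed.

Lemma j_dual_single v x y m : tb v = [::] -> j_dual d M v x y m = 0.
Proof. by move=> e; rewrite /j_dual parseE /= /blocks e. Qed.

Lemma sum_middle (a b : int) s :
  \sum_(1 <= i < (size (a :: rcons s b)).-1) (a :: rcons s b)`_i = sumz s.
Proof.
rewrite /= size_rcons big_add1 /= big_mkord -sumz_nth.
by apply: eq_bigr => i _; rewrite nth_rcons_lt.
Qed.

Lemma is_input_dual v x y m (w : A y x m) Bm b1 : mcomp x v y ->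
  tb v = rcons Bm b1 ->
  is_input ((b1.1, b1.2 ++ Letter w :: hd v) :: rev Bm).
Proof.
move=> vP e; have := blocks_composable vP; rewrite /blocks e.
rewrite -cats1 => /List.Forall_cons_iff [h1 /Forall_cat [h2]].
move=> /List.Forall_cons_iff [h3 _].
split=> //=; last by rewrite !size_cat /= addnS.
constructor; last by apply/Forall_rev.
have := lastb_end vP; rewrite /lastb e last_rcons => e1 /=.
apply/composable_cat; rewrite -[wend _ _]/(bend b1); split=> //.
split; first by rewrite e1.
rewrite /bend /= wend_cat /= /wend /=; exact: h1.
Qed.

(** The counterpart of [jsign] for the dual-valued part of [j], [Bm] being the
    blocks strictly between the first and the last one. *)
Definition dual_sign v (Bm : seq (block A)) : int :=
  jsign d v + d + mwdeg d v + (wdeg (hd v) + mwdeg d v + d) * bsdeg Bm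
  + wdeg (hd v) * (mwdeg d v + d).

(** The block in which the argument is inserted is the last block of the word,
    followed by the argument and by the first block.  The degree of the argument
    is forced by the contraction, hence an exponent in terms of the word. *)
Lemma j_dual_eff v x y m (w : A y x (- m)) Bm b1 : mcomp x v y ->
  tb v = rcons Bm b1 ->
  j_dual d M v x y m w =
    sgn (dual_sign v Bm) * teval (W := k^o) (contract (rev (forms v)))
      (M ((b1.1, b1.2 ++ Letter w :: hd v) :: rev Bm)).
Proof.
move=> vP e.
have inp (a : A y x (- m)) := is_input_dual a vP e.
have lin := multi_linear (X1 := [::]) Mmulti
  (@contract_multilinear k A (rev (forms v))) inp.
rewrite /j_dual parseE /=.
have eb : rev (blocks x v) = b1 :: rcons (rev Bm) (x, hd v).
  by rewrite /blocks e rev_cons rev_rcons.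
rewrite eb; case ec: (rcons _ _) => [|c bs']; first by case: (rev Bm) ec.
rewrite -ec last_rcons belast_rcons /=.
set al := _ :: map (@bdeg k A) _; set ta := map (@tdeg k d A) _; set S := sgn (dual_sign _ _).
have alE : al = map (@bdeg k A) (rev (blocks x v)) by rewrite eb.
have alE' : al = bdeg b1 :: rcons (map (@bdeg k A) (rev Bm)) (wdeg (hd v)).
  by rewrite /al map_rcons.
set h := fun a => _.
have hE a : h a = S *: teval (W := k^o) (contract (rev (forms v)))
      (M ((b1.1, b1.2 ++ Letter a :: hd v) :: rev Bm)).
  rewrite /h /plug /=.
  pose s (o : seq (letter A)) := (d - 1) * (m - (d - 1)) + delta d (d + 2) al ta (- m - 1)
              + tensor_sign d ta o.
  rewrite -(multi_sign Mmulti (s := s) (inp a)).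
    rewrite mulr_sumr; apply: eq_big_Forall (Mmulti.1 _ (inp a)) _ => q [e1 _].
    rewrite contractE; last first.
      have /(congr1 size) := e1.
      rewrite size_map /out_slots size_zip size_rot !size_map minnn /= => ->.
      by rewrite !size_rev -size_tb e size_rcons.
    rewrite /s; set D := delta _ _ _ _ _.
    by rewrite -[in RHS]addrA [in RHS]sgnD -[RHS]/(_ * _) !mulrA.
  move=> o _ eo c0; have {}c0 : contract (rev (forms v)) o != 0 by apply/eqP.
  move: eo; rewrite (contract_odeg d c0) tsum_rev.
  rewrite bsdeg_cons bsdeg_rev /bdeg /= wdeg_cat wdeg_cons /= => eo.
  rewrite /s parD (tensor_sign_contract d c0) /delta.
  have -> : \sum_(1 <= i < (size al).-1) al`_i = bsdeg Bm.
    by rewrite alE' sum_middle sumz_bdeg bsdeg_rev.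
  have -> : al`_(size al).-1 = wdeg (hd v).
    by rewrite alE' /= size_rcons /= nth_rcons_last.
  rewrite sumz_nth.
  have -> : sumz al = wdeg b1.2 + bsdeg Bm + wdeg (hd v).
    rewrite alE' /sumz big_cons -/(sumz _) sumz_rcons sumz_bdeg bsdeg_rev.
    by rewrite /bdeg; ring.
  rewrite alE eps_blocks /dual_sign mwdegE e bsdeg_rcons /bdeg.
  have -> : m = tsum d (forms v) + wdeg b1.2 + wdeg (hd v) + bsdeg Bm + d + 1.
    by lia.
  by parity.
rewrite to_dualE; first exact: hE.
move=> c' a b; rewrite !hE (lin c' a b) scalerDr; congr (_ + _).
by rewrite !scalerA mulrC.
Qed.

End EffectiveJ.


(** * Splittings of words and of block sequences *)

Section Splits.
Variables (T : Type) (V : nmodType).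

Fixpoint splits (s : seq T) : seq (seq T * seq T) :=
  match s with
  | [::] => [:: ([::], [::])]
  | a :: s' => ([::], a :: s') :: [seq (a :: p.1, p.2) | p <- splits s']
  end.

Lemma splits_cons a s :
  splits (a :: s) = ([::], a :: s) :: [seq (a :: p.1, p.2) | p <- splits s].
Proof. by []. Qed.

Lemma splitsE s : splits s = [seq (take i s, drop i s) | i <- iota 0 (size s).+1].
Proof.
elim: s => // a s IH; rewrite splits_cons IH -map_comp.
rewrite [size (a :: s)]/= -[(size s).+2]add1n iotaD map_cat.
by rewrite (iotaDl 1 0) -!map_comp.
Qed.

Lemma picks_rcons (s : seq T) a :
  picks (rcons s a) =
    rcons [seq (q.1.1, q.1.2, rcons q.2 a) | q <- picks s] (s, a, [::]).
Proof.
by elim: s => //= b s IH; rewrite IH map_rcons -!map_comp.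
Qed.

Lemma big_picks_rev (s : seq T) (F : seq T -> T -> seq T -> V) :
  \sum_(q <- picks (rev s)) F q.1.1 q.1.2 q.2 =
  \sum_(q <- picks s) F (rev q.2) q.1.2 (rev q.1.1).
Proof.
elim: s F => [|a s IH] F /=; first by rewrite !big_nil.
rewrite rev_cons picks_rcons -cats1 big_cat big_seq1 big_map /=.
have /= -> := IH (fun u b v => F u b (rcons v a)).
rewrite big_cons big_map /= addrC.
by congr (_ + _); apply: eq_bigr => q _; rewrite rev_cons.
Qed.

Lemma big_splits3 (s : seq T) (F : seq T -> seq T -> seq T -> V) :
  \sum_(p <- splits s) \sum_(q <- splits p.2) F p.1 q.1 q.2 =
  \sum_(p <- splits s) \sum_(q <- splits p.1) F q.1 q.2 p.2.
Proof.
elim: s F => [|a s IH] F; first by rewrite /= !big_seq1.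
rewrite /= !big_cons !big_map /=.
have /= -> := IH (fun u v w => F (a :: u) v w).
rewrite big_nil addr0 -addrA; congr (_ + _).
rewrite -big_split /=; apply: eq_bigr => p _.
by rewrite big_cons big_map.
Qed.

End Splits.

Section BlockSplits.
Variables (k : fieldType) (A : quiver k) (V : nmodType).
Implicit Types (v : seq (mletter A)) (x y : ob A).

Lemma big_cuts (b : block A) (F : block A * block A -> V) :
  \sum_(c <- cuts b) F c =
  \sum_(p <- splits b.2) F ((b.1, p.1), (wend b.1 p.1, p.2)).
Proof. by rewrite /cuts splitsE !big_map. Qed.

(** This is how the sums over [picks] and [cuts] in the necklace product become
    sums over cuts of words. *)
Lemma big_picks_cons (b : block A) (B : seq (block A))
    (F : seq (block A) * block A * seq (block A) -> V) :
  \sum_(q <- picks (b :: B)) F q =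
  F ([::], b, B) + \sum_(q <- picks B) F (b :: q.1.1, q.1.2, q.2).
Proof. by rewrite /= big_cons big_map. Qed.

Lemma big_splits_cons (T : Type) (a : T) s (F : seq T * seq T -> V) :
  \sum_(p <- splits (a :: s)) F p =
  F ([::], a :: s) + \sum_(p <- splits s) F (a :: p.1, p.2).
Proof. by rewrite /= big_cons big_map. Qed.

Lemma big_splits_blocks v x y (G : seq (block A) -> seq (block A) -> V) :
  mcomp x v y ->
  \sum_(p <- splits v) G (blocks x p.1) (blocks (mend x p.1) p.2) =
  \sum_(q <- picks (blocks x v)) \sum_(c <- cuts q.1.2)
    G (rcons q.1.1 c.1) (c.2 :: q.2).
Proof.
elim: v x G => [|c v IH] x G vP.
  by rewrite /blocks /= /cuts /= !big_seq1.
rewrite big_splits_cons; case: c vP => [a|f] /= [e vP].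
- pose addh (B : seq (block A)) :=
    if B is b :: B' then (x, a :: b.2) :: B' else [::].
  have := IH (ltgt a) (fun B C => G (addh B) C) vP.
  rewrite -[blocks (ltgt a) v]/((ltgt a, hd v) :: tb v).
  rewrite big_picks_cons big_cuts => {}IH.
  rewrite -[blocks x (inl a :: v)]/((x, a :: hd v) :: tb v).
  rewrite big_picks_cons big_cuts big_splits_cons -addrA.
  by congr (_ + _); exact: IH.
- have {}IH := IH (ltgt f) (fun B C => G ((x, [::]) :: B) C) vP.
  rewrite -[blocks x (inr f :: v)]/((x, [::]) :: @blocks k A (ltgt f) v).
  rewrite big_picks_cons big_cuts /= big_seq1.
  by congr (_ + _); exact: IH.
Qed.

Lemma big_splits_rev_blocks v x y (G : seq (block A) -> seq (block A) -> V) :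
  mcomp x v y ->
  \sum_(p <- splits v)
     G (rev (blocks x p.1)) (rev (blocks (mend x p.1) p.2)) =
  \sum_(q <- picks (rev (blocks x v))) \sum_(c <- cuts q.1.2)
    G (c.1 :: q.2) (rcons q.1.1 c.2).
Proof.
move=> vP.
rewrite (big_picks_rev _ (fun u b w => \sum_(c <- cuts b)
   G (c.1 :: w) (rcons u c.2))).
rewrite (big_splits_blocks (fun B C => G (rev B) (rev C)) vP).
by apply: eq_bigr => q _; apply: eq_bigr => c _; rewrite rev_rcons rev_cons.
Qed.

End BlockSplits.


Lemma splits_Forall (T : Type) (s : seq T) :
  List.Forall (fun p => p.1 ++ p.2 = s) (splits s).
Proof.
elim: s => [|a s IH] /=; first by constructor.
constructor=> //; elim: IH => //= p l <- _ IH'; by constructor.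
Qed.

(** * Diagrams of the necklace product as cut words *)

Section NecDiagrams.
Variables (k : fieldType) (d p : int) (A : quiver k) (F G : multi A).
Variables (W : lmodType k) (h : seq (letter A) -> W).
Implicit Types (v : seq (mletter A)) (x y : ob A).

(** The diagrams obtained from the blocks of a word cut in three, the middle
    piece carrying the inputs of the disc whose arrow is plugged. *)
Definition diagram (X U Y : seq (block A)) : W :=
  match X, U, rev Y with
  | a :: W2, [:: y], b :: W1 =>
      if (0 < size y.2)%N then teval h (nec_inner d F G (rev W1) a y b W2) else 0
  | a :: W2, y :: c :: U', b :: W1 =>
      teval h (nec_root_F d F G (rev W1) y b (belast c U') a (last c U') W2)
      + teval h (nec_root_G d p F G (rev W1) y b (belast c U') a (last c U') W2)
  | _, _, _ => 0
  end.

Lemma diagram_single (a : block A) W2 (y : block A) W1 b :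
  diagram (a :: W2) [:: y] (rcons W1 b) =
    if (0 < size y.2)%N then teval h (nec_inner d F G W1 a y b W2) else 0.
Proof. by rewrite /diagram rev_rcons revK. Qed.

Lemma diagram_multi (a : block A) W2 (y : block A) Wm (y' : block A) W1 b :
  diagram (a :: W2) (y :: rcons Wm y') (rcons W1 b) =
    teval h (nec_root_F d F G W1 y b Wm a y' W2)
    + teval h (nec_root_G d p F G W1 y b Wm a y' W2).
Proof.
rewrite /diagram rev_rcons revK; case e: (rcons Wm y') => [|c U'].
  by case: Wm e.
have [-> ->] : Wm = belast c U' /\ y' = last c U'.
  by move: e; rewrite lastI => /rcons_inj [-> ->].
by [].
Qed.

(** [nec] cuts the input of an inner disc with one output from the left; words are
    cut from the right. *)
Lemma big_cuts3 (b : block A) (H : block A -> block A -> block A -> W) :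
  \sum_(ay <- cuts b) \sum_(yb <- cuts ay.2) H ay.1 yb.1 yb.2 =
  \sum_(c <- cuts b) \sum_(c' <- cuts c.1) H c'.1 c'.2 c.2.
Proof.
rewrite !big_cuts /=.
transitivity (\sum_(p <- splits b.2) \sum_(q <- splits p.2)
   H (b.1, p.1) (wend b.1 p.1, q.1) (wend b.1 (p.1 ++ q.1), q.2)).
  apply: eq_bigr => s _; rewrite big_cuts /=.
  by apply: eq_bigr => q _; rewrite wend_cat.
rewrite (big_splits3 _ (fun s1 s2 s3 =>
  H (b.1, s1) (wend b.1 s1, s2) (wend b.1 (s1 ++ s2), s3))).
apply: eq_bigr => s _; rewrite big_cuts /=.
by apply: eq_big_Forall (splits_Forall s.1) _ => q ->.
Qed.

(** A diagram is determined by its type and by the two places where the inputs of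
    the plugged disc begin and end; these lie in one block if that disc has a
    single output and in two blocks otherwise. *)
Lemma nec_splits v x y : mcomp x v y ->
  teval h (nec d p F G (rev (blocks x v))) =
  \sum_(s <- splits v) \sum_(t <- splits s.1)
    diagram (rev (blocks x t.1)) (rev (blocks (mend x t.1) t.2))
      (rev (blocks (mend x s.1) s.2)).
Proof.
move=> vP.
pose G1 Z Y := \sum_(q <- picks Z) \sum_(c <- cuts q.1.2)
  diagram (c.1 :: q.2) (rcons q.1.1 c.2) Y.
transitivity (\sum_(s <- splits v)
    G1 (rev (blocks x s.1)) (rev (blocks (mend x s.1) s.2))); last first.
  apply: eq_big_Forall (splits_Forall v) _ => s e.
  have sP : mcomp x s.1 (mend x s.1) by move: vP; rewrite -e => /mcomp_cat [].
  by symmetry; exact: (big_splits_rev_blocks (fun X U => diagram X U _) sP).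
rewrite (big_splits_rev_blocks G1 vP) /nec teval_cat !teval_flatten.
rewrite -big_split; apply: eq_bigr => q _.
rewrite /G1.
under [RHS]eq_bigr => c _ do rewrite big_picks_cons.
rewrite big_split; congr (_ + _).
  rewrite teval_flatten.
  rewrite -(big_cuts3 _ (fun a c b => diagram (a :: q.2) [:: c] (rcons q.1.1 b))).
  apply: eq_bigr => ay _; rewrite teval_flatten.
  apply: eq_bigr => yb _; rewrite diagram_single.
  by case: ifP; rewrite ?teval_nil.
rewrite teval_flatten exchange_big; apply: eq_bigr => r _.
rewrite teval_flatten; apply: eq_bigr => c _; rewrite teval_flatten.
by apply: eq_bigr => c' _; rewrite diagram_multi teval_cat.
Qed.

End NecDiagrams.


(** * The terms of the relation as diagrams *)

Section Terms.
Variables (k : fieldType) (d : int) (A : quiver k) (M : multi A).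
Hypothesis Mmulti : is_multi d (d + 2) M.
Implicit Types (v u : seq (mletter A)) (x y : ob A) (m n : int).

(** The letters of [A] on the left are moved past the whole right word, except
    for the two halves of the block glued in the middle. *)
Lemma jsign_cat x v1 v2 :
  jsign d (v1 ++ v2) = jsign d v1 + jsign d v2
    + bsdeg (blocks x v1) * mwdeg d v2 - bdeg (lastb x v1) * wdeg (hd v2).
Proof.
rewrite /blocks /lastb; elim: v1 x => [|[a|f] v1 IH] x /=.
- by rewrite bsdeg_cons bsdeg_nil /bdeg wdeg_nil; ring.
- rewrite (IH (ltgt a)) mwdeg_cat !bsdeg_cons /bdeg /= wdeg_cons.
  rewrite (mwdegE d v1); case e: (tb v1) => [|b t] /=.
    have -> : hd (v1 ++ v2) = hd v1 ++ hd v2.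
      have := blocks_cat (ltgt a) v1 v2.
      by rewrite /blocks /initb /lastb e => -[].
    by rewrite wdeg_cat !wdeg_cons bsdeg_nil; ring.
  have -> : hd (v1 ++ v2) = hd v1.
    have := blocks_cat (ltgt a) v1 v2.
    by rewrite /blocks /initb /lastb e => -[].
  by rewrite !bsdeg_cons; ring.
- by rewrite (IH (ltgt f)) !bsdeg_cons {1 3}/bdeg /= wdeg_nil; ring.
Qed.

Lemma rev_blocks_inl x v1 z v2 y :
  rev (blocks x (v1 ++ inl z :: v2)) =
  rev (tb v2) ++ plug (lastb x v1) [:: z] (y, hd v2) :: rev (initb x v1).
Proof. by rewrite blocks_cat rev_cat rev_cons cat_rcons. Qed.

Lemma rev_blocks_inr x v1 f v2 :
  rev (blocks x (v1 ++ inr f :: v2)) =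
  rev (tb v2) ++ (ltgt f, hd v2) :: lastb x v1 :: rev (initb x v1).
Proof.
rewrite blocks_cat /= cats0 -surjective_pairing rev_cat !rev_cons.
by rewrite -!cats1 -!catA.
Qed.

Lemma j_A_linear_inl x y n v1 v2 s t m :
  (forall a : A s t m, mcomp x (v1 ++ inl (Letter a) :: v2) y) ->
  linear (fun a : A s t m => j_A d M (v1 ++ inl (Letter a) :: v2) x y n).
Proof.
move=> vP c a b.
have v0 z : (0 < size (v1 ++ inl z :: v2))%N by rewrite size_cat addnS.
have inp (a' : A s t m) : is_input (rev (tb v2) ++
    ((lastb x v1).1, (lastb x v1).2 ++ Letter a' :: hd v2) :: rev (initb x v1)).
  by have := is_input_blocks (v0 _) (vP a'); rewrite (rev_blocks_inl _ _ _ _ x).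
rewrite !(j_A_eff Mmulti n (v0 _) (vP _)) !(rev_blocks_inl _ _ _ _ x).
rewrite (multi_linear Mmulti (contract_last_multilinear _ _ _ _) inp c a b).
rewrite !forms_cat !(jsign_cat x) /= !mwdeg_cons /= !wdeg_cons /=.
by rewrite scalerDr !scalerA mulrC.
Qed.

Lemma contract_last_linear_form s t m (c : k) (f g : dual_quiver A s t m)
    fs1 fs2 x y n o :
  contract_last (fs1 ++ @Letter _ (dual_quiver A) _ _ _ (c *: f + g) :: fs2)
    x y n o =
  c *: contract_last (fs1 ++ @Letter _ (dual_quiver A) _ _ _ f :: fs2) x y n o
  + contract_last (fs1 ++ @Letter _ (dual_quiver A) _ _ _ g :: fs2) x y n o.
Proof.
elim: fs1 o => [|f1 fs1 IH] [|a o] /=; rewrite ?scaler0 ?addr0 //.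
  by rewrite dual_eval_linl scalerDl scalerA.
by rewrite IH scalerDr !scalerA mulrC.
Qed.

Lemma teval_linear_form s t m (c : k) (f g : dual_quiver A s t m)
    fs1 fs2 x y n (T : tensor A) :
  teval (contract_last
    (fs1 ++ @Letter _ (dual_quiver A) _ _ _ (c *: f + g) :: fs2) x y n) T =
  c *: teval (contract_last
         (fs1 ++ @Letter _ (dual_quiver A) _ _ _ f :: fs2) x y n) T
  + teval (contract_last
         (fs1 ++ @Letter _ (dual_quiver A) _ _ _ g :: fs2) x y n) T.
Proof.
rewrite /teval scaler_sumr -big_split; apply: eq_bigr => q _ /=.
by rewrite contract_last_linear_form scalerDr !scalerA mulrC.
Qed.

Lemma j_A_linear_inr x y n v1 v2 s t m :
  (forall a : dual_quiver A s t m,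
     mcomp x (v1 ++ inr (@Letter _ (dual_quiver A) _ _ _ a) :: v2) y) ->
  linear (fun a : dual_quiver A s t m =>
    j_A d M (v1 ++ inr (@Letter _ (dual_quiver A) _ _ _ a) :: v2) x y n).
Proof.
move=> vP c a b.
have v0 z : (0 < size (v1 ++ inr z :: v2))%N by rewrite size_cat addnS.
rewrite !(j_A_eff Mmulti n (v0 _) (vP _)) !rev_blocks_inr.
rewrite !forms_cat /= !rev_cat !rev_cons !cat_rcons.
rewrite teval_linear_form !(jsign_cat x) /= !mwdeg_cons /=.
by rewrite scalerDr !scalerA mulrC.
Qed.

End Terms.


Section OutSlots.
Variables (k : fieldType) (A : quiver k).

Lemma size_out_slots (X : seq (block A)) : size (out_slots X) = size X.
Proof. by rewrite /out_slots size_zip size_rot !size_map minnn. Qed.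

Lemma out_slots_size (X : seq (block A)) (o : seq (letter A)) :
  map (fun a => (lsrc a, ltgt a)) o = out_slots X -> size o = size X.
Proof. by move=> /(congr1 size); rewrite size_map size_out_slots. Qed.

(** This identifies the output of the inner disc that is plugged. *)
Lemma out_slots_last x (u : seq (mletter A)) y o : mcomp x u y ->
  map (fun a => (lsrc a, ltgt a)) o = out_slots (rev (blocks x u)) ->
  exists o' z, [/\ o = rcons o' z, lsrc z = x, ltgt z = y
                 & size o' = size (forms u)].
Proof.
move=> uP e; have so := out_slots_size e; move: e.
case/lastP: o so => [|o' z]; rewrite size_rev // size_rcons => -[so].
rewrite map_rcons {1}/out_slots {2}blocks_lastI rev_rcons /= /rot /= drop0 take0.
rewrite cats1 (lastb_end uP) [blocks x u]/blocks rev_cons !map_rcons /=.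
rewrite zip_rcons; last first.
  by rewrite !size_map !size_rev size_initb size_tb.
move=> /rcons_inj [_ <- <-]; exists o', z; split=> //.
by rewrite so size_tb.
Qed.

(** This identifies the output of the disc containing the root that is plugged
    into the other disc. *)
Lemma out_slots_middle (W1 : seq (block A)) y y' W2 o :
  map (fun a => (lsrc a, ltgt a)) o = out_slots (W1 ++ y :: y' :: W2) ->
  exists o1 z o2, [/\ o = o1 ++ z :: o2, size o1 = size W1, lsrc z = y.1
                    & ltgt z = bend y'].
Proof.
move=> e; have so := out_slots_size e.
have lt1 : (size W1 < size o)%N by rewrite so size_cat /=; lia.
case: o lt1 so e => // z0 o0; set o := z0 :: o0 => lt1 so e.
exists (take (size W1) o), (nth z0 o (size W1)), (drop (size W1).+1 o).
have := congr1 (fun s => nth (y.1, bend y) s (size W1)) e.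
rewrite (nth_map z0) // /out_slots nth_zip ?size_rot ?size_map //.
have -> : nth y.1 (map fst (W1 ++ y :: y' :: W2)) (size W1) = y.1.
  by rewrite (nth_map y) ?nth_cat ?ltnn ?subnn // size_cat /=; lia.
have -> : nth (bend y) (rot 1 (map (@bend k A) (W1 ++ y :: y' :: W2))) (size W1)
          = bend y'.
  case: (W1) => [|w W1'] //=.
  rewrite /rot /= drop0 nth_cat size_map size_cat /= ifT; last by lia.
  rewrite (nth_map y) ?nth_cat; last by rewrite size_cat /=; lia.
  by rewrite ltnNge leqnSn /= subSnn.
case=> -> ->; split=> //; first by rewrite -drop_nth // cat_take_drop.
by rewrite size_take lt1.
Qed.

End OutSlots.

Section Terms.
Variables (k : fieldType) (d : int) (A : quiver k) (M : multi A).
Hypothesis Mmulti : is_multi d (d + 2) M.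
Variables (v1 u v2 : seq (mletter A)) (x X Y y : ob A) (n : int).
Hypotheses (c1 : mcomp x v1 X) (cu : mcomp X u Y) (c2 : mcomp Y v2 y).
Hypothesis u0 : (0 < size u)%N.

Let D := mwdeg d u + 1 + 1.
Let W1 := rev (tb v2).
Let W2 := rev (initb x v1).
Let a := lastb x v1.
Let b : block A := (Y, hd v2).
Let T1 := tsum d (forms v1).
Let Tu := tsum d (forms u).
Let T2 := tsum d (forms v2).
Let fs := rev (forms v2) ++ rev (forms u) ++ rev (forms v1).

Lemma mcomp_inl z : lsrc z = X -> ltgt z = Y -> mcomp x (v1 ++ inl z :: v2) y.
Proof.
move=> e1 e2; apply/mcomp_cat; rewrite (mcomp_mend c1); split=> //=.
by rewrite e1 e2.
Qed.

Lemma mcomp_inr (f : letter (dual_quiver A)) : lsrc f = X -> ltgt f = Y -> mcomp x (v1 ++ inr f :: v2) y.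
Proof.
move=> e1 e2; apply/mcomp_cat; rewrite (mcomp_mend c1); split=> //=.
by rewrite e1 e2.
Qed.

(** By linearity of [M] in the plugged letter, a double sum over outputs of the
    inner and the outer disc is an iterated operation.  The sign [K] is arbitrary
    because the diagrams where the inner disc has one output and those where it
    has several only differ by it. *)
Lemma plug_inner (K : seq (letter A) -> seq (letter A) -> int) (c : int) :
  (forall g0 z q, odeg d g0 = - Tu -> ldeg z = D ->
     odeg d (take (size W1) q) = - T2 ->
     odeg d (drop (size W1) q) =
       bsdeg W1 + bdeg a + (D - 1) + bdeg b + bsdeg W2 + (d + 2) + T2 ->
     odeg d (take (size q).-1 q) = - (T1 + T2) ->
     par (K (rcons g0 z) q) =
     par (c + jsign d u + jsign d (v1 ++ inl z :: v2))) ->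
  \sum_(g <- M (rev (blocks X u)))
    \sum_(q <- M (W1 ++ plug a (drop (size g.2).-1 g.2) b :: W2))
      (sgn (K g.2 q.2) * g.1 * q.1) *:
        contract_last fs x y n (take (size W1) q.2 ++ take (size g.2).-1 g.2
                                ++ drop (size W1) q.2) =
  sgn c *: j_A d M (v1 ++ inl (Letter (j_A d M u X Y D)) :: v2) x y n.
Proof.
move=> KP.
pose F (w : A X Y D) := j_A d M (v1 ++ inl (Letter w) :: v2) x y n.
have Flin : linear F.
  by apply: (j_A_linear_inl Mmulti) => w; apply: mcomp_inl.
rewrite -/(F _) (j_A_eff Mmulti D u0 cu) (linear_scale Flin) /teval.
rewrite (linear_comb Flin) !scaler_sumr.
apply: eq_big_Forall (Mmulti.1 _ (is_input_blocks u0 cu)) _ => -[r g] /= [e1 e2].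
have [g0 [z [eg zs zt sg]]] := out_slots_last cu e1.
rewrite {g e1}eg in e2 *.
have -> : take (size (rcons g0 z)).-1 (rcons g0 z) = g0.
  by rewrite size_rcons /= -cats1 take_size_cat.
have -> : drop (size (rcons g0 z)).-1 (rcons g0 z) = [:: z].
  by rewrite size_rcons /= -cats1 drop_size_cat.
have sW1 : size W1 = size (rev (forms v2)) by rewrite !size_rev size_tb.
have inp : is_input (W1 ++ plug a [:: z] b :: W2).
  have := @is_input_blocks k A x (v1 ++ inl z :: v2) y.
  rewrite (rev_blocks_inl x v1 z v2 Y) size_cat addnS; apply=> //.
  exact: mcomp_inl.
have sg' : size (rev (forms u)) = size g0 by rewrite size_rev.
transitivity (\sum_(q <- M (W1 ++ plug a [:: z] b :: W2))
    (r * contract (rev (forms u)) g0) *: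
      ((sgn (K (rcons g0 z) q.2) * q.1) *:
       contract_last (rev (forms v2) ++ rev (forms v1)) x y n q.2)).
  apply: eq_big_Forall (Mmulti.1 _ inp) _ => -[r' q] /= [/out_slots_size sq _].
  have sq' : size (take (size W1) q) = size W1.
    by rewrite size_take sq size_cat /= ifT //; lia.
  have -> : contract_last (rev (forms v2) ++ rev (forms v1)) x y n q =
      contract (rev (forms v2)) (take (size W1) q) *:
      contract_last (rev (forms v1)) x y n (drop (size W1) q).
    by rewrite -{1}(cat_take_drop (size W1) q) contract_last_cat ?sq'.
  rewrite !contract_last_cat ?sq' //.
  by rewrite !scalerA; congr (_ *: _); ring.
have e2' : odeg d g0 + (ldeg z + d) = mwdeg d u - Tu + d + 2.
  move: e2; rewrite -cats1 odeg_cat odeg_cons odeg_nil addr0 => ->.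
  by rewrite bsdeg_rev bsdeg_cons mwdegE /Tu /bdeg /=; ring.
rewrite contract_last_rcons // (linear_scale Flin) -scaler_sumr.
have [->|c0] := eqVneq (contract (rev (forms u)) g0) 0.
  by rewrite mulr0 !scale0r !scaler0.
have og0 := contract_odeg d c0; rewrite tsum_rev -/Tu in og0.
have dz : ldeg z = D by rewrite /D; lia.
have zP := mcomp_inl zs zt.
rewrite /F (Letter_lcomp zs zt dz) (j_A_eff Mmulti n _ zP); last first.
  by rewrite size_cat addnS.
rewrite (rev_blocks_inl x v1 z v2 Y) forms_cat rev_cat /=.
rewrite (multi_sign Mmulti (s := K (rcons g0 z))
  (c := c + jsign d u + jsign d (v1 ++ inl z :: v2)) inp).
  rewrite !sgnD !scalerA; congr (_ *: _); ring.
move=> q _ oq /(contract_last_odeg d) [q' [z' [eq cq _ odq]]].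
have sq' := contract_size cq.
have tq : odeg d (take (size W1) q) = - T2.
  have tE : take (size W1) q = take (size W1) q'.
    by rewrite eq -cats1 takel_cat // sq' size_cat sW1 leq_addr.
  have st : size (rev (forms v2)) = size (take (size W1) q').
    by rewrite size_takel ?sW1 // sq' size_cat leq_addr.
  move: cq; rewrite -(cat_take_drop (size W1) q') contract_cat //.
  rewrite mulf_eq0 negb_or => /andP [cq2 _].
  by rewrite tE (contract_odeg d cq2) tsum_rev.
apply: KP => //; last first.
- rewrite eq size_rcons /= -cats1 take_size_cat // odq tsum_cat !tsum_rev.
  by rewrite /T1 /T2; ring.
- move: oq; rewrite -{1}(cat_take_drop (size W1) q) odeg_cat tq.
  rewrite bsdeg_cat bsdeg_cons /plug /bdeg /= wdeg_cat wdeg_cons dz => oq.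
  rewrite /bdeg /=; lia.
Qed.

Lemma mwdeg_blocks x' (v : seq (mletter A)) :
  mwdeg d v = bsdeg (blocks x' v) + tsum d (forms v).
Proof. by rewrite mwdegE bsdeg_cons. Qed.

Lemma rev_forms3 : rev (forms (v1 ++ u ++ v2)) = fs.
Proof. by rewrite !forms_cat !rev_cat -catA. Qed.

(** The common sign relating the terms of the [A_infinity]-relation to the
    diagrams. *)
Definition term_sign (v : seq (mletter A)) : int :=
  jsign d v + d * tsum d (forms v).

Lemma term_inner : tb u = [::] ->
  sgn (term_sign (v1 ++ u ++ v2)) *: (sgn (mwdeg d v1) *:
     j_A d M (v1 ++ inl (Letter (j_A d M u X Y D)) :: v2) x y n) =
  teval (contract_last (rev (forms (v1 ++ u ++ v2))) x y n)
    (nec_inner d M M W1 a (X, hd u) b W2).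
Proof.
move=> tu; have fu : forms u = [::].
  by apply: size0nil; rewrite -size_tb tu.
have bu : rev (blocks X u) = [:: (X, hd u)] by rewrite /blocks tu.
rewrite scalerA -sgnD rev_forms3.
pose K (g q : seq (letter A)) :=
  koszul [:: (1%N, bsdeg W1); (2%N, bdeg a); (0%N, bdeg (X, hd u));
             (3%N, bdeg b); (4%N, bsdeg W2)]
  + koszul [:: (2%N, wdeg (drop (size g).-1 g)); (0%N, bsdeg W1);
               (1%N, bdeg a); (3%N, bdeg b); (4%N, bsdeg W2)]
  + (d + 1) * odeg d (take (size g).-1 g)
  + (d + 1) * odeg d (take (size q).-1 q).
rewrite -(plug_inner (K := K)).
  rewrite bu /nec_inner teval_flatten /bold_out big_map.
  have := Mmulti.1 _ (is_input_blocks u0 cu); rewrite bu => gP.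
  apply: eq_big_Forall gP _ => -[r g] /= [e1 _].
  have [z ->] : exists z, g = [:: z].
    by have /= := out_slots_size e1; case: g {e1} => [|z []] // _; exists z.
  rewrite /= teval_map big_map; apply: eq_bigr => -[r' q] _ /=.
  rewrite cat_take_drop; congr (_ *: _).
  by rewrite /K /= !sgnD; ring.
move=> g0 z q og dz otq odq otl.
rewrite /K size_rcons /= -cats1 take_size_cat // drop_size_cat // og otl.
have hu : hd (u ++ v2) = hd u ++ hd v2.
  by have := blocks_cat X u v2; rewrite /blocks /initb /lastb tu => -[].
have lu : lastb X u = (X, hd u) by rewrite /lastb tu.
have Du : D = wdeg (hd u) + 2.
  by rewrite /D mwdegE tu fu bsdeg_nil /tsum big_nil; ring.
have Tu0 : Tu = 0 by rewrite /Tu fu /tsum big_nil.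
rewrite wdeg_cons wdeg_nil dz /W1 /W2 !bsdeg_rev -/a {1 2}/bdeg /=.
rewrite /koszul /= !(big_cons, big_nil) /=.
rewrite /term_sign (jsign_cat d x v1) (jsign_cat d X u) (jsign_cat d x v1).
rewrite hu lu !forms_cat !tsum_cat -/T1 -/T2 -/Tu Tu0.
rewrite /= !(mwdeg_cat, mwdeg_cons, wdeg_cat, wdeg_cons) /= dz.
rewrite (mwdeg_blocks x v1) !(blocks_lastI x v1) !bsdeg_rcons -/a -/T1.
rewrite !mwdegE tu fu [blocks X u]/blocks tu bsdeg_cons bsdeg_nil -/T2 Du.
by rewrite /tsum big_nil /bdeg /=; parity.
Qed.

Section Multi.
Variables (Bm : seq (block A)) (yy : block A).
Hypothesis tu : tb u = rcons Bm yy.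

Lemma rev_blocks_multi :
  rev (blocks X u) = yy :: rcons (rev Bm) (X, hd u).
Proof. by rewrite /blocks tu rev_cons rev_rcons. Qed.

Lemma hd_cat_multi : hd (u ++ v2) = hd u.
Proof.
have := blocks_cat X u v2; rewrite /blocks /initb tu.
by case: Bm => [|? ?] /= -[].
Qed.

Lemma lastb_multi : lastb X u = yy.
Proof. by rewrite /lastb tu last_rcons. Qed.

(** The inner disc has a free output, and the root is on the outer disc. *)
Lemma term_root_F :
  sgn (term_sign (v1 ++ u ++ v2)) *: (sgn (mwdeg d v1) *:
     j_A d M (v1 ++ inl (Letter (j_A d M u X Y D)) :: v2) x y n) =
  teval (contract_last (rev (forms (v1 ++ u ++ v2))) x y n)
    (nec_root_F d M M W1 yy b (rev Bm) a (X, hd u) W2).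
Proof.
rewrite scalerA -sgnD rev_forms3.
pose K (g q : seq (letter A)) :=
  koszul [:: (3%N, bsdeg W1); (0%N, bdeg yy); (4%N, bdeg b);
             (1%N, bsdeg (rev Bm)); (5%N, bdeg a); (2%N, bdeg (X, hd u));
             (6%N, bsdeg W2)]
  + koszul [:: (5%N, odeg d (take (size g).-1 g));
               (2%N, wdeg (drop (size g).-1 g)); (0%N, bsdeg W1);
               (3%N, bdeg b); (1%N, bdeg a); (4%N, bsdeg W2)]
  + koszul [:: (0%N, odeg d (take (size W1) q));
               (2%N, odeg d (drop (size W1) q) - (d + 1));
               (1%N, odeg d (take (size g).-1 g))]
  + (d + 1) * odeg d (take (size g).-1 g)
  + (d + 1) * odeg d (take (size q).-1 q).
rewrite -(plug_inner (K := K)).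
  rewrite rev_blocks_multi /nec_root_F teval_flatten /bold_out big_map.
  apply: eq_bigr => -[r g] _ /=.
  rewrite teval_map big_map; apply: eq_bigr => -[r' q] _ /=.
  congr (_ *: _).
  by rewrite /K !sgnD; ring.
move=> g0 z q og dz otq odq otl.
rewrite /K size_rcons /= -cats1 take_size_cat // drop_size_cat //.
rewrite og otl otq odq.
have hu := hd_cat_multi; have lu := lastb_multi.
have Du : D = wdeg (hd u) + bsdeg Bm + bdeg yy + Tu + 2.
  by rewrite /D mwdegE tu bsdeg_rcons -/Tu; ring.
rewrite wdeg_cons wdeg_nil dz /W1 /W2 !bsdeg_rev -/a.
rewrite /koszul /= !(big_cons, big_nil) /=.
rewrite /term_sign (jsign_cat d x v1) (jsign_cat d X u) (jsign_cat d x v1).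
rewrite hu lu !forms_cat !tsum_cat -/T1 -/T2 -/Tu.
rewrite /= !(mwdeg_cat, mwdeg_cons, wdeg_cons) /= dz.
rewrite (mwdeg_blocks x v1) !(blocks_lastI x v1) !bsdeg_rcons -/a -/T1.
rewrite !mwdegE [blocks X u]/blocks tu bsdeg_cons bsdeg_rcons -/T2 -/Tu Du.
by rewrite /bdeg /=; parity.
Qed.

Let m := D + (d - 1).

(** Here the inner operation is dual-valued: evaluating it on an output [z] of the
    disc containing the root amounts to plugging [z] into the inner disc. *)
Lemma term_root_G :
  sgn (term_sign (v1 ++ u ++ v2)) *: (sgn (mwdeg d v1) *:
     j_A d M (v1 ++ inr (@Letter _ (dual_quiver A) _ _ _ (j_dual d M u X Y m))
              :: v2) x y n) =
  teval (contract_last (rev (forms (v1 ++ u ++ v2))) x y n)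
    (nec_root_G d (d + 2) M M W1 yy b (rev Bm) a (X, hd u) W2).
Proof.
rewrite scalerA -sgnD rev_forms3.
set g' := j_dual _ _ _ _ _ _; set f' := Letter g'.
have fP : mcomp x (v1 ++ inr f' :: v2) y by apply: mcomp_inr.
have fs0 : (0 < size (v1 ++ inr f' :: v2))%N by rewrite size_cat addnS.
have inpG := is_input_blocks fs0 fP.
rewrite (j_A_eff Mmulti n fs0 fP) scalerA -sgnD.
rewrite rev_blocks_inr -/W1 -/W2 -/a -[(_, hd v2)]/b in inpG *.
rewrite forms_cat rev_cat /= rev_cons cat_rcons.
rewrite /nec_root_G teval_flatten /bold_out big_map [in LHS]/teval scaler_sumr.
apply: eq_big_Forall (Mmulti.1 _ inpG) _ => -[r g] /= [e1 eg].
have [g1 [z [g2 [gE sg1 zs zt]]]] := out_slots_middle e1.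
rewrite (lastb_end c1) in zt; rewrite [b.1]/= in zs.
have sW1 : size W1 = size (rev (forms v2)) by rewrite !size_rev size_tb.
have sg1' : size (rev (forms v2)) = size g1 by rewrite sg1.
rewrite {}gE {e1} in eg *.
have -> : take (size W1) (g1 ++ z :: g2) = g1 by rewrite -sg1 take_size_cat.
have -> : take 1 (drop (size W1) (g1 ++ z :: g2)) = [:: z].
  by rewrite -sg1 drop_size_cat //= take0.
have -> : drop (size W1).+1 (g1 ++ z :: g2) = g2.
  by rewrite -sg1 -cat_rcons -(size_rcons g1 z) drop_size_cat.
rewrite teval_map contract_last_cat //=.
case: z zs zt eg => s t m' w /= zs zt; move: w; rewrite {s}zs {t}zt => w eg.
have inpF := is_input_dual w cu tu.
rewrite -[plug _ _ _]/(yy.1, yy.2 ++ Letter w :: hd u).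
set Cg := contract _ g1; set Hg := contract_last _ _ _ _ g2.
have hE q : size q = size ((yy.1, yy.2 ++ Letter w :: hd u) :: rev Bm) ->
    contract_last fs x y n (g1 ++ q ++ g2) =
    (Cg * contract (rev (forms u)) q) *: Hg.
  rewrite /= size_rev => sq.
  have sq' : size (rev (forms u)) = size q.
    by rewrite sq size_rev -size_tb tu size_rcons.
  by rewrite !contract_last_cat // scalerA.
(* If [z] has the wrong degree, no output of the other disc can be contracted. *)
have [em|nm] := eqVneq m' (- m); last first.
  rewrite /dual_eval lcomp_out /=; last by case=> _ _ e; rewrite e eqxx in nm.
  rewrite dual_zero scale0r !scaler0; symmetry.
  rewrite (eq_big_Forall (G := fun=> 0) (Mmulti.1 _ inpF)); first by rewrite big1.
  move=> -[r' q] /= [/out_slots_size sq eq]; rewrite hE //.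
  have [->|c0] := eqVneq (contract (rev (forms u)) q) 0.
    by rewrite mulr0 scale0r scaler0.
  exfalso; move/eqP: nm; apply.
  move: eq; rewrite (contract_odeg d c0) tsum_rev bsdeg_cons bsdeg_rev.
  rewrite /bdeg /= wdeg_cat wdeg_cons /= /m /D mwdegE tu bsdeg_rcons /bdeg.
  by lia.
move: w eg inpF hE; rewrite {m'}em => w eg inpF hE.
have -> : dual_eval f' (Letter w) = g' w by rewrite /dual_eval /= lcomp_Letter.
rewrite /g' (j_dual_eff Mmulti w cu tu).
pose K (q : seq (letter A)) :=
  koszul [:: (0%N, bsdeg W1); (4%N, bdeg yy); (1%N, bdeg b);
             (6%N, bsdeg (rev Bm)); (2%N, bdeg a); (5%N, bdeg (X, hd u));
             (3%N, bsdeg W2)]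
  + koszul [:: (4%N, odeg d g1); (1%N, odeg d [:: Letter w]);
               (5%N, odeg d g2 - (d + 1)); (0%N, bdeg yy);
               (2%N, bdeg (X, hd u)); (3%N, bsdeg (rev Bm))]
  + (d + 1) * (d + 2) + (d + 2 + d + 1) * (d + 1) + (d + 1) * bdeg yy
  + koszul [:: (1%N, odeg d q); (0%N, odeg d g1);
               (2%N, odeg d g2 - (d + 1))]
  + (d + 1) * odeg d (take (size (g1 ++ Letter w :: g2)).-1
                        (g1 ++ Letter w :: g2)).
transitivity ((\sum_(q <- M ((yy.1, yy.2 ++ Letter w :: hd u) :: rev Bm))
      (sgn (K q.2) * q.1) *: (contract (rev (forms u)) q.2 : k^o))
    *: (r *: (Cg *: Hg))); last first.
  rewrite scaler_suml; apply: eq_big_Forall (Mmulti.1 _ inpF) _.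
  move=> -[r' q] /= [/out_slots_size sq _].
  rewrite hE // -[(_ *: _ : k^o)]/(_ * _) !scalerA.
  by congr (_ *: _); rewrite /K -!addrA !sgnD; ring.
have [H0|/eqP H0] := eqVneq (Cg *: Hg) 0.
  by rewrite H0 !scaler0 [Cg *: _]scalerA mulrC -scalerA H0 !scaler0.
have Cg0 : Cg != 0 by apply/eqP => e; apply: H0; rewrite e scale0r.
have Hg0 : Hg <> 0 by move=> e; apply: H0; rewrite e scaler0.
have og1 := contract_odeg d Cg0; rewrite tsum_rev -/T2 in og1.
have [g2' [z' [g2E _ _ og2']]] := contract_last_odeg d Hg0.
rewrite tsum_rev -/T1 in og2'.
have ol : odeg d (take (size (g1 ++ Letter w :: g2)).-1
                        (g1 ++ Letter w :: g2)) = - T2 + (d - m) - T1.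
  rewrite g2E -rcons_cons -rcons_cat size_rcons /= -cats1 take_size_cat //.
  by rewrite odeg_cat odeg_cons og1 og2' /=; ring.
have og2 : odeg d g2 = bsdeg W1 + bdeg b + bdeg a + bsdeg W2 + d + 2
                       + T2 - (d - m).
  move: eg; rewrite odeg_cat odeg_cons og1 /= bsdeg_cat !bsdeg_cons; lia.
set c := dual_sign d u Bm.
rewrite (multi_sign Mmulti (W := k^o) (s := K)
  (c := term_sign (v1 ++ u ++ v2) + mwdeg d v1
        + jsign d (v1 ++ inr f' :: v2) + c) inpF).
  rewrite !scalerA; congr (_ *: _).
  by rewrite -[(_ *: _ : k^o)]/(_ * _) !sgnD; ring.
move=> q _ oq _.
rewrite /K ol og1 og2 oq.
have hu := hd_cat_multi; have lu := lastb_multi.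
have Dm : m = wdeg (hd u) + bsdeg Bm + bdeg yy + Tu + d + 1.
  by rewrite /m /D mwdegE tu bsdeg_rcons -/Tu; ring.
rewrite /W1 /W2 odeg_cons odeg_nil !bsdeg_cons !bsdeg_rev -/a.
rewrite /koszul /= !(big_cons, big_nil) /=.
rewrite /c /dual_sign /term_sign (jsign_cat d x v1) (jsign_cat d X u) (jsign_cat d x v1).
rewrite hu lu !forms_cat !tsum_cat -/T1 -/T2 -/Tu.
rewrite /= !(mwdeg_cat, mwdeg_cons) /= /tdeg /=.
rewrite (mwdeg_blocks x v1) !(blocks_lastI x v1) !bsdeg_rcons -/a -/T1.
rewrite !mwdegE [blocks X u]/blocks tu bsdeg_cons bsdeg_rcons -/T2 -/Tu.
rewrite /bdeg /= wdeg_cat wdeg_cons /= wdeg_nil Dm /bdeg.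
by parity.
Qed.

End Multi.

End Terms.


Section PureRelation.
Variables (k : fieldType) (d : int) (A : quiver k) (M : multi A).
Hypothesis MP : is_preCY d M.
Implicit Types (v u : seq (mletter A)) (x y : ob A) (m n : int).

(** An operation on [A \oplus A^*[d-1]] has two components, so inserting one in a
    pure word gives two pure words. *)
Definition plugged v1 u v2 x y n : A x y n :=
  let X := mend x v1 in let Y := mend X u in
  let D := mwdeg d u + 1 + 1 in
  j_A d M (v1 ++ inl (Letter (j_A d M u X Y D)) :: v2) x y n
  + j_A d M (v1 ++ inr (@Letter _ (dual_quiver A) _ _ _
                          (j_dual d M u X Y (D + (d - 1)))) :: v2) x y n.

Lemma plugged_diagram v1 u v2 x y n : mcomp x (v1 ++ u ++ v2) y ->
  (if (0 < size u)%N then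
     sgn (term_sign d (v1 ++ u ++ v2)) *: (sgn (mwdeg d v1) *: plugged v1 u v2 x y n)
   else 0) =
  diagram d (d + 2) M M (contract_last (rev (forms (v1 ++ u ++ v2))) x y n)
    (rev (blocks x v1)) (rev (blocks (mend x v1) u))
    (rev (blocks (mend (mend x v1) u) v2)).
Proof.
case: MP => Mm _ _ /mcomp_cat [c1 /mcomp_cat [cu c2]].
have eX : rev (blocks x v1) = lastb x v1 :: rev (initb x v1).
  by rewrite blocks_lastI rev_rcons.
set X := mend x v1 in eX c1 cu c2 *; set Y := mend X u in c2 cu *.
have eY : rev (blocks Y v2) = rcons (rev (tb v2)) (Y, hd v2).
  by rewrite /blocks rev_cons.
rewrite eX eY; case/lastP tu: (tb u) => [|Bm yy].
- rewrite [blocks X u]/blocks tu diagram_single /=.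
  have -> : size (hd u) = size u by rewrite {2}(hd_nof tu) size_map.
  case: ifP => // u0; rewrite -(term_inner Mm _ c1 cu c2 u0 tu) /plugged -/X -/Y.
  rewrite j_dual_single //.
  have fP m (f : dual_quiver A X Y m) :
    mcomp x (v1 ++ inr (@Letter _ (dual_quiver A) _ _ _ f) :: v2) y.
    exact: (mcomp_inr c1 c2).
  by rewrite (linear_zero (j_A_linear_inr Mm n (fP _))) addr0.
- have u0 : (0 < size u)%N by case: (u) tu => //; case: (Bm).
  rewrite u0 (rev_blocks_multi _ tu) diagram_multi /plugged -/X -/Y.
  rewrite !scalerDr -(term_root_F Mm _ c1 cu c2 u0 tu).
  by rewrite -(term_root_G Mm _ c1 cu c2 u0 tu).
Qed.

(** The [A]-valued part of the [A_infinity]-relation on a pure word is, up to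
    a global sign, an evaluation of the necklace product. *)
Lemma pure_relation v x y n : (0 < size v)%N -> mcomp x v y ->
  \sum_(s <- splits v) \sum_(t <- splits s.1)
    (if (0 < size t.2)%N then
       sgn (mwdeg d t.1) *: plugged t.1 t.2 s.2 x y n else 0) = 0.
Proof.
move=> v0 vP; case: (MP) => _ _ M0.
have := M0 _ (is_input_blocks v0 vP) _ _
  (contract_last_multilinear (rev (forms v)) x y n).
rewrite teval_nil (nec_splits _ _ _ _ _ vP) => e.
apply: (@scalerI _ _ (sgn (term_sign d v))); first exact: sgn_neq0.
rewrite scaler0 -{}[RHS]e scaler_sumr.
apply: eq_big_Forall (splits_Forall v) _ => s es.
rewrite scaler_sumr; apply: eq_big_Forall (splits_Forall s.1) _ => t et.
have ev : t.1 ++ t.2 ++ s.2 = v by rewrite catA et.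
have := @plugged_diagram t.1 t.2 s.2 x y n; rewrite ev => /(_ vP).
by rewrite -mend_cat et => <-; case: ifP; rewrite ?scaler0.
Qed.

End PureRelation.

(** * Expanding words of [A \oplus A^*[d-1]] *)

Section InsertSum.
Variable k : fieldType.

Lemma insert_sum_splits (Q R : quiver k) (F0 : ob Q -> ob R) (f : op F0)
    (sm : @op k Q Q id) w x y n :
  insert_sum f sm w x y n =
  \sum_(s <- splits w) \sum_(t <- splits s.1)
    (if (0 < size t.2)%N then
       sgn (wdeg t.1) *:
         f (t.1 ++ out_letter 1 sm (wend x t.1) t.2 :: s.2) x y n else 0).
Proof.
rewrite /insert_sum (exchange_big_dep predT) //= splitsE big_map.
rewrite -[iota 0 _]/(index_iota 0 (size w).+1) big_mkord; apply: eq_bigr => j _.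
have jw : (j <= size w)%N by rewrite -ltnS.
rewrite /= splitsE big_map -[iota 0 _]/(index_iota 0 (size (take j w)).+1) big_mkord.
rewrite size_takel // big_ord_recr /= size_drop size_takel // subnn addr0.
pose G i : R (F0 x) (F0 y) n := if (0 < size (drop i (take j w)))%N then
  sgn (wdeg (take i (take j w))) *: f (take i (take j w) ++
    out_letter 1 sm (wend x (take i (take j w))) (drop i (take j w)) :: drop j w)
    x y n else 0.
rewrite -[RHS]/(\sum_(i < j) G i) (big_ord_widen _ G jw).
apply: eq_bigr => i ij.
by rewrite /G size_drop size_takel // subn_gt0 ij take_takel ?(ltnW ij).
Qed.

End InsertSum.

Section Expand.
Variables (k : fieldType) (d : int) (A : quiver k).
Local Notation AA := (AAdual d A).
Implicit Types (w : seq (letter AA)) (x y : ob A).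

Definition fst_letter (a : letter AA) : letter A := Letter (lelt a).1.
Definition snd_letter (a : letter AA) : letter (dual_quiver A) :=
  @Letter _ (dual_quiver A) _ _ _ (lelt a).2.

Lemma big_expand_cons (V : nmodType) (a : letter AA) w (F : seq (mletter A) -> V) :
  \sum_(v <- expand (a :: w)) F v =
  \sum_(v <- expand w)
    (F (inl (fst_letter a) :: v) + F (inr (snd_letter a) :: v)).
Proof. by rewrite /= cats0 big_cat !big_map big_split. Qed.

Lemma big_expand_cat (V : nmodType) w1 w2 (F : seq (mletter A) -> V) :
  \sum_(v <- expand (w1 ++ w2)) F v =
  \sum_(v1 <- expand w1) \sum_(v2 <- expand w2) F (v1 ++ v2).
Proof.
elim: w1 F => [|a w1 IH] F; first by rewrite big_seq1.
by rewrite cat_cons !big_expand_cons IH; apply: eq_bigr => v1 _; rewrite big_split.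
Qed.

Lemma big_expand_splits (V : nmodType) w
    (F : seq (mletter A) -> seq (mletter A) -> V) :
  \sum_(v <- expand w) \sum_(s <- splits v) F s.1 s.2 =
  \sum_(s <- splits w) \sum_(v1 <- expand s.1) \sum_(v2 <- expand s.2) F v1 v2.
Proof.
elim: w F => [|a w IH] F; first by rewrite /= !big_seq1.
rewrite big_splits_cons big_expand_cons.
under eq_bigr => v _ do rewrite !big_splits_cons addrACA.
rewrite big_split [X in _ = X + _]big_seq1 big_expand_cons; congr (_ + _).
rewrite big_split (IH (fun u v => F (_ :: u) v)) (IH (fun u v => F (_ :: u) v)).
rewrite -big_split; apply: eq_bigr => s _.
by rewrite big_expand_cons -big_split.
Qed.

Lemma expand_Forall w x y : @composable k AA x w y ->
  List.Forall (fun v => [/\ size v = size w, mcomp x v y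
                         & mwdeg d v = wdeg w]) (expand w).
Proof.
elim: w x => [|a w IH] x /=.
  by move=> e; constructor=> //; rewrite mwdeg_nil wdeg_nil.
case=> e /IH h; rewrite cats0; apply/Forall_cat; split.
  elim: h => //= v l [e1 e2 e3] _ IH'; constructor=> //.
  by split=> /=; rewrite ?e1 // mwdeg_cons wdeg_cons e3.
elim: h => //= v l [e1 e2 e3] _ IH'; constructor=> //.
split=> /=; rewrite ?e1 // mwdeg_cons wdeg_cons e3 /= /tdeg /=; ring.
Qed.

End Expand.


(** * Multilinearity of [j] *)

Section JDual.
Variables (k : fieldType) (d : int) (A : quiver k) (M : multi A).
Hypothesis Mmulti : is_multi d (d + 2) M.
Implicit Types (v u : seq (mletter A)) (x y : ob A) (m n : int).

Lemma contract_linear_form s t m (c : k) (f g : dual_quiver A s t m)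
    fs1 fs2 o :
  contract (fs1 ++ @Letter _ (dual_quiver A) _ _ _ (c *: f + g) :: fs2) o =
  c * contract (fs1 ++ @Letter _ (dual_quiver A) _ _ _ f :: fs2) o
  + contract (fs1 ++ @Letter _ (dual_quiver A) _ _ _ g :: fs2) o.
Proof.
elim: fs1 o => [|f1 fs1 IH] [|a o] /=; rewrite ?mulr0 ?addr0 //.
  by rewrite dual_eval_linl mulrDl mulrA.
by rewrite IH mulrDr mulrCA.
Qed.

Lemma tb_cat_nil v1 v2 : tb v1 = [::] ->
  hd (v1 ++ v2) = hd v1 ++ hd v2 /\ tb (v1 ++ v2) = tb v2.
Proof. by elim: v1 => [|[a|f] v1 IH] //= /IH [-> ->]. Qed.

Lemma tb_cat_cons v1 v2 B l : tb v1 = rcons B l ->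
  hd (v1 ++ v2) = hd v1 /\ tb (v1 ++ v2) = B ++ (l.1, l.2 ++ hd v2) :: tb v2.
Proof.
elim: v1 B l => [|[a|f] v1 IH] B l /=.
- by case: B.
- by move=> /IH [-> ->].
- case/lastP E: (tb v1) IH => [|B' l'] IH; rewrite ?E.
    case: B => [|? B]; last by case: B.
    move=> /= [<-] /=.
    by have [-> ->] := tb_cat_nil v2 E.
  rewrite -rcons_cons => /rcons_inj [<- <-].
  by have [-> ->] := IH B' l' erefl.
Qed.

Lemma jsign_inl v1 v2 s t m (a b : A s t m) :
  jsign d (v1 ++ inl (Letter a) :: v2) = jsign d (v1 ++ inl (Letter b) :: v2).
Proof.
have [x] : exists x : ob A, True by exists s.
by rewrite !(jsign_cat d x) /= !mwdeg_cons /= !wdeg_cons.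
Qed.

Lemma jsign_inr v1 v2 s t m (a b : dual_quiver A s t m) :
  jsign d (v1 ++ inr (@Letter _ (dual_quiver A) _ _ _ a) :: v2) =
  jsign d (v1 ++ inr (@Letter _ (dual_quiver A) _ _ _ b) :: v2).
Proof.
have [x] : exists x : ob A, True by exists s.
by rewrite !(jsign_cat d x) /= !mwdeg_cons /=.
Qed.

(** The letter lies in the first block if no form precedes it, in the last block
    if no form follows it, and in a middle block if it is surrounded by forms.
    In the first two cases it belongs to the block receiving the argument of the
    dual-valued operation, to the right or to the left of this argument. *)
Lemma j_dual_linear_inl x y n v1 v2 s t m :
  (forall a : A s t m, mcomp x (v1 ++ inl (Letter a) :: v2) y) ->
  linear (fun a : A s t m => j_dual d M (v1 ++ inl (Letter a) :: v2) x y n).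
Proof.
move=> vP c a b; apply: dual_ext => w.
rewrite dual_addE dual_scaleE.
case/lastP E1: (tb v1) => [|B1 l1]; case/lastP E2: (tb v2) => [|B2 l2].
- have tz z : tb (v1 ++ inl z :: v2) = [::].
    by have [_ ->] := tb_cat_nil (inl z :: v2) E1.
  by rewrite !j_dual_single ?dual_zeroE ?mulr0 ?addr0.
- have h z : hd (v1 ++ inl z :: v2) = hd v1 ++ z :: hd v2.
    by have [-> _] := tb_cat_nil (inl z :: v2) E1.
  have tz z : tb (v1 ++ inl z :: v2) = rcons B2 l2.
    by have [_ ->] := tb_cat_nil (inl z :: v2) E1; rewrite /= E2.
  rewrite !(j_dual_eff Mmulti _ (vP _) (tz _)) !h /dual_sign !h.
  have inp (a' : A s t m) := is_input_dual w (vP a') (tz _).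
  rewrite (jsign_inl v1 v2 (c *: a + b) a) (jsign_inl v1 v2 b a).
  rewrite !mwdeg_cat !mwdeg_cons !wdeg_cat !wdeg_cons /=.
  have e (a' : A s t m) : l2.2 ++ Letter w :: hd v1 ++ Letter a' :: hd v2 =
      (l2.2 ++ Letter w :: hd v1) ++ Letter a' :: hd v2 by rewrite -catA.
  have inp' (a' : A s t m) : is_input ([::] ++ (l2.1,
      (l2.2 ++ Letter w :: hd v1) ++ Letter a' :: hd v2) :: rev B2).
    by have := inp a'; rewrite h -e.
  have := multi_linear Mmulti (@contract_multilinear k A _) inp' c a b.
  rewrite !e !forms_cat /= => ->.
  by rewrite mulrDr; congr (_ + _); rewrite [LHS]mulrCA.
- have h z : hd (v1 ++ inl z :: v2) = hd v1.
    by have [-> _] := tb_cat_cons (inl z :: v2) E1.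
  have tz z : tb (v1 ++ inl z :: v2) = rcons B1 (l1.1, l1.2 ++ z :: hd v2).
    by have [_ ->] := tb_cat_cons (inl z :: v2) E1; rewrite /= E2 cats1.
  rewrite !(j_dual_eff Mmulti _ (vP _) (tz _)) !h /dual_sign !h.
  have inp (a' : A s t m) := is_input_dual w (vP a') (tz _).
  rewrite (jsign_inl v1 v2 (c *: a + b) a) (jsign_inl v1 v2 b a).
  rewrite !mwdeg_cat !mwdeg_cons /=.
  have e (a' : A s t m) : (l1.2 ++ Letter a' :: hd v2) ++ Letter w :: hd v1 =
      l1.2 ++ Letter a' :: (hd v2 ++ Letter w :: hd v1) by rewrite -catA.
  have inp' (a' : A s t m) : is_input ([::] ++ (l1.1,
      l1.2 ++ Letter a' :: (hd v2 ++ Letter w :: hd v1)) :: rev B1).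
    by have := inp a'; rewrite h -e.
  have := multi_linear Mmulti (@contract_multilinear k A _) inp' c a b.
  rewrite !e !forms_cat /= => ->.
  by rewrite mulrDr; congr (_ + _); rewrite [LHS]mulrCA.
- have h z : hd (v1 ++ inl z :: v2) = hd v1.
    by have [-> _] := tb_cat_cons (inl z :: v2) E1.
  have tz z : tb (v1 ++ inl z :: v2) =
      rcons (B1 ++ (l1.1, l1.2 ++ z :: hd v2) :: B2) l2.
    have [_ ->] := tb_cat_cons (inl z :: v2) E1.
    by rewrite /= E2 -rcons_cons -rcons_cat.
  rewrite !(j_dual_eff Mmulti _ (vP _) (tz _)) !h /dual_sign !h.
  have inp (a' : A s t m) := is_input_dual w (vP a') (tz _).
  rewrite (jsign_inl v1 v2 (c *: a + b) a) (jsign_inl v1 v2 b a).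
  rewrite !bsdeg_cat !bsdeg_cons /bdeg /= !wdeg_cat !wdeg_cons /=.
  rewrite !mwdeg_cat !mwdeg_cons /=.
  have e (a' : A s t m) :
      (l2.1, l2.2 ++ Letter w :: hd v1)
        :: rev (B1 ++ (l1.1, l1.2 ++ Letter a' :: hd v2) :: B2) =
      ((l2.1, l2.2 ++ Letter w :: hd v1) :: rev B2)
        ++ (l1.1, l1.2 ++ Letter a' :: hd v2) :: rev B1.
    by rewrite rev_cat rev_cons cat_rcons.
  have inp' (a' : A s t m) := inp a'.
  have {}inp' (a' : A s t m) : is_input (((l2.1, l2.2 ++ Letter w :: hd v1)
      :: rev B2) ++ (l1.1, l1.2 ++ Letter a' :: hd v2) :: rev B1).
    by have := inp a'; rewrite h e.
  have := multi_linear Mmulti (@contract_multilinear k A _) inp' c a b.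
  rewrite !e !forms_cat /= => ->.
  by rewrite mulrDr; congr (_ + _); rewrite [LHS]mulrCA.
Qed.

Lemma j_dual_linear_inr x y n v1 v2 s t m :
  (forall a : dual_quiver A s t m,
     mcomp x (v1 ++ inr (@Letter _ (dual_quiver A) _ _ _ a) :: v2) y) ->
  linear (fun a : dual_quiver A s t m =>
    j_dual d M (v1 ++ inr (@Letter _ (dual_quiver A) _ _ _ a) :: v2) x y n).
Proof.
move=> vP c a b; apply: dual_ext => w.
rewrite dual_addE dual_scaleE.
pose z0 := @Letter _ (dual_quiver A) _ _ _ (0 : dual_quiver A s t m).
have tE (a' : dual_quiver A s t m) :
    hd (v1 ++ inr (@Letter _ (dual_quiver A) _ _ _ a') :: v2) =
      hd (v1 ++ inr z0 :: v2) /\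
    tb (v1 ++ inr (@Letter _ (dual_quiver A) _ _ _ a') :: v2) =
      tb (v1 ++ inr z0 :: v2).
  by elim: (v1) => [|[e|e] v1' [IH1 IH2]] //=; rewrite ?IH1 ?IH2.
case/lastP E: (tb (v1 ++ inr z0 :: v2)) => [|B l].
  by have := size_tb (v1 ++ inr z0 :: v2); rewrite E forms_cat size_cat addnS.
have tz (a' : dual_quiver A s t m) : tb (v1 ++ inr (@Letter _ (dual_quiver A) _ _ _ a') :: v2) =
    rcons B l by have [_ ->] := tE a'.
rewrite !(j_dual_eff Mmulti _ (vP _) (tz _)) /dual_sign.
rewrite (jsign_inr v1 v2 (c *: a + b) a) (jsign_inr v1 v2 b a).
rewrite !(tE _).1 !mwdeg_cat !mwdeg_cons /=.
rewrite !forms_cat /= !rev_cat !rev_cons !cat_rcons.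
rewrite [in LHS]/teval -[X in _ = X + _]mulrCA -mulrDr; congr (_ * _).
rewrite /teval [c * _]mulr_sumr -big_split; apply: eq_bigr => q _ /=.
rewrite contract_linear_form -![(_ *: _ : k^o)]/(_ * _) mulrDr.
by congr (_ + _); rewrite mulrCA.
Qed.

End JDual.


Lemma sum_dual_ext (k : fieldType) (d : int) (A B : quiver k)
    (F0 : ob A -> ob B) x y n (a b : sum_dual d F0 x y n) :
  a.1 = b.1 -> a.2 = b.2 -> a = b.
Proof. by case: a b => [a1 a2] [b1 b2] /= -> ->. Qed.

Section JOp.
Variables (k : fieldType) (d : int) (A : quiver k) (M : multi A).
Local Notation AA := (AAdual d A).
Local Notation dlet := (@Letter _ (dual_quiver A) _ _ _).
Implicit Types (w : seq (letter AA)) (x y : ob A) (m n : int).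

Lemma big_expand_insert (V : nmodType) w1 (a : letter AA) w2
    (F : seq (mletter A) -> V) :
  \sum_(v <- expand (w1 ++ a :: w2)) F v =
  \sum_(v1 <- expand w1) \sum_(v2 <- expand w2)
    (F (v1 ++ inl (fst_letter a) :: v2) + F (v1 ++ inr (snd_letter a) :: v2)).
Proof.
rewrite big_expand_cat; apply: eq_bigr => v1 _.
by rewrite big_expand_cons.
Qed.

Lemma composable_insert w1 (a : letter AA) w2 x y :
  @composable k AA x (w1 ++ a :: w2) y ->
  [/\ @composable k AA x w1 (lsrc a) & @composable k AA (ltgt a) w2 y].
Proof. by move=> /composable_cat [h [e h']]; rewrite e. Qed.

Lemma mcomp_insert x (v1 : seq (mletter A)) c v2 y :
  mcomp x v1 (msrc c) -> mcomp (mtgt c) v2 y -> mcomp x (v1 ++ c :: v2) y.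
Proof. by move=> h1 h2; apply/mcomp_cat; rewrite (mcomp_mend h1). Qed.

(** Linearity on pure words extends to words in the direct sum, letter by
    letter. *)
Lemma expand_linear (V : lmodType k) (F : seq (mletter A) -> V) x y :
  (forall v1 v2 s t m,
     (forall a : A s t m, mcomp x (v1 ++ inl (Letter a) :: v2) y) ->
     linear (fun a : A s t m => F (v1 ++ inl (Letter a) :: v2))) ->
  (forall v1 v2 s t m,
     (forall a : dual_quiver A s t m, mcomp x (v1 ++ inr (dlet a) :: v2) y) ->
     linear (fun a : dual_quiver A s t m => F (v1 ++ inr (dlet a) :: v2))) ->
  forall w1 w2 s t m,
  (forall a : AA s t m, @composable k AA x (w1 ++ Letter a :: w2) y) ->
  linear (fun a : AA s t m => \sum_(v <- expand (w1 ++ Letter a :: w2)) F v).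
Proof.
move=> F1 F2 w1 w2 s t m wP c a b.
have [/expand_Forall h1 /expand_Forall h2] := composable_insert (wP 0).
rewrite !big_expand_insert scaler_sumr -big_split.
apply: eq_big_Forall h1 _ => v1 [_ h1 _].
rewrite scaler_sumr -big_split; apply: eq_big_Forall h2 _ => v2 [_ h2 _] /=.
rewrite scalerDr addrACA; congr (_ + _).
  by apply: F1 => e; apply: mcomp_insert.
by apply: F2 => e; apply: mcomp_insert.
Qed.

Hypothesis Mmulti : is_multi d (d + 2) M.

Lemma multi_zero (W : lmodType k) (h : seq (letter A) -> W) (X : seq (block A)) :
  is_input X ->
  (forall o, map (fun a => (lsrc a, ltgt a)) o = out_slots X ->
     odeg d o = bsdeg X + (d + 2) -> h o = 0) ->
  teval h (M X) = 0.
Proof.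
move=> XP h0; rewrite /teval (eq_big_Forall (G := fun=> 0) (Mmulti.1 _ XP)).
  by rewrite big1.
by move=> q [e1 e2]; rewrite h0 ?scaler0.
Qed.

Lemma j_A_degree (v : seq (mletter A)) x y n : (0 < size v)%N -> mcomp x v y ->
  n <> mwdeg d v + 2 -> j_A d M v x y n = 0.
Proof.
move=> v0 vP nD; rewrite (j_A_eff Mmulti n v0 vP).
rewrite multi_zero ?scaler0 //; first exact: is_input_blocks v0 vP.
move=> o _ eo; apply: contrapT.
move=> /(contract_last_odeg d) [o' [z [e _ [_ _ dz] od]]]; apply: nD.
move: eo; rewrite e -cats1 odeg_cat odeg_cons odeg_nil od dz tsum_rev.
rewrite bsdeg_rev bsdeg_cons mwdegE /bdeg /=; lia.
Qed.

Lemma j_dual_degree (v : seq (mletter A)) x y m : mcomp x v y ->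
  m <> mwdeg d v + d + 1 -> j_dual d M v x y m = 0.
Proof.
move=> vP mD; case/lastP tv: (tb v) => [|B l]; first exact: j_dual_single.
apply: dual_ext => w; rewrite dual_zeroE (j_dual_eff Mmulti w vP tv).
rewrite multi_zero ?mulr0 //; first exact: is_input_dual vP tv.
move=> o _ eo; apply/eqP; apply: contrapT => /negP c0; apply: mD.
move: eo; rewrite (contract_odeg d c0) tsum_rev bsdeg_cons bsdeg_rev.
rewrite /bdeg /= wdeg_cat wdeg_cons mwdegE tv bsdeg_rcons /bdeg /=; lia.
Qed.

Lemma j_op_is_op : is_op 1 (@j_op k d A M).
Proof.
split=> [w1 w2 s t n c a b x y m wP|w x y m w0 wP dP].
  have wP' (a' : AA s t n) : @composable k AA x (w1 ++ Letter a' :: w2) y.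
    have [h1 h2] := composable_insert wP; apply/composable_cat.
    by rewrite (composable_wend h1).
  move: wP' => {}wP.
  apply: sum_dual_ext.
    apply: (expand_linear (F := fun v => j_A d M v x y m)) wP c a b => v1 v2 s' t' m'.
      exact: j_A_linear_inl.
    exact: j_A_linear_inr.
  apply: (expand_linear (F := fun v => j_dual d M v x y (m + (d - 1)))) wP c a b
    => v1 v2 s' t' m'.
    exact: j_dual_linear_inl.
  exact: j_dual_linear_inr.
apply: sum_dual_ext => /=.
  rewrite (eq_big_Forall (G := fun=> 0) (expand_Forall wP)) ?big1 //.
  move=> v [e vP vd]; apply: j_A_degree; rewrite ?e //; rewrite vd; lia.
rewrite (eq_big_Forall (G := fun=> 0) (expand_Forall wP)) ?big1 //.
move=> v [e vP vd]; apply: j_dual_degree => //; rewrite vd; lia.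
Qed.

Lemma fst_sum_dual x y n I (r : seq I) (P : pred I) (F : I -> AA x y n) :
  (\sum_(i <- r | P i) F i).1 = \sum_(i <- r | P i) (F i).1.
Proof. by elim/big_rec2: _ => //= i a b _ <-. Qed.

Lemma snd_sum_dual x y n I (r : seq I) (P : pred I) (F : I -> AA x y n) :
  (\sum_(i <- r | P i) F i).2 = \sum_(i <- r | P i) (F i).2.
Proof. by elim/big_rec2: _ => //= i a b _ <-. Qed.

End JOp.

Section Relation.
Variables (k : fieldType) (d : int) (A : quiver k) (M : multi A).
Local Notation AA := (AAdual d A).
Hypothesis MP : is_preCY d M.
Implicit Types (w : seq (letter AA)) (x y : ob A) (m n : int).

(** Both sums over the expansions of the pieces and over the cuts can be carried
    out in either order, which reduces the relation to pure words. *)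
Lemma insert_sum_j_fst w x y n : (0 < size w)%N -> @composable k AA x w y ->
  (insert_sum (@j_op k d A M) (@j_op k d A M) w x y n).1 = 0.
Proof.
move=> w0 wP; have Mm : is_multi d (d + 2) M by case: MP.
rewrite insert_sum_splits fst_sum_dual.
transitivity (\sum_(v <- expand w) \sum_(s <- splits v) \sum_(t <- splits s.1)
    (if (0 < size t.2)%N then
       sgn (mwdeg d t.1) *: plugged d M t.1 t.2 s.2 x y n else 0)); last first.
  rewrite (eq_big_Forall (G := fun=> 0) (expand_Forall wP)) ?big1 //.
  by move=> v [e vP _]; rewrite (pure_relation MP) // e.
rewrite (big_expand_splits w (fun v' v2 => \sum_(t <- splits v')
  (if (0 < size t.2)%N then
       sgn (mwdeg d t.1) *: plugged d M t.1 t.2 v2 x y n else 0))).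
apply: eq_big_Forall (splits_Forall w) _ => -[w' w2] /= ew.
rewrite fst_sum_dual [RHS]exchange_big /=.
under [RHS]eq_bigr => v2 _ do rewrite (big_expand_splits w' (fun v1 u =>
  if (0 < size u)%N then sgn (mwdeg d v1) *: plugged d M v1 u v2 x y n else 0)).
rewrite [RHS]exchange_big /=.
apply: eq_big_Forall (splits_Forall w') _ => -[w1 u] /= ew'.
rewrite -{}ew' -catA in ew.
move: wP; rewrite -ew => /composable_cat [c1 /composable_cat [cu c2]].
have [u0|u0] := posnP (size u).
  rewrite (size0nil u0) /= big1 // => v2 _; rewrite big1 // => v1 _.
  by rewrite big_seq1.
rewrite [RHS]exchange_big /= big_expand_insert scaler_sumr.
apply: eq_big_Forall (expand_Forall c1) _ => v1 [_ h1 d1].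
rewrite scaler_sumr; apply: eq_big_Forall (expand_Forall c2) _ => v2 [_ h2 _].
set X := @wend k AA x w1 in c2 cu h1 h2 *; set Y := @wend k AA X u in c2 cu h2 *.
have inl0 m (e : A X Y m) : mcomp x (v1 ++ inl (Letter e) :: v2) y.
  exact: mcomp_insert.
have inr0 m (e : dual_quiver A X Y m) :
    mcomp x (v1 ++ inr (@Letter _ (dual_quiver A) _ _ _ e) :: v2) y.
  exact: mcomp_insert.
rewrite /fst_letter /snd_letter /out_letter /= -/Y.
rewrite (linear_bigsum (j_A_linear_inl Mm n (inl0 _))).
rewrite (linear_bigsum (j_A_linear_inr Mm n (inr0 _))).
rewrite -big_split scaler_sumr; apply: eq_big_Forall (expand_Forall cu) _.
move=> u' [eu h3 du].
by rewrite eu u0 -d1 /plugged (mcomp_mend h1) (mcomp_mend h3) du.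
Qed.

End Relation.


(** * The natural form and almost cyclicity *)

Section PurePairing.
Variables (k : fieldType) (d : int) (A : quiver k) (M : multi A).
Hypothesis Mmulti : is_multi d (d + 2) M.
Hypothesis Mcyc : cyclically_invariant d M.
Local Notation dlet := (@Letter _ (dual_quiver A) _ _ _).
Implicit Types (v : seq (mletter A)) (c p : mletter A) (x y z : ob A).

(** The natural form on the operation of a pure word and a pure letter. *)
Definition pairing v x y c : k :=
  match c with
  | inl b => sgn (mwdeg d v)
      * dual_eval (dlet (j_dual d M v x y (mwdeg d v + 1 + 1 + (d - 1)))) b
  | inr g => sgn (mwdeg d v * mdeg d c)
      * dual_eval g (Letter (j_A d M v x y (mwdeg d v + 1 + 1)))
  end.

Lemma is_input_rot (b : block A) X : is_input (b :: X) -> is_input (rcons X b).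
Proof.
case=> _ /List.Forall_cons_iff [h1 h2] h3; split.
- by rewrite size_rcons.
- by rewrite -cats1; apply/Forall_cat; split=> //; constructor.
- rewrite size_rcons => e; rewrite -cats1 map_cat flatten_cat size_cat addnC.
  by have := h3 e; rewrite /= size_cat cats0.
Qed.

(** Cyclic invariance of [M], contracted: the rotated output meets the rotated
    form. *)
Lemma contract_rot (b : block A) X f fs : is_input (b :: X) ->
  teval (W := k^o) (contract (f :: fs)) (M (b :: X)) =
  sgn (bdeg b * bsdeg X + tsum d fs * tdeg d f)
    * teval (W := k^o) (contract (rcons fs f)) (M (rcons X b)).
Proof.
move=> inp; have inp' := is_input_rot inp.
rewrite (Mcyc inp (@contract_multilinear k A _)) teval_scale sgnD.
rewrite -[LHS]/(_ * _) -mulrA; congr (_ * _).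
rewrite /tau_out teval_map /=.
pose s (o : seq (letter A)) := odeg d (take (size o).-1 o) * odeg d (drop (size o).-1 o).
rewrite -[RHS]/(_ *: (_ : k^o)).
rewrite -(multi_sign Mmulti (W := k^o) (s := s) inp').
  apply: eq_big_Forall (Mmulti.1 _ inp') _ => -[r o] /= [/out_slots_size so _].
  case/lastP: o so => [|o z]; rewrite size_rcons // => _.
  rewrite /s size_rcons /= -[rcons o z]cats1 take_size_cat // drop_size_cat //=.
  congr (_ *: _); rewrite -[rcons fs f]cats1.
  have [e|ne] := eqVneq (size o) (size fs).
    by rewrite contract_cat // -/(contract [:: f] [:: z]) /= mulr1 mulrC.
  have z1 : contract fs o = 0.
    by apply/eqP; apply: contraNT ne => /contract_size ->.
  rewrite z1 mulr0; symmetry; apply/eqP; apply: contraNT ne.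
  by move=> /contract_size; rewrite !size_cat /= !addn1 => -[->].
move=> o _ _ /eqP c0; have := contract_size c0.
case/lastP: o c0 => [|o z]; rewrite !size_rcons // => c0 [so].
rewrite /s size_rcons /= -[rcons o z]cats1 take_size_cat // drop_size_cat //.
move: c0; rewrite -!cats1 contract_cat // mulf_eq0 negb_or => /andP [c1 c2].
by rewrite (contract_odeg d c1) (contract_odeg d c2) /tsum big_seq1; parity.
Qed.

Lemma pairing_degree v x y c : (0 < size v)%N -> mcomp x v y ->
  mwdeg d v + mdeg d c + d + 2 <> 0 -> pairing v x y c = 0.
Proof.
move=> v0 vP; case: c => [b|g] /= nS.
all: set t := dual_eval _ _; have [->|] := eqVneq t 0; first by rewrite mulr0.
all: rewrite /t => /dual_eval_out [_ _ /= e]; exfalso; apply: nS.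
all: by rewrite /tdeg; lia.
Qed.

Lemma contract_last_form (g : letter (dual_quiver A)) fs x y n o :
  lsrc g = y -> ltgt g = x -> - ldeg g = n ->
  dual_eval g (Letter (contract_last fs x y n o)) = contract (rcons fs g) o.
Proof.
move=> gs gt gn; subst x y n.
have lin (e : k) (u v : A (ltgt g) (lsrc g) (- ldeg g)) : dual_eval g (Letter (e *: u + v)) =
    e * dual_eval g (Letter u) + dual_eval g (Letter v).
  exact: dual_eval_linr.
have ev0 : dual_eval g (Letter (0 : A (ltgt g) (lsrc g) (- ldeg g))) = 0.
  by rewrite /dual_eval lcomp0 dual_zero.
elim: fs o => [|f fs IH] [|z o] //=.
  case: o => [|? ?]; rewrite ?ev0 ?mulr0 ?mulr1 //.
  by rewrite /dual_eval lcomp_Letter.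
by have := lin (dual_eval f z) (contract_last fs (ltgt g) (lsrc g) (- ldeg g) o) 0;
  rewrite !addr0 ev0 addr0 IH => ->.
Qed.

Lemma pairing_inr v x y (g : letter (dual_quiver A)) :
  (0 < size v)%N -> mcomp x v y -> lsrc g = y -> ltgt g = x ->
  mwdeg d v + mdeg d (inr g) + d + 2 = 0 ->
  dual_eval g (Letter (j_A d M v x y (mwdeg d v + 1 + 1))) =
  sgn (jsign d v) * teval (W := k^o) (contract (rcons (rev (forms v)) g))
    (M (rev (blocks x v))).
Proof.
move=> v0 vP gs gt S0; rewrite (j_A_eff Mmulti _ v0 vP).
set D := mwdeg d v + 1 + 1.
have gl : linear (fun a : A x y D => dual_eval g (Letter a) : k^o).
  by move=> e a b; rewrite dual_eval_linr.
rewrite (linear_scale gl); congr (_ * _); rewrite /teval (linear_comb gl).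
apply: eq_bigr => q _; rewrite contract_last_form //.
by move: S0; rewrite /D /= /tdeg; lia.
Qed.

Lemma pairing_inl v x y (b : letter A) Bm b1 :
  mcomp x v y -> lsrc b = y -> ltgt b = x ->
  mwdeg d v + mdeg d (inl b) + d + 2 = 0 -> tb v = rcons Bm b1 ->
  dual_eval (dlet (j_dual d M v x y (mwdeg d v + 1 + 1 + (d - 1)))) b =
  sgn (dual_sign d v Bm) * teval (W := k^o) (contract (rev (forms v)))
    (M ((b1.1, b1.2 ++ b :: hd v) :: rev Bm)).
Proof.
move=> vP bs bt S0 tv; rewrite /dual_eval /= (j_dual_eff Mmulti _ vP tv).
by rewrite Letter_lcomp //; move: S0 => /=; lia.
Qed.

Lemma pairing_single v x y b : tb v = [::] -> pairing v x y (inl b) = 0.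
Proof.
by move=> tv; rewrite /= j_dual_single // dual_eval0l mulr0.
Qed.

Lemma tb_cat_inr v (f : letter (dual_quiver A)) v2 :
  hd (v ++ inr f :: v2) = hd v
  /\ tb (v ++ inr f :: v2) = tb v ++ (ltgt f, hd v2) :: tb v2.
Proof. by elim: v => [|[e|e] v [IH1 IH2]] //=; rewrite IH1 IH2. Qed.

Lemma is_input_closed v x y (b : letter A) Bm b1 : mcomp x v y ->
  lsrc b = y -> ltgt b = x -> tb v = rcons Bm b1 ->
  is_input ((b1.1, b1.2 ++ b :: hd v) :: rev Bm).
Proof.
case: b => s t n w vP /= es et; move: w; rewrite es et => w.
exact: is_input_dual.
Qed.

(** Both sides contract [M] with the same forms.  If the last input [p] is a letter
    of [A], the blocks are the same on both sides; if it is a form, they differ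
    by one rotation. *)
Lemma pairing_cyclic v x z y c p : mcomp x v z -> mcomp z [:: p] y ->
  mcomp y [:: c] x ->
  pairing (rcons v p) x y c =
  sgn (mdeg d c * mwdeg d (rcons v p)) * pairing (c :: v) y z p.
Proof.
move=> vP pP cP.
have vpP : mcomp x (rcons v p) y.
  by rewrite -cats1; apply/mcomp_cat; rewrite (mcomp_mend vP).
have cvP : mcomp y (c :: v) z by case: cP => /= -> ->.
have vp0 : (0 < size (rcons v p))%N by rewrite size_rcons.
have deg : mwdeg d (c :: v) + mdeg d p = mwdeg d (rcons v p) + mdeg d c.
  by rewrite -cats1 mwdeg_cat !mwdeg_cons mwdeg_nil; ring.
have [S0|nS] := eqVneq (mwdeg d (rcons v p) + mdeg d c + d + 2) 0; last first.
  by rewrite !pairing_degree ?mulr0 // ?deg; apply/eqP.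
have S0' : mwdeg d (c :: v) + mdeg d p + d + 2 = 0 by rewrite deg.
case: pP cP => ps pt [cs ct].
case: p c ps pt cs ct vpP cvP vp0 S0 S0' {deg} => [a|f] [b|g] ps pt cs ct vpP cvP vp0 S0 S0'.
all: rewrite -cats1 in vpP vp0 S0 *.
- case/lastP tv: (tb v) => [|B l].
    by rewrite !pairing_single ?mulr0 // (tb_cat_nil [:: inl a] tv).2.
  have [hvp] := tb_cat_cons [:: inl a] tv; rewrite /= [B ++ _]cats1 => tvp.
  rewrite /= (pairing_inl vpP cs ct S0 tvp) (pairing_inl cvP ps pt S0' tv) hvp.
  rewrite /= -catA !forms_cat cats0 !mulrA; congr (_ * _).
  rewrite -!sgnD /dual_sign; apply: sgn_par.
  have eb : ldeg b = - (mwdeg d v + ldeg a + d).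
    by move: S0; rewrite mwdeg_cat mwdeg_cons mwdeg_nil /=; lia.
  rewrite hvp (jsign_cat d x) /= !mwdeg_cat !mwdeg_cons !mwdeg_nil /=.
  rewrite !wdeg_cons wdeg_nil eb [blocks x v]/blocks bsdeg_cons tv bsdeg_rcons.
  rewrite /lastb tv last_rcons mwdegE tv bsdeg_rcons /bdeg /=; parity.
- have {}ct : ltgt g = x := ct.
  have tgv : tb (inr g :: v) = rcons (initb x v) (lastb x v).
    by rewrite /= ct; exact: blocks_lastI.
  rewrite /= (pairing_inr vp0 vpP cs ct S0) (pairing_inl cvP ps pt S0' tgv).
  rewrite blocks_cat rev_cat rev_cons /= forms_cat cats0.
  have ed : tdeg d g = - (mwdeg d v + ldeg a + d + 1).
    by move: S0; rewrite mwdeg_cat mwdeg_cons mwdeg_nil /=; lia.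
  rewrite -rev_cons !mulrA -!sgnD; congr (_ * _); apply: sgn_par.
  rewrite /dual_sign /= (jsign_cat d x) /= !mwdeg_cat !mwdeg_cons !mwdeg_nil /=.
  rewrite wdeg_cons wdeg_nil ed (blocks_lastI x v) bsdeg_rcons.
  rewrite (mwdeg_blocks d x) (blocks_lastI x v) bsdeg_rcons /bdeg; parity.
- have [hvf tvf] := tb_cat_inr v f [::]; rewrite [tb v ++ _]cats1 in tvf.
  have {}pt : ltgt f = y := pt.
  rewrite /= (pairing_inl vpP cs ct S0 tvf) (pairing_inr _ cvP ps pt S0') //.
  have inp := is_input_closed vpP cs ct tvf.
  rewrite forms_cat rev_cat [rev (forms [:: inr f])]/= [[:: f] ++ _]/=.
  rewrite (contract_rot _ _ inp) hvf /= -rev_cons pt.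
  have eb : ldeg b = - (mwdeg d v + tdeg d f + d + 1).
    by move: S0; rewrite mwdeg_cat mwdeg_cons mwdeg_nil /=; lia.
  rewrite -[blocks y _]/((y, b :: hd v) :: tb v) [rev (_ :: tb v)]rev_cons.
  rewrite !mulrA; congr (_ * _).
  rewrite -!sgnD /dual_sign; apply: sgn_par.
  rewrite /= hvf bsdeg_rev !(jsign_cat d x) /= !mwdeg_cat !mwdeg_cons !mwdeg_nil.
  rewrite /bdeg /= wdeg_cons wdeg_nil tsum_rev (mwdegE d v) eb mwdegE.
  by rewrite [blocks x v]/blocks bsdeg_cons /bdeg /=; parity.
- have [hvf tvf] := tb_cat_inr v f [::]; rewrite [tb v ++ _]cats1 in tvf.
  have {}pt : ltgt f = y := pt; have {}ct : ltgt g = x := ct.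
  rewrite /= (pairing_inr vp0 vpP cs _ S0) // (pairing_inr _ cvP ps pt S0') //.
  have inp := is_input_blocks vp0 vpP.
  have bE : rev (blocks x (v ++ [:: inr f])) = (ltgt f, [::]) :: rev (blocks x v).
    by rewrite /blocks tvf hvf -rcons_cons rev_rcons.
  rewrite bE in inp *.
  rewrite forms_cat rev_cat [rev (forms [:: inr f])]/= [[:: f] ++ _]/=.
  rewrite rcons_cons (contract_rot _ _ inp) /= rev_cons pt.
  rewrite -[blocks y _]/((y, [::]) :: (ltgt g, hd v) :: tb v) ct rev_cons.
  rewrite !mulrA; congr (_ * _); last by rewrite !rev_cons.
  have ef : tdeg d f = - (mwdeg d v + tdeg d g + d + 2).
    by move: S0; rewrite mwdeg_cat mwdeg_cons mwdeg_nil /=; lia.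
  rewrite -!sgnD; apply: sgn_par.
  rewrite /= ?bsdeg_rev !(jsign_cat d x) /= !mwdeg_cat !mwdeg_cons !mwdeg_nil.
  rewrite /bdeg /= wdeg_nil -[rcons _ g]cats1 tsum_cat tsum_rev /tsum big_seq1 -/(tsum _ _).
  by rewrite mwdegE [blocks x v]/blocks bsdeg_cons ef /bdeg /=; parity.
Qed.

End PurePairing.


Lemma form_lettersE (k : fieldType) (Q : quiver k) (G : Defs.form Q) x y m n
    (a : Q x y m) (b : Q y x n) :
  form_letters G (Letter a) (Letter b) x y = G x y m n a b.
Proof. by rewrite /form_letters /= !lcomp_Letter. Qed.

Lemma out_letterE (k : fieldType) (Q R : quiver k) (F0 : ob Q -> ob R)
    (f : op F0) r x w y : composable x w y ->
  out_letter r f x w = Letter (f w x y (wdeg w + r + 1)).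
Proof. by move=> /composable_wend e; rewrite /out_letter e. Qed.

Section BigSplitsRcons.
Variables (T : Type) (V : nmodType).

Lemma big_splits_rcons (s : seq T) a (F : seq T -> seq T -> V) :
  \sum_(p <- splits (rcons s a)) F p.1 p.2 =
  \sum_(p <- splits s) F p.1 (rcons p.2 a) + F (rcons s a) [::].
Proof.
elim: s F => [|b s IH] F; first by rewrite /= big_cons !big_seq1.
rewrite rcons_cons !big_splits_cons /= -addrA; congr (_ + _).
exact: (IH (fun u v => F (b :: u) v)).
Qed.

End BigSplitsRcons.

(** * The relation paired with a last letter *)

Section Rotation.
Variables (k : fieldType) (Q : quiver k) (G : Defs.form Q) (sm : @op k Q Q id).
Variable e : int.
Hypothesis Gform : is_form e G.
Hypothesis Gsym : forall x y m n (a : Q x y m) (b : Q y x n),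
  @G x y m n a b = - sgn ((m - 1) * (n - 1)) * @G y x n m b a.
Hypothesis smop : is_op 1 sm.
Hypothesis smcyc : almost_cyclic G sm.
Implicit Types (w : seq (letter Q)) (x y u : ob Q) (p q : letter Q).

Lemma form_letters_linear x y m q :
  linear (fun a : Q x y m => form_letters G (Letter a) q x y : k^o).
Proof.
move=> c a b; rewrite /form_letters /= !lcomp_Letter.
by case: Gform => -> _ _.
Qed.

Lemma form_letters_sym p q x y : lsrc p = x -> ltgt p = y ->
  lsrc q = y -> ltgt q = x ->
  form_letters G p q x y =
    - sgn ((ldeg p - 1) * (ldeg q - 1)) * form_letters G q p y x.
Proof. by move=> *; rewrite /form_letters Gsym. Qed.

Lemma almost_cyclicE w p q x u y D D' :
  composable x w u -> composable u [:: p] y -> composable y [:: q] x ->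
  D = wdeg (rcons w p) + 2 -> D' = wdeg (q :: w) + 2 ->
  form_letters G (Letter (sm (rcons w p) x y D)) q x y =
    sgn ((ldeg q - 1) * wdeg (rcons w p)) *
    form_letters G (Letter (sm (q :: w) y u D')) p y u.
Proof.
move=> wP pP qP -> ->; have := smcyc wP pP qP.
have wpP : composable x (rcons w p) y.
  by rewrite -cats1; apply/composable_cat; rewrite (composable_wend wP).
have qwP : composable y (q :: w) u by case: qP => /= -> ->.
rewrite (out_letterE _ _ wpP) (out_letterE _ _ qwP).
by rewrite -![_ + 1 + 1]addrA.
Qed.

(** The [A_infinity]-relation, paired with a last letter, is cyclic: insertions
    avoiding the last input are rotated, and those containing it are turned,
    by symmetry of the form, into insertions containing the first one. *)
Lemma insert_sum_cyclic w p q x u y D D' :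
  composable x w u -> composable u [:: p] y -> composable y [:: q] x ->
  D = wdeg (rcons w p) + 3 -> D' = wdeg (q :: w) + 3 ->
  form_letters G (Letter (insert_sum sm sm (rcons w p) x y D)) q x y =
    sgn ((ldeg q - 1) * wdeg (rcons w p)) *
    form_letters G (Letter (insert_sum sm sm (q :: w) y u D')) p y u.
Proof.
move=> wP pP qP eD eD'; rewrite !insert_sum_splits.
pose T x0 y0 n w1 v w2 : Q x0 y0 n := if (0 < size v)%N then
  sgn (wdeg w1) *: sm (w1 ++ out_letter 1 sm (wend x0 w1) v :: w2) x0 y0 n else 0.
rewrite (big_splits_rcons _ _ (fun v w2 =>
  \sum_(t <- splits v) T x y D t.1 t.2 w2)).
rewrite (big_splits_rcons _ _ (fun w1 v => T x y D w1 v [::])).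
rewrite [T _ _ _ _ [::] _]/T /= addr0.
have -> : \sum_(s <- splits (q :: w)) \sum_(t <- splits s.1) T y u D' t.1 t.2 s.2
  = \sum_(s <- splits w) \sum_(t <- splits s.1) T y u D' (q :: t.1) t.2 s.2
    + \sum_(t <- splits w) T y u D' [::] (q :: t.1) t.2.
  rewrite -big_splits3 big_splits_cons big_splits_cons [T _ _ _ _ [::] _]/T /=.
  by rewrite add0r addrC (big_splits3 _ (fun w1 v w2 => T y u D' (q :: w1) v w2)).
have lin1 := form_letters_linear q.
have lin2 := form_letters_linear p.
rewrite !(linear_add (lin1 _ _ _)) !(linear_add (lin2 _ _ _)) mulrDr.
congr (_ + _).
  rewrite (linear_bigsum (lin1 _ _ _)) (linear_bigsum (lin2 _ _ _)) mulr_sumr.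
  apply: eq_big_Forall (splits_Forall w) _ => -[w' w2] /= ew.
  rewrite (linear_bigsum (lin1 _ _ _)) (linear_bigsum (lin2 _ _ _)) mulr_sumr.
  apply: eq_big_Forall (splits_Forall w') _ => -[w1 v] /= ew'.
  rewrite /T; case: ifP => [_|_]; last first.
    by rewrite (linear_zero (lin1 _ _ _)) (linear_zero (lin2 _ _ _)) mulr0.
  have {ew ew'}ew : w = w1 ++ v ++ w2 by rewrite -ew -ew' catA.
  move: wP; rewrite ew => /composable_cat [c1 /composable_cat [cv c2]].
  have [qs qt] : lsrc q = y /\ ltgt q = x by case: qP => /=.
  rewrite (_ : wend y (q :: w1) = wend x w1); last by rewrite /wend /= qt.
  rewrite (linear_scale (lin1 _ _ _)) (linear_scale (lin2 _ _ _)).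
  set L := out_letter 1 sm (wend x w1) v.
  have c : composable x (w1 ++ L :: w2) u by apply/composable_cat; split.
  have dL : ldeg L = wdeg v + 2 by rewrite /L /=; ring.
  rewrite -rcons_cons -rcons_cat (almost_cyclicE (D' := D') c pP qP).
  - rewrite -![_ *: (_ : k^o)]/(_ * _) !mulrA -!sgnD; congr (_ * _).
    apply: sgn_par. rewrite -!cats1 !wdeg_cat !wdeg_cons dL wdeg_nil.
    by parity.
  - rewrite eD ew -!cats1 !wdeg_cat !wdeg_cons wdeg_nil dL; ring.
  - rewrite eD' ew !wdeg_cons !wdeg_cat !wdeg_cons dL; ring.
rewrite (linear_bigsum (lin1 _ _ _)) (linear_bigsum (lin2 _ _ _)) mulr_sumr.
apply: eq_big_Forall (splits_Forall w) _ => -[w1 v] /= ew.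
rewrite /T size_rcons /=.
move: wP; rewrite -ew => /composable_cat [c1 cv].
set z := wend x w1 in c1 cv *.
have [qs qt] : lsrc q = y /\ ltgt q = x by case: qP => /=.
have cvp : composable z (rcons v p) y.
  by rewrite -cats1; apply/composable_cat; rewrite (composable_wend cv).
have cqw : composable y (q :: w1) z by split=> //; rewrite qt.
rewrite (linear_scale (lin1 _ _ _)) (linear_scale (lin2 _ _ _)).
rewrite [wend y [::]]/= (out_letterE _ _ cvp) (out_letterE _ _ cqw).
set L := Letter (sm _ z y _); set L' := Letter (sm _ y z _).
have dL : ldeg L = wdeg v + (ldeg p - 1) + 2.
  by rewrite /L /= -cats1 wdeg_cat wdeg_cons wdeg_nil; ring.
have dL' : ldeg L' = ldeg q - 1 + wdeg w1 + 2.
  by rewrite /L' /= wdeg_cons; ring.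
have LP : composable z [:: L] y by split.
have LP' : composable y [:: L'] z by split.
rewrite cats1 (almost_cyclicE (D' := ldeg L') c1 LP qP).
- rewrite -[Letter (sm (q :: w1) y z (ldeg L'))]/L'.
  rewrite (form_letters_sym (p := L')) //.
  rewrite {2}/L (almost_cyclicE (D' := D') cv pP LP').
  + rewrite -![_ *: (_ : k^o)]/(_ * _) sgn_opp !mulrA -!sgnD.
    congr (_ * _); apply: sgn_par.
    rewrite -!cats1 !wdeg_cat !wdeg_cons wdeg_nil dL dL'; parity.
  + by rewrite -cats1 wdeg_cat wdeg_cons wdeg_nil; ring.
  + by rewrite eD' -ew !wdeg_cons wdeg_cat dL'; ring.
- by rewrite eD -ew -!cats1 !wdeg_cat !wdeg_cons wdeg_nil dL; ring.
- by rewrite dL' wdeg_cons; ring.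
Qed.

End Rotation.


Section NaturalForm.
Variables (k : fieldType) (d : int) (A B : quiver k) (F0 : ob A -> ob B).
Variable F : forall x y n, {linear A x y n -> B (F0 x) (F0 y) n}.
Local Notation AB := (sum_dual d F0).

Lemma natural_form_is_form :
  is_form (d - 1) (@natural_form k d A B F0 (fun x y n => F x y n)).
Proof.
split.
- move=> x y m n c a a' b; rewrite /natural_form /=.
  rewrite [c *: a.1 + a'.1]/= linearP dual_eval_linr dual_eval_linl; ring.
- move=> x y m n c a b b'; rewrite /natural_form /=.
  rewrite linearP dual_eval_linr dual_eval_linl; ring.
- move=> x y m n a b mn; rewrite /natural_form.
  set t1 := dual_eval _ _; set t2 := dual_eval _ _.
  have -> : t1 = 0.
    have [//|] := eqVneq t1 0; rewrite /t1 => /dual_eval_out [_ _ /= e].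
    by exfalso; apply: mn; lia.
  have -> : t2 = 0.
    have [//|] := eqVneq t2 0; rewrite /t2 => /dual_eval_out [_ _ /= e].
    by exfalso; apply: mn; lia.
  by rewrite !mulr0 subr0.
Qed.

Lemma natural_form_sym x y m n (a : AB x y m) (b : AB y x n) :
  @natural_form k d A B F0 (fun x y n => F x y n) x y m n a b =
  - sgn ((m - 1) * (n - 1)) *
    @natural_form k d A B F0 (fun x y n => F x y n) y x n m b a.
Proof.
rewrite /natural_form [(n - 1) * (m - 1)]mulrC.
have e := sgn_sq k ((m - 1) * (n - 1)).
set s := sgn _ in e *; set t1 := dual_eval _ _; set t2 := dual_eval _ _.
rewrite -[sgn (m - 1 + 1) * t1 in LHS]mul1r -e; ring.
Qed.

End NaturalForm.

Section Ainf.
Variables (k : fieldType) (d : int) (A : quiver k) (M : multi A).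
Hypothesis MP : is_preCY d M.
Local Notation AA := (AAdual d A).
Local Notation J := (@j_op k d A M).
Local Notation Gam := (@Gamma k d A).
Implicit Types (w : seq (letter AA)) (x y u : ob A) (m n : int).

Let Mmulti : is_multi d (d + 2) M. Proof. by case: MP. Qed.
Let Mcyc : cyclically_invariant d M. Proof. by case: MP. Qed.

Lemma Gamma_is_form : is_form (d - 1) Gam.
Proof. exact: (@natural_form_is_form k d A A id (fun x y n => idfun)). Qed.

Lemma Gamma_sym x y m n (a : AA x y m) (b : AA y x n) :
  @Gamma k d A x y m n a b = - sgn ((m - 1) * (n - 1)) * @Gamma k d A y x n m b a.
Proof. exact: (@natural_form_sym k d A A id (fun x y n => idfun)). Qed.

Lemma Gamma_j w x y n (q : AA y x n) :
  @composable k AA x w y ->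
  @Gamma k d A x y (wdeg w + 1 + 1) n (J w x y (wdeg w + 1 + 1)) q =
  \sum_(v <- expand w)
    (pairing d M v x y (inl (fst_letter (Letter q)))
     + pairing d M v x y (inr (snd_letter (Letter q)))).
Proof.
move=> wP; rewrite /Gamma /natural_form /=.
set D := wdeg w + 1 + 1.
have l1 : linear (fun f : dual_quiver A x y (D + (d - 1)) =>
    sgn (D - 1 + 1) * dual_eval (@Letter _ (dual_quiver A) _ _ _ f) (Letter q.1)
    : k^o).
  move=> c f g; rewrite dual_eval_linl mulrDr; congr (_ + _); exact: mulrCA.
have l2 : linear (fun a : A x y D => - (sgn ((D - 1) * (n - 1)) * sgn (n - 1 + 1)
   * dual_eval (@Letter _ (dual_quiver A) y x _ q.2) (Letter a)) : k^o).
  move=> c f g; rewrite dual_eval_linr mulrDr opprD; congr (_ + _).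
  by rewrite mulrCA -mulrN.
rewrite (linear_bigsum l1) (linear_bigsum l2) -big_split /=.
apply: eq_big_Forall (expand_Forall wP) _ => v [_ _ dv].
rewrite dv -/D /tdeg; congr (_ * _ + _).
  by apply: sgn_par; rewrite /D; parity.
rewrite -mulNr; congr (_ * _).
rewrite -sgnD sgn_opp; apply: sgn_par.
by rewrite /D /=; parity.
Qed.

Lemma j_op_almost_cyclic : almost_cyclic Gam J.
Proof.
move=> w p q x u y wP.
case: p => s1 t1 n1 p1 [/= e1 e2]; case: q => s2 t2 n2 q1 [/= e3 e4].
move: p1 q1; rewrite {s1}e1 {t1}e2 {s2}e3 {t2}e4 => p q.
have wpP : @composable k AA x (rcons w (Letter p)) y.
  by rewrite -cats1; apply/composable_cat; rewrite (composable_wend wP).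
have qwP : @composable k AA y (Letter q :: w) u by split.
rewrite (out_letterE _ _ wpP) (out_letterE _ _ qwP) !form_lettersE.
rewrite !Gamma_j // big_expand_cons -cats1 big_expand_cat mulr_sumr.
apply: eq_big_Forall (expand_Forall wP) _ => v [_ vP dv].
rewrite big_expand_cons big_seq1 !cats1.
have sE (p' : mletter A) : mdeg d p' = n1 - 1 ->
    sgn ((n2 - 1) * wdeg (w ++ [:: Letter p])) =
    sgn ((n2 - 1) * mwdeg d (rcons v p')) :> k.
  move=> e; congr (sgn (_ * _)).
  by rewrite wdeg_cat wdeg_cons wdeg_nil -cats1 mwdeg_cat mwdeg_cons mwdeg_nil dv e.
have mE (c : mletter A) : mdeg d c = n2 - 1 -> forall p' : mletter A, mdeg d p' = n1 - 1 ->
    msrc c = y -> mtgt c = x -> msrc p' = u -> mtgt p' = y ->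
    pairing d M (rcons v p') x y c =
    sgn ((n2 - 1) * wdeg (w ++ [:: Letter p])) * pairing d M (c :: v) y u p'.
  move=> ec p' ep c1 c2 p1 p2; rewrite (sE _ ep) -ec.
  by apply: (pairing_cyclic Mmulti Mcyc vP); split.
have dq : mdeg d (inr (snd_letter (Letter q))) = n2 - 1.
  by rewrite /= /tdeg /=; ring.
have dp : mdeg d (inr (snd_letter (Letter p))) = n1 - 1.
  by rewrite /= /tdeg /=; ring.
set pl := inl (fst_letter (Letter p)); set ql := inl (fst_letter (Letter q)).
rewrite (mE ql erefl pl erefl) // (mE ql erefl _ dp) //.
rewrite (mE _ dq pl erefl) // (mE _ dq _ dp) //.
by rewrite -!mulrDr addrACA cats1.
Qed.

Lemma insert_sum_degree w x y n : @composable k AA x w y -> n <> wdeg w + 3 ->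
  insert_sum J J w x y n = 0.
Proof.
move=> wP nD; rewrite insert_sum_splits.
rewrite (eq_big_Forall (G := fun=> 0) (splits_Forall w)) ?big1 //.
move=> [w' w2] /= ew.
rewrite (eq_big_Forall (G := fun=> 0) (splits_Forall w')) ?big1 //.
move=> [w1 v] /= ew'; case: ifP => // _.
have {ew ew'}ew : w = w1 ++ v ++ w2 by rewrite -ew -ew' catA.
move: wP; rewrite ew => /composable_cat [c1 /composable_cat [cv c2]].
rewrite (j_op_is_op Mmulti).2 ?scaler0 ?size_cat ?addnS //.
  by apply/composable_cat; split.
rewrite wdeg_cat wdeg_cons /= => e; apply: nD.
by rewrite ew !wdeg_cat; lia.
Qed.

Definition no_dual w := List.Forall (fun a : letter AA => (lelt a).2 = 0) w.

(** In the expansion, each word with forms contains the form 0, and the word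
    without forms has a single block. *)
Lemma j_op_no_dual w x y n : @composable k AA x w y -> no_dual w ->
  (J w x y n).2 = 0.
Proof.
move=> + h; rewrite /=; set m := n + (d - 1).
suff H (pre : seq (letter A)) z :
    @mcomp k A x (map inl pre) z -> @composable k AA z w y ->
    \sum_(v <- expand w) j_dual d M (map inl pre ++ v) x y m = 0.
  by move=> wP; exact: (H [::] x).
elim: h pre z => [|a w' a0 _ IH] pre z preP.
  move=> _; rewrite big_seq1 cats0 j_dual_single //.
  by elim: (pre).
case=> az wP; rewrite big_expand_cons.
have w'P := expand_Forall wP.
rewrite (eq_big_Forall (G := fun v =>
  j_dual d M (map inl (rcons pre (fst_letter a)) ++ v) x y m) w'P).
  apply: (IH _ (ltgt a)) => //.
  by rewrite map_rcons -cats1; apply/mcomp_cat; rewrite (mcomp_mend preP).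
move=> v [_ vP _]; rewrite map_rcons cat_rcons /snd_letter a0.
rewrite (linear_zero (j_dual_linear_inr Mmulti _ _)) ?addr0 // => f.
by apply: mcomp_insert => //=; rewrite az.
Qed.

Lemma insert_sum_no_dual w x y n : @composable k AA x w y -> no_dual w ->
  (insert_sum J J w x y n).2 = 0.
Proof.
move=> wP w0; rewrite insert_sum_splits snd_sum_dual.
rewrite (eq_big_Forall (G := fun=> 0) (splits_Forall w)) ?big1 //.
move=> [w' w2] /= ew; rewrite snd_sum_dual.
rewrite (eq_big_Forall (G := fun=> 0) (splits_Forall w')) ?big1 //.
move=> [w1 v] /= ew'; case: ifP => // _.
have {ew ew'}ew : w = w1 ++ v ++ w2 by rewrite -ew -ew' catA.
move: wP w0; rewrite ew => /composable_cat [c1 /composable_cat [cv c2]].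
move=> /Forall_cat [k1 /Forall_cat [kv k2]].
rewrite -[LHS]/(_ *: (J _ x y n).2) j_op_no_dual ?scaler0 //.
  by apply/composable_cat; split.
apply/Forall_cat; split=> //; constructor=> //.
exact: (j_op_no_dual _ cv kv).
Qed.

(** Induction on the number of letters that have not yet been rotated to the front
    and stripped of their dual component. *)
Lemma Gamma_insert_sum w w' (q : letter AA) x y D : (0 < size (w ++ w'))%N -> no_dual w ->
  @composable k AA x (w ++ w') y -> lsrc q = y -> ltgt q = x ->
  D = wdeg (w ++ w') + 3 ->
  form_letters Gam (Letter (insert_sum J J (w ++ w') x y D)) q x y = 0.
Proof.
elim/last_ind: w' w q x y D => [|w' p IH] w q x y D.
  rewrite cats0 => s0 w0 wP qs qt _.
  have -> : insert_sum J J w x y D = 0.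
    apply: sum_dual_ext; first exact: insert_sum_j_fst.
    exact: insert_sum_no_dual.
  exact: (linear_zero (form_letters_linear Gamma_is_form q)).
rewrite -rcons_cat => s0 w0 wP qs qt eD.
have [c1 [ps pt]] : @composable k AA x (w ++ w') (lsrc p) /\
    (lsrc p = lsrc p /\ ltgt p = y).
  by move: wP; rewrite -cats1 => /composable_cat [c [e1 e2]]; rewrite e1.
have R1 := insert_sum_j_fst MP D s0 wP.
(* As the [A]-valued part of the relation vanishes, the dual component of [q] does
   not affect the pairing. *)
pose q' : letter AA := @Letter _ AA _ _ _ (((lelt q).1, 0) : AA _ _ _).
transitivity (form_letters Gam
    (Letter (insert_sum J J (rcons (w ++ w') p) x y D)) q' x y).
  move: R1; set R := insert_sum _ _ _ _ _ _ => R1.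
  rewrite /q'; case: q qs qt {q'} => s t n q /= qs qt; move: q.
  rewrite {s}qs {t}qt => q; rewrite !form_lettersE /Gamma /natural_form /= R1.
  by rewrite /dual_eval /= !lcomp0 !dual_zero !mulr0.
rewrite (insert_sum_cyclic (D' := wdeg (q' :: w ++ w') + 3) Gamma_is_form Gamma_sym
  j_op_almost_cyclic c1) //; last first.
rewrite -cat_cons IH ?mulr0 //.
  by constructor.
by split=> //=; rewrite qt.
Qed.

(** The value of the dual-valued part on [b] is the pairing of the relation with
    the letter [(b, 0)]. *)
Lemma j_op_is_Ainf : is_Ainf J.
Proof.
split=> [|w x y n w0 wP]; first exact: j_op_is_op.
have [nD|nD] := eqVneq n (wdeg w + 3); last first.
  by apply: insert_sum_degree => //; apply/eqP.
apply: sum_dual_ext; first exact: insert_sum_j_fst.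
apply: dual_ext => b; rewrite [RHS]dual_zeroE.
pose q : AA y x (- (n + (d - 1))) := (b, 0).
have := @Gamma_insert_sum [::] w (Letter q) x y n w0 (List.Forall_nil _) wP
  erefl erefl nD.
rewrite form_lettersE /Gamma /natural_form [dual_eval _ _ in X in _ - X]dual_eval0l.
rewrite mulr0 subr0 /dual_eval /= lcomp_Letter => /eqP.
by rewrite mulf_eq0 (negbTE (sgn_neq0 _ _)) => /eqP.
Qed.

Lemma j_op_almost_cyclic_Ainf : is_almost_cyclic_Ainf Gam J.
Proof.
split; first by exists (d - 1); exact: Gamma_is_form.
  exact: j_op_is_Ainf.
exact: j_op_almost_cyclic.
Qed.

End Ainf.


(** * Strict morphisms *)

Lemma big_splits_nil_r (T : Type) (V : nmodType) (s : seq T)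
    (F : seq T -> seq T -> V) :
  (forall u v, (0 < size v)%N -> F u v = 0) ->
  \sum_(p <- splits s) F p.1 p.2 = F s [::].
Proof.
elim: s F => [|a s IH] F F0; first by rewrite big_seq1.
rewrite big_splits_cons F0 // add0r (IH (fun u v => F (a :: u) v)) //.
by move=> u v; exact: F0.
Qed.

Lemma big_splits_nil_l (T : Type) (V : nmodType) (s : seq T)
    (F : seq T -> seq T -> V) :
  (forall u v, (0 < size u)%N -> F u v = 0) ->
  \sum_(p <- splits s) F p.1 p.2 = F [::] s.
Proof.
case: s => [|a s] F0; first by rewrite big_seq1.
by rewrite big_splits_cons big1 ?addr0 // => p _; rewrite F0.
Qed.

Lemma splits_map (T U : Type) (g : T -> U) (s : seq T) :
  splits (map g s) = [seq (map g p.1, map g p.2) | p <- splits s].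
Proof. by elim: s => //= a s ->; rewrite -!map_comp. Qed.

Lemma Forall_flatten (T U : Type) (P : U -> Prop) (g : T -> seq U) (s : seq T) :
  List.Forall (fun x => List.Forall P (g x)) s ->
  List.Forall P (flatten [seq g x | x <- s]).
Proof. by elim=> //= x l h _ IH; apply/Forall_cat. Qed.

Lemma block_splits_Forall (T : Type) (s : seq T) :
  List.Forall (fun bs => flatten bs = s
    /\ List.Forall (fun b => (0 < size b)%N) bs) (block_splits s).
Proof.
elim: s => [|a s IH] /=; first by constructor.
apply: Forall_flatten; elim: IH => // bs l [e h] _ IH'; constructor=> //.
constructor; first by rewrite /= e; split=> //; constructor.
case: bs e h {IH'} => [|b bs] /= e h; first by constructor.
constructor; last by constructor.
rewrite /= e; split=> //; constructor=> //.
by move: h => /List.Forall_cons_iff [].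
Qed.

Section Strict.
Variables (k : fieldType) (Q R : quiver k) (F0 : ob Q -> ob R).
Variable L : forall x y n, Q x y n -> R (F0 x) (F0 y) n.
Hypothesis Llin : forall x y n, linear (@L x y n).
Implicit Types (w : seq (letter Q)) (x y : ob Q) (n : int).
Local Notation SL := (@strict_op k Q R F0 L).

Lemma strict_lin0 x y n : L (0 : Q x y n) = 0.
Proof. exact: (linear_zero (Llin (x := x) (y := y) (n := n))). Qed.

Lemma out_letter_strict x y n (a : Q x y n) :
  out_letter 0 SL x [:: Letter a] = Letter (L a).
Proof.
rewrite /out_letter /= /wend /= wdeg_cons wdeg_nil /=.
have -> : n - 1 + 0 + 0 + 1 = n by ring.
by rewrite lcomp_Letter.
Qed.

Lemma out_letter_strict_map x (a : letter Q) : lsrc a = x ->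
  out_letter 0 SL x [:: a] = map_letter L a.
Proof. by case: a => x' y n a /= <-; exact: out_letter_strict. Qed.

Lemma strict_op_is_op : is_op 0 SL.
Proof.
split=> [w1 w2 u v n c a b x y m _|w x y m w0 wP mw].
  case: w1 => [|z1 [|z2 w1]] /=; last by rewrite scaler0 addr0.
    case: w2 => [|z w2]; last by rewrite scaler0 addr0.
    by rewrite lcomp_linear Llin.
  by rewrite scaler0 addr0.
case: w w0 wP mw => [|a [|b w]] //= _ wP mw.
rewrite lcomp_out ?strict_lin0 //.
move=> [_ _ e]; apply: mw; rewrite wdeg_cons wdeg_nil e; ring.
Qed.

Lemma strict_op_is_strict : is_strict SL.
Proof. by move=> [|a [|b w]] x y m. Qed.

Lemma wend_map x w : wend (F0 x) (map (map_letter L) w) = F0 (wend x w).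
Proof. by rewrite /wend; elim: w x => //= a w IH x. Qed.

Lemma composable_map_letter x w y : composable x w y ->
  composable (F0 x) (map (map_letter L) w) (F0 y).
Proof. by elim: w x => [x ->|a w IH x [<- /IH h]]. Qed.

Lemma wdeg_map w : wdeg (map (map_letter L) w) = wdeg w.
Proof. by rewrite /wdeg big_map. Qed.

Lemma composable_out_letters (f : op F0) x bs y :
  composable x (flatten bs) y ->
  composable (F0 x) (out_letters f x bs) (F0 y).
Proof.
elim: bs x => [x ->|b bs IH x] //=.
by move=> /composable_cat [_ /IH].
Qed.

Lemma op_zero_letter (S T : quiver k) (G0 : ob S -> ob T) r (g : op G0)
    s1 s2 u v n (x y : ob S) m : is_op r g ->
  composable x (s1 ++ Letter (0 : S u v n) :: s2) y ->
  g (s1 ++ Letter (0 : S u v n) :: s2) x y m = 0.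
Proof.
move=> gop c; have := gop.1 s1 s2 u v n (-1) 0 0 x y m c.
by rewrite scaler0 addr0 scaleN1r addNr.
Qed.

(** Blocks with several letters contribute nothing to a composition with a
    strict family. *)
Lemma big_block_splits_strict (V : nmodType) (h : seq (letter R) -> V) x w y :
  (forall s1 s2 u v n,
     composable (F0 x) (s1 ++ Letter (0 : R u v n) :: s2) (F0 y) ->
     h (s1 ++ Letter (0 : R u v n) :: s2) = 0) ->
  composable x w y ->
  \sum_(bs <- block_splits w) h (out_letters SL x bs) =
    h (map (map_letter L) w).
Proof.
elim: w x h => [|a w IH] x h h0 /=; first by rewrite big_seq1.
case=> ax wP.
rewrite big_flatten big_map /=.
rewrite -(IH (ltgt a) (fun s => h (map_letter L a :: s))) //; last first.
  move=> s1 s2 u v n c; rewrite -cat_cons h0 //=.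
  by rewrite ax.
apply: eq_big_Forall (block_splits_Forall w) _ => bs [e bs0].
rewrite big_cons /= (out_letter_strict_map ax).
case: bs e bs0 => [|[|c b] bs] /= e bs0; first by rewrite big_nil addr0.
  by move: bs0 => /List.Forall_cons_iff [].
rewrite big_seq1 -[RHS]addr0; congr (_ + _).
have z := h0 [::] (out_letters SL (wend x [:: a, c & b]) bs) (F0 x)
  (F0 (wend x [:: a, c & b])) (wdeg [:: a, c & b] + 0 + 1).
apply: z; split=> //.
apply: composable_out_letters.
by move: wP; rewrite -e => -[_ /composable_cat []].
Qed.

Lemma op_comp_strict (S : quiver k) (G0 : ob R -> ob S) r (g : op G0) x w y n :
  is_op r g -> composable x w y ->
  op_comp g SL w x y n = g (map (map_letter L) w) (F0 x) (F0 y) n.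
Proof.
move=> gop wP; rewrite /op_comp.
apply: (big_block_splits_strict (h := fun s => g s (F0 x) (F0 y) n) _ wP).
by move=> s1 s2 u v m c; apply: op_zero_letter gop c.
Qed.

Variables (smQ : @op k Q Q id) (smR : @op k R R id).
Hypothesis smQop : is_op 1 smQ.

Lemma insert_sum_strict w x y n : (0 < size w)%N -> composable x w y ->
  insert_sum SL smQ w x y n = L (smQ w x y n).
Proof.
move=> w0 wP; rewrite insert_sum_splits.
pose T w1 v w2 : R (F0 x) (F0 y) n := if (0 < size v)%N then
  sgn (wdeg w1) *: SL (w1 ++ out_letter 1 smQ (wend x w1) v :: w2) x y n else 0.
rewrite (@big_splits_nil_r _ _ _ (fun v w2 => \sum_(t <- splits v) T t.1 t.2 w2));
  last first.
  move=> u [|z v] // _; rewrite big1 // => t _; rewrite /T; case: ifP => // _.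
  by case: t.1 => [|? [|? ?]]; rewrite /= scaler0.
rewrite (@big_splits_nil_l _ _ _ (fun w1 v => T w1 v [::])); last first.
  move=> [|z u] v // _; rewrite /T; case: ifP => // _.
  by case: u => [|? ?]; rewrite /= scaler0.
rewrite /T w0 wdeg_nil sgn0 scale1r /=.
have [nD|nD] := eqVneq n (wdeg w + 1 + 1).
  by rewrite (out_letterE _ _ wP) nD lcomp_Letter.
rewrite lcomp_out; last by case=> _ _ /= e'; rewrite e' eqxx in nD.
rewrite (smQop.2 w) // => e'; move/eqP: nD; apply; lia.
Qed.

Hypothesis smRop : is_op 1 smR.
Hypothesis LE : forall w x y n, (0 < size w)%N -> composable x w y ->
  L (smQ w x y n) = smR (map (map_letter L) w) (F0 x) (F0 y) n.

Lemma strict_Ainf_mor : is_Ainf_mor smQ smR SL.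
Proof.
split; first exact: strict_op_is_op.
move=> w x y n w0 wP.
by rewrite insert_sum_strict // (op_comp_strict _ smRop wP) LE.
Qed.

Lemma insert_sum_map w x y n : composable x w y ->
  L (insert_sum smQ smQ w x y n) =
  insert_sum smR smR (map (map_letter L) w) (F0 x) (F0 y) n.
Proof.
move=> wP; rewrite !insert_sum_splits splits_map big_map.
rewrite (linear_bigsum (@Llin _ _ _)).
apply: eq_big_Forall (splits_Forall w) _ => -[w' w2] /= ew.
rewrite splits_map big_map (linear_bigsum (@Llin _ _ _)).
apply: eq_big_Forall (splits_Forall w') _ => -[w1 v] /= ew'.
rewrite size_map; case: ifP => v0; last exact: strict_lin0.
have {ew ew'}ew : w = w1 ++ v ++ w2 by rewrite -ew -ew' catA.
move: wP; rewrite ew => /composable_cat [c1 /composable_cat [cv c2]].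
rewrite (linear_scale (@Llin _ _ _)) wdeg_map LE; first last.
- by apply/composable_cat; split.
- by rewrite size_cat addnS.
rewrite map_cat /=; congr (_ *: smR (_ ++ _ :: _) _ _ _).
rewrite wend_map (out_letterE _ _ cv).
rewrite (out_letterE _ _ (composable_map_letter cv)) wdeg_map.
by rewrite /map_letter /= LE.
Qed.

Lemma form_letters0l (G : Defs.form R) e (x y : ob R) u v n q : is_form e G ->
  form_letters G (Letter (0 : R u v n)) q x y = 0.
Proof.
case=> G1 _ _; rewrite /form_letters /= lcomp0.
by have := G1 x y n (ldeg q) (-1) 0 0 (lcomp q y x (ldeg q));
  rewrite scaler0 addr0 mulN1r addNr.
Qed.

Lemma form_letters0r (G : Defs.form R) e (x y : ob R) u v n p : is_form e G ->
  form_letters G p (Letter (0 : R u v n)) x y = 0.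
Proof.
case=> _ G1 _; rewrite /form_letters /= lcomp0.
by have := G1 x y (ldeg p) n (-1) (lcomp p x y (ldeg p)) 0 0;
  rewrite scaler0 addr0 mulN1r addNr.
Qed.

Lemma strict_cyclic_mor (g : Defs.form Q) (G : Defs.form R) e : is_form e G ->
  (forall x y m n (a : Q x y m) (b : Q y x n),
     @G (F0 x) (F0 y) m n (L a) (L b) = @g x y m n a b) ->
  is_cyclic_mor g G SL.
Proof.
move=> Gf Gg; split=> [x y m n a b|w x w2 wP].
  by rewrite !out_letter_strict form_lettersE.
rewrite big_nat; apply: big1 => i /andP [i1 iw].
have [i2|i2] := leqP 2 i.
  rewrite {1}/out_letter.
  rewrite [SL _ _ _ _](_ : _ = 0); first exact: form_letters0l Gf.
  have : (1 < size (take i w))%N by rewrite size_takel // ltnW.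
  by case: (take i w) => [|? [|? ?]].
rewrite {2}/out_letter [SL (drop i w) _ _ _](_ : _ = 0).
  exact: form_letters0r Gf.
have : (1 < size (drop i w))%N by rewrite size_drop; lia.
by case: (drop i w) => [|? [|? ?]].
Qed.

End Strict.


(** * The structure on A \oplus B^*[d-1] *)

Section WordSlots.
Variables (k : fieldType) (A : quiver k).
Implicit Types (v : seq (mletter A)) (x y : ob A).

Lemma map_fst_tb v : map fst (tb v) = map (@ltgt _ _) (forms v).
Proof. by elim: v => [|[a|g] v IH] //=; rewrite IH. Qed.

Lemma map_bend_blocks x v y : mcomp x v y ->
  map (@bend k A) (blocks x v) = rcons (map (@lsrc _ _) (forms v)) y.
Proof.
rewrite /blocks; elim: v x => [|[a|g] v IH] x /=.
- by move=> ->.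
- by case=> _ /IH.
- by case=> <- /IH e; congr (_ :: _).
Qed.

(** The outputs run between the ends of the forms they are contracted with. *)
Lemma out_slots_word x v y : mcomp x v y ->
  out_slots (rev (blocks x v)) =
  rcons [seq (ltgt g, lsrc g) | g <- rev (forms v)] (x, y).
Proof.
move=> vP; rewrite /out_slots !map_rev (map_bend_blocks vP) rev_rcons.
rewrite /blocks /= rev_cons map_fst_tb rot1_cons -!map_rev.
rewrite zip_rcons ?size_map //; congr (rcons _ _).
by elim: (rev _) => //= g s ->.
Qed.

Lemma out_slots_dual x v y b1 Bm (w : seq (letter A)) : mcomp x v y ->
  tb v = rcons Bm b1 -> wend b1.1 w = bend (x, hd v) ->
  out_slots ((b1.1, w) :: rev Bm) =
  [seq (ltgt g, lsrc g) | g <- rev (forms v)].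
Proof.
move=> vP tv wE; rewrite /out_slots /= rot1_cons /bend /= wE.
have e1 : b1.1 :: map fst (rev Bm) = map (@ltgt _ _) (rev (forms v)).
  by rewrite !map_rev -map_fst_tb tv map_rcons rev_rcons.
have e2 : rcons (map (@bend k A) (rev Bm)) (bend (x, hd v)) =
    map (@lsrc _ _) (rev (forms v)).
  have := map_bend_blocks vP.
  rewrite /blocks tv -rcons_cons map_rcons => /rcons_inj [e _].
  by rewrite !map_rev -e /= rev_cons.
by rewrite e1 e2; elim: (rev _) => //= g s ->.
Qed.

End WordSlots.

Section SumStructure.
Variables (k : fieldType) (d : int) (A B : preCY_cat k d) (f : strict_mor A B).
Local Notation F0 := (sob f).
Local Notation AB := (ABdual f).

(** Forms on [B] that remember objects of [A], which [sob f] may identify: these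
    are needed to pull the forms back to [A]. *)
Definition pulled_quiver : quiver k :=
  @Quiver k (ob A) (fun x y n => dual_quiver B (F0 x) (F0 y) n).

Definition ab_letter := (letter A + letter pulled_quiver)%type.

Definition to_A_form (g : letter pulled_quiver) : letter (dual_quiver A) :=
  @Letter _ (dual_quiver A) _ _ _ (pull_dual (lelt g)).
Definition to_B_form (g : letter pulled_quiver) : letter (dual_quiver B) :=
  @Letter _ (dual_quiver B) _ _ _ (lelt g).

Definition to_A (c : ab_letter) : mletter A :=
  match c with inl a => inl a | inr g => inr (to_A_form g) end.
Definition to_B (c : ab_letter) : mletter B :=
  match c with inl a => inl (map_letter (smap f) a) | inr g => inr (to_B_form g) end.

Implicit Types (w : seq (letter AB)) (v : seq ab_letter) (x y : ob A) (m n : int).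

Lemma pull_dualE x y m (g : dual_quiver B (F0 x) (F0 y) m) (u : A y x (- m)) :
  pull_dual g u = g (smap f y x (- m) u).
Proof.
rewrite /pull_dual to_dualE // => c a b.
by rewrite linearP [LHS]dual_linear.
Qed.

(** The hypotheses exclude elements whose ends only match after applying
    [sob f]. *)
Lemma dual_eval_pull (g : letter pulled_quiver) (a : letter A) :
  lsrc a = ltgt g -> ltgt a = lsrc g ->
  dual_eval (to_A_form g) a = dual_eval (to_B_form g) (map_letter (smap f) a).
Proof.
case: a => s t n a /= es et; move: a; rewrite es et => a.
rewrite /dual_eval /= pull_dualE; congr (lelt g _).
have [en|en] := eqVneq n (- ldeg g).
  by move: a; rewrite en => a; rewrite /map_letter /= !lcomp_Letter.
rewrite !lcomp_out ?linear0 //; by case=> _ _ /= e; rewrite e eqxx in en.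
Qed.

Lemma contract_pull (gs : seq (letter pulled_quiver)) (o : seq (letter A)) :
  map (fun a => (lsrc a, ltgt a)) o = [seq (ltgt g, lsrc g) | g <- gs] ->
  contract (map to_A_form gs) o =
  contract (map to_B_form gs) (map (map_letter (smap f)) o).
Proof.
elim: gs o => [|g gs IH] [|a o] //= [e1 e2 /IH ->].
by rewrite (dual_eval_pull e1 e2).
Qed.

Lemma contract_last_pull (gs : seq (letter pulled_quiver)) x y n
    (o : seq (letter A)) :
  map (fun a => (lsrc a, ltgt a)) o =
    rcons [seq (ltgt g, lsrc g) | g <- gs] (x, y) ->
  smap f x y n (contract_last (map to_A_form gs) x y n o) =
  contract_last (map to_B_form gs) (F0 x) (F0 y) n
    (map (map_letter (smap f)) o).
Proof.
elim: gs o => [|g gs IH] [|a o] //=.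
  case: o => //= -[e1 e2]; case: a e1 e2 => s t m a /= e1 e2.
  move: a; rewrite e1 e2 => a; rewrite /map_letter /=.
  have [en|en] := eqVneq m n.
    by move: a; rewrite en => a; rewrite !lcomp_Letter.
  rewrite !lcomp_out ?linear0 //; by case=> _ _ /= e; rewrite e eqxx in en.
by case=> e1 e2 /IH e; rewrite linearZ /= e (dual_eval_pull e1 e2).
Qed.

Fixpoint ab_forms v : seq (letter pulled_quiver) :=
  match v with
  | [::] => [::]
  | inl _ :: v' => ab_forms v'
  | inr g :: v' => g :: ab_forms v'
  end.

Lemma forms_to_A v : forms (map to_A v) = map to_A_form (ab_forms v).
Proof. by elim: v => [|[a|g] v IH] //=; rewrite IH. Qed.

Lemma forms_to_B v : forms (map to_B v) = map to_B_form (ab_forms v).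
Proof. by elim: v => [|[a|g] v IH] //=; rewrite IH. Qed.

Lemma hd_to_B v : hd (map to_B v) = map (map_letter (smap f)) (hd (map to_A v)).
Proof. by elim: v => [|[a|g] v IH] //=; rewrite IH. Qed.

Lemma tb_to_B v : tb (map to_B v) = map (map_block (smap f)) (tb (map to_A v)).
Proof. by elim: v => [|[a|g] v IH] //=; rewrite IH /map_block /= hd_to_B. Qed.

Lemma mdeg_to_B c : mdeg d (to_B c) = mdeg d (to_A c).
Proof. by case: c. Qed.

Lemma mwdeg_to_B v : mwdeg d (map to_B v) = mwdeg d (map to_A v).
Proof.
elim: v => [|c v IH] /=; first by rewrite !mwdeg_nil.
by rewrite !mwdeg_cons IH mdeg_to_B.
Qed.

Lemma jsign_to_B v : jsign d (map to_B v) = jsign d (map to_A v).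
Proof.
elim: v => [|[a|g] v IH] //=; rewrite IH //.
by rewrite mwdeg_to_B hd_to_B wdeg_map.
Qed.

Lemma mcomp_to_B x v y : mcomp x (map to_A v) y ->
  mcomp (F0 x) (map to_B v) (F0 y).
Proof.
elim: v x => [x ->|c v IH x [e /IH h]] //=.
by case: c e h => [a|g] /= <-.
Qed.

Let AM : is_multi d (d + 2) (@pm k d A). Proof. by case: (pmP A). Qed.
Let BM : is_multi d (d + 2) (@pm k d B). Proof. by case: (pmP B). Qed.

(** Strictness, contracted with forms on [B]: contracting [M_B] after [\Phi] is
    contracting [M_A] with the pulled back forms. *)
Lemma j_A_natural x v y n : (0 < size v)%N -> mcomp x (map to_A v) y ->
  smap f x y n (j_A d (@pm k d A) (map to_A v) x y n) =
  j_A d (@pm k d B) (map to_B v) (F0 x) (F0 y) n.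
Proof.
move=> v0 vP; have v0A : (0 < size (map to_A v))%N by rewrite size_map.
have v0B : (0 < size (map to_B v))%N by rewrite size_map.
rewrite (j_A_eff AM _ v0A vP) (j_A_eff BM _ v0B (mcomp_to_B vP)).
rewrite jsign_to_B linearZ /=; congr (_ *: _).
rewrite forms_to_A forms_to_B -!map_rev.
have inp := is_input_blocks v0A vP.
have -> : rev (blocks (F0 x) (map to_B v)) =
    map (map_block (smap f)) (rev (blocks x (map to_A v))).
  by rewrite map_rev /blocks /= tb_to_B /map_block /= hd_to_B.
rewrite -(smapP f inp (contract_last_multilinear _ _ _ _)).
rewrite /tmap teval_map /teval linear_sum.
apply: eq_big_Forall (AM.1 _ inp) _ => -[r o] /= [e _].
rewrite linearZ /= contract_last_pull //.
by rewrite e (out_slots_word vP) forms_to_A -map_rev -map_comp.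
Qed.

Lemma j_dual_natural x v y m : mcomp x (map to_A v) y ->
  pull_dual (j_dual d (@pm k d B) (map to_B v) (F0 x) (F0 y) m) =
  j_dual d (@pm k d A) (map to_A v) x y m.
Proof.
move=> vP; apply: dual_ext => u; rewrite pull_dualE.
case/lastP tv: (tb (map to_A v)) => [|Bm b1].
  by rewrite !j_dual_single ?dual_zeroE ?tb_to_B ?tv // [LHS]dual_zeroE.
have tvB : tb (map to_B v) =
    rcons (map (map_block (smap f)) Bm) (map_block (smap f) b1).
  by rewrite tb_to_B tv map_rcons.
rewrite (j_dual_eff AM u vP tv) (j_dual_eff BM _ (mcomp_to_B vP) tvB).
rewrite /dual_sign jsign_to_B mwdeg_to_B hd_to_B wdeg_map.
have -> : bsdeg (map (map_block (smap f)) Bm) = bsdeg Bm.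
  by rewrite /bsdeg big_map; apply: eq_bigr => b _; rewrite /bdeg wdeg_map.
congr (_ * _).
have inp := is_input_dual u vP tv.
rewrite forms_to_A forms_to_B -!map_rev.
have -> : (F0 b1.1, map (map_letter (smap f)) b1.2
      ++ Letter (smap f y x (- m) u) :: map (map_letter (smap f)) (hd (map to_A v)))
    :: map (map_block (smap f)) (rev Bm) =
  map (map_block (smap f)) ((b1.1, b1.2 ++ Letter u :: hd (map to_A v)) :: rev Bm).
  by rewrite /= /map_block /= map_cat.
rewrite -(smapP f inp (@contract_multilinear k B _)).
rewrite /tmap teval_map /teval.
apply: eq_big_Forall (AM.1 _ inp) _ => -[r o] /= [e _].
rewrite -contract_pull // e (out_slots_dual vP tv).
  by rewrite forms_to_A -map_rev -map_comp.
by rewrite wend_cat.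
Qed.

Local Notation phiL := (@map_letter k AB (AAdual d A) id (@phi_l_lin k d A B f)).
Local Notation phiR := (@map_letter k AB (AAdual d B) F0 (@phi_r_lin k d A B f)).

Fixpoint ab_expand w : seq (seq ab_letter) :=
  if w is a :: w' then
    [seq c :: v | c <- [:: inl (@Letter _ A _ _ _ (lelt a).1);
                           inr (@Letter _ pulled_quiver _ _ _ (lelt a).2)],
                  v <- ab_expand w']
  else [:: [::]].

Lemma expand_phiL w : expand (map phiL w) = map (map to_A) (ab_expand w).
Proof. by elim: w => //= a w ->; rewrite !cats0 !map_cat -!map_comp. Qed.

Lemma expand_phiR w : expand (map phiR w) = map (map to_B) (ab_expand w).
Proof. by elim: w => //= a w ->; rewrite !cats0 !map_cat -!map_comp. Qed.

Lemma pull_dual_linear x y m : linear (@pull_dual k d A B f x y m).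
Proof.
move=> c a b; apply: dual_ext => u; rewrite pull_dualE.
rewrite -[RHS]/((c *: pull_dual a + pull_dual b : dual _) u).
rewrite [RHS]dual_addE [X in _ = X + _]dual_scaleE !pull_dualE.
by rewrite [LHS]dual_addE [X in X + _ = _]dual_scaleE.
Qed.

Lemma phi_l_linear x y n : linear (@phi_l_lin k d A B f x y n).
Proof.
move=> c a b; apply: sum_dual_ext => //; exact: pull_dual_linear.
Qed.

Lemma phi_r_linear x y n : linear (@phi_r_lin k d A B f x y n).
Proof. by move=> c a b; apply: sum_dual_ext => //=; rewrite linearP. Qed.

Lemma phi_inj x y n (a b : AB x y n) :
  phi_l_lin a = phi_l_lin b -> phi_r_lin a = phi_r_lin b -> a = b.
Proof.
move=> /(congr1 fst) /= e1 /(congr1 snd) /= e2.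
by rewrite [a]surjective_pairing [b]surjective_pairing e1 e2.
Qed.

Lemma ab_Forall w x y : @composable k AB x w y ->
  List.Forall (fun v => size v = size w /\ mcomp x (map to_A v) y) (ab_expand w).
Proof.
move=> wP; have := expand_Forall (@composable_map_letter _ _ _ _ _ _ _ _ wP
  : @composable k (AAdual d A) x (map phiL w) y).
rewrite expand_phiL size_map; elim: (ab_expand w) => //= v l IH.
move=> /List.Forall_cons_iff [[e h _] /IH ?]; constructor=> //.
by rewrite -e size_map.
Qed.

Lemma phi_l_sm w x y n : (0 < size w)%N -> @composable k AB x w y ->
  phi_l_lin (@sm_AB k d A B f w x y n) =
  @j_op k d A (@pm k d A) (map phiL w) x y n.
Proof.
move=> w0 wP; apply: sum_dual_ext => //.
rewrite /= expand_phiL expand_phiR !big_map.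
set m := n + (d - 1).
rewrite (linear_bigsum (@pull_dual_linear _ _ _)); apply: eq_big_Forall (ab_Forall wP) _ => v [_ vP].
exact: j_dual_natural.
Qed.

Lemma phi_r_sm w x y n : (0 < size w)%N -> @composable k AB x w y ->
  phi_r_lin (@sm_AB k d A B f w x y n) =
  @j_op k d B (@pm k d B) (map phiR w) (F0 x) (F0 y) n.
Proof.
move=> w0 wP; apply: sum_dual_ext => //.
rewrite /= expand_phiL expand_phiR !big_map linear_sum.
apply: eq_big_Forall (ab_Forall wP) _ => v [e vP].
by apply: j_A_natural; rewrite ?e.
Qed.

End SumStructure.


(** * The span of a strict morphism *)

Section SpanAinf.
Variables (k : fieldType) (d : int) (A B : preCY_cat k d) (f : strict_mor A B).
Local Notation F0 := (sob f).
Local Notation AB := (ABdual f).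
Local Notation sm := (@sm_AB k d A B f).
Local Notation JA := (@j_op k d A (@pm k d A)).
Local Notation JB := (@j_op k d B (@pm k d B)).
Local Notation phil := (@phi_l_lin k d A B f).
Local Notation phir := (@phi_r_lin k d A B f).
Local Notation phiL := (@map_letter k AB (AAdual d A) id phil).
Local Notation phiR := (@map_letter k AB (AAdual d B) F0 phir).
Local Notation NF := (@natural_form k d A B F0 (fun x y n => smap f x y n)).

Let JAop := @j_op_is_op k d A (@pm k d A)
  (let: And3 h _ _ := pmP A in h).
Let JBop := @j_op_is_op k d B (@pm k d B)
  (let: And3 h _ _ := pmP B in h).

Lemma composable_phiL w x y : @composable k AB x w y ->
  @composable k (AAdual d A) x (map phiL w) y.
Proof. exact: (@composable_map_letter k AB (AAdual d A) id phil). Qed.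

Lemma composable_phiR w x y : @composable k AB x w y ->
  @composable k (AAdual d B) (F0 x) (map phiR w) (F0 y).
Proof. exact: (@composable_map_letter k AB (AAdual d B) F0 phir). Qed.

Lemma sm_AB_is_op : is_op 1 sm.
Proof.
split=> [w1 w2 u v n c a b x y m wP|w x y m w0 wP wd].
  have w0 (e : letter AB) : (0 < size (w1 ++ e :: w2))%N by rewrite size_cat addnS.
  have wP' (e : AB u v n) : @composable k AB x (w1 ++ Letter e :: w2) y.
    by move/composable_cat: wP => [c1 c2]; apply/composable_cat.
  apply: phi_inj.
    rewrite (phi_l_linear c) !phi_l_sm // !map_cat /= /map_letter /=.
    rewrite (phi_l_linear c); apply: (JAop.1).
    have := composable_phiL (wP' a).
    by rewrite map_cat.
  rewrite (phi_r_linear c) !phi_r_sm // !map_cat /= /map_letter /=.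
  rewrite (phi_r_linear c); apply: (JBop.1).
  have := composable_phiR (wP' a).
  by rewrite map_cat.
apply: phi_inj.
  rewrite (linear_zero (@phi_l_linear _ _ _ _ f x y m)) phi_l_sm //.
  apply: (JAop.2); rewrite ?size_map ?wdeg_map //.
  exact: composable_phiL.
rewrite (linear_zero (@phi_r_linear _ _ _ _ f x y m)) phi_r_sm //.
apply: (JBop.2); rewrite ?size_map ?wdeg_map //.
exact: composable_phiR.
Qed.

Lemma sm_AB_is_Ainf : is_Ainf sm.
Proof.
split=> [|w x y n w0 wP]; first exact: sm_AB_is_op.
have [_ RA] := j_op_is_Ainf (pmP A); have [_ RB] := j_op_is_Ainf (pmP B).
apply: phi_inj.
  rewrite (linear_zero (@phi_l_linear _ _ _ _ f x y n)).
  rewrite (@insert_sum_map k AB (AAdual d A) id phil (@phi_l_linear k d A B f)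
    sm JA (@phi_l_sm k d A B f) w x y n wP).
  by apply: RA; rewrite ?size_map //; exact: composable_phiL.
rewrite (linear_zero (@phi_r_linear _ _ _ _ f x y n)).
rewrite (@insert_sum_map k AB (AAdual d B) F0 phir (@phi_r_linear k d A B f)
  sm JB (@phi_r_sm k d A B f) w x y n wP).
by apply: RB; rewrite ?size_map //; exact: composable_phiR.
Qed.

Lemma Gamma_phi_l x y m n (a : AB x y m) (b : AB y x n) :
  @Gamma k d A x y m n (phil a) (phil b) = @natural_form k d A B F0
    (fun x y n => smap f x y n) x y m n a b.
Proof.
rewrite /Gamma /natural_form; congr (_ * _ - _ * _).
  exact: (@dual_eval_pull k d A B f (@Letter k (pulled_quiver f) _ _ _ a.2)
    (Letter b.1) erefl erefl).
exact: (@dual_eval_pull k d A B f (@Letter k (pulled_quiver f) _ _ _ b.2)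
  (Letter a.1) erefl erefl).
Qed.

Lemma Gamma_phi_r x y m n (a : AB x y m) (b : AB y x n) :
  @Gamma k d B (F0 x) (F0 y) m n (phir a) (phir b) = @natural_form k d A B F0
    (fun x y n => smap f x y n) x y m n a b.
Proof. by []. Qed.

Lemma form_letters_phi_l (a b : letter AB) x y :
  lsrc a = x -> ltgt a = y -> lsrc b = y -> ltgt b = x ->
  form_letters NF a b x y = form_letters (@Gamma k d A) (phiL a) (phiL b) x y.
Proof.
case: a b => s1 t1 n1 a [s2 t2 n2 b] /= e1 e2 e3 e4; move: a b.
rewrite {s1}e1 {t1}e2 {s2}e3 {t2}e4 => a b.
by rewrite /map_letter !form_lettersE Gamma_phi_l.
Qed.

Lemma phiL_out_letter x w y : (0 < size w)%N -> @composable k AB x w y ->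
  phiL (out_letter 1 sm x w) = out_letter 1 JA x (map phiL w).
Proof.
move=> w0 wP; rewrite (out_letterE _ _ wP).
have wP' : @composable k (AAdual d A) x (map phiL w) y.
  exact: composable_phiL.
rewrite (out_letterE _ _ wP') wdeg_map /map_letter /=.
by congr Letter; exact: phi_l_sm.
Qed.

(** The form on the mixed space is pulled back from [A \oplus A^*[d-1]] along a
    map that commutes with the operations. *)
Lemma sm_AB_almost_cyclic : almost_cyclic NF sm.
Proof.
move=> w p q x u y wP pP qP.
have wpP : @composable k AB x (rcons w p) y.
  by rewrite -cats1; apply/composable_cat; rewrite (composable_wend wP).
have qwP : @composable k AB y (q :: w) u by case: qP => /= -> ->.
have [ps pt] : lsrc p = u /\ ltgt p = y by case: pP.
have [qs qt] : lsrc q = y /\ ltgt q = x by case: qP.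
rewrite !form_letters_phi_l ?(composable_wend wpP) ?(composable_wend qwP) //.
- rewrite (phiL_out_letter _ wpP) ?size_rcons // (phiL_out_letter _ qwP) //.
  rewrite map_rcons (j_op_almost_cyclic (pmP A) (u := u)) //.
  + by rewrite -map_rcons wdeg_map.
  + exact: composable_phiL.
- exact: (composable_wend qwP).
- exact: (composable_wend wpP).
Qed.

Lemma strict_span_is_scyc_mor (hA : is_almost_cyclic_Ainf (@Gamma k d A) JA)
    (hB : is_almost_cyclic_Ainf (@Gamma k d B) JB) :
  @is_scyc_mor k d (AcycCat hA) (AcycCat hB) _ (strict_span f).
Proof.
split.
- split; [|exact: sm_AB_is_Ainf|exact: sm_AB_almost_cyclic].
  exists (d - 1).
  exact: (@natural_form_is_form k d A B F0 (fun x y n => smap f x y n)).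
- split; last 2 [exact: strict_op_is_strict].
    exact: (@strict_Ainf_mor k AB (AAdual d A) id phil (@phi_l_linear k d A B f)
      sm JA sm_AB_is_op JAop (@phi_l_sm k d A B f)).
  exact: (@strict_cyclic_mor k AB (AAdual d A) id phil NF _ _
    (Gamma_is_form d A) Gamma_phi_l).
- split; first exact: (@strict_Ainf_mor k AB (AAdual d B) F0 phir
    (@phi_r_linear k d A B f) sm JB sm_AB_is_op JBop (@phi_r_sm k d A B f)).
    exact: strict_op_is_strict.
  exact: (@strict_cyclic_mor k AB (AAdual d B) F0 phir NF _ _
    (Gamma_is_form d B) Gamma_phi_r).
Qed.

End SpanAinf.


(** * Composition of strict morphisms *)

Section Composition.
Variables (k : fieldType) (d : int) (A B C : preCY_cat k d).
Variables (f : strict_mor A B) (g : strict_mor B C).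
Local Notation h := (strict_comp f g).
Local Notation AB := (ABdual f).
Local Notation BC := (ABdual g).
Local Notation AC := (ABdual h).
Implicit Types (x y : ob A) (n : int).

Definition chi_l_lin x y n (v : AC x y n) : AB x y n :=
  (v.1, @pull_dual k d B C g (sob f x) (sob f y) (n + (d - 1)) v.2).

Definition chi_r_lin x y n (v : AC x y n) : BC (sob f x) (sob f y) n :=
  (smap f x y n v.1, v.2).

Lemma chi_l_linear x y n : linear (@chi_l_lin x y n).
Proof.
move=> c a b; rewrite /chi_l_lin [(c *: a + b).2]/= pull_dual_linear.
by [].
Qed.

Lemma chi_r_linear x y n : linear (@chi_r_lin x y n).
Proof. by move=> c a b; rewrite /chi_r_lin [(c *: a + b).1]/= linearP. Qed.

Lemma phi_l_chi_l x y n (v : AC x y n) :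
  phi_l_lin (chi_l_lin v) = phi_l_lin v.
Proof.
rewrite /phi_l_lin /=; congr (_, _); apply: dual_ext => u.
by rewrite !pull_dualE.
Qed.

Local Notation chiL := (@map_letter k AC AB id chi_l_lin).
Local Notation chiR := (@map_letter k AC BC (sob f) chi_r_lin).

Lemma composable_chiL w x y : @composable k AC x w y ->
  @composable k AB x (map chiL w) y.
Proof. exact: (@composable_map_letter k AC AB id chi_l_lin). Qed.

Lemma composable_chiR w x y : @composable k AC x w y ->
  @composable k BC (sob f x) (map chiR w) (sob f y).
Proof. exact: (@composable_map_letter k AC BC (sob f) chi_r_lin). Qed.

Lemma map_phi_l_chi (w : seq (letter AC)) :
  map (@map_letter k AB (AAdual d A) id (@phi_l_lin k d A B f)) (map chiL w) =
  map (@map_letter k AC (AAdual d A) id (@phi_l_lin k d A C h)) w.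
Proof.
by rewrite -map_comp; apply: eq_map => a; rewrite /= /map_letter /= phi_l_chi_l.
Qed.

Lemma map_phi_chi (w : seq (letter AC)) :
  map (@map_letter k BC (AAdual d B) id (@phi_l_lin k d B C g)) (map chiR w) =
  map (@map_letter k AB (AAdual d B) (sob f) (@phi_r_lin k d A B f)) (map chiL w).
Proof. by rewrite -!map_comp; apply: eq_map => a. Qed.

Lemma map_phi_r_chi (w : seq (letter AC)) :
  map (@map_letter k BC (AAdual d C) (sob g) (@phi_r_lin k d B C g)) (map chiR w) =
  map (@map_letter k AC (AAdual d C) (sob h) (@phi_r_lin k d A C h)) w.
Proof. by rewrite -!map_comp; apply: eq_map => a. Qed.

(** The component in [B^*] is the naturality of [\Psi] on the image of the word in
    [B \oplus C^*[d-1]]. *)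
Lemma chi_l_sm w x y n : (0 < size w)%N -> @composable k AC x w y ->
  chi_l_lin (@sm_AB k d A C h w x y n) = @sm_AB k d A B f (map chiL w) x y n.
Proof.
move=> w0 wP.
have w0' : (0 < size (map chiR w))%N by rewrite size_map.
have e := @phi_l_sm k d B C g _ _ _ n w0' (composable_chiR wP).
apply: sum_dual_ext.
  by rewrite /chi_l_lin /sm_AB [LHS]/= [RHS]/= map_phi_l_chi.
have /(congr1 snd) := e; rewrite map_phi_chi.
by rewrite /phi_l_lin /sm_AB /chi_l_lin map_phi_r_chi.
Qed.

(** The component in [B] is the naturality of [\Phi] on the image of the word in
    [A \oplus B^*[d-1]]. *)
Lemma chi_r_sm w x y n : (0 < size w)%N -> @composable k AC x w y ->
  chi_r_lin (@sm_AB k d A C h w x y n) =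
  @sm_AB k d B C g (map chiR w) (sob f x) (sob f y) n.
Proof.
move=> w0 wP.
have w0' : (0 < size (map chiL w))%N by rewrite size_map.
have e := @phi_r_sm k d A B f _ _ _ n w0' (composable_chiL wP).
apply: sum_dual_ext; last by rewrite /chi_r_lin /sm_AB [LHS]/= [RHS]/= map_phi_r_chi.
have /(congr1 fst) := e; rewrite -map_phi_chi.
by rewrite /phi_r_lin /sm_AB /chi_r_lin map_phi_l_chi.
Qed.

End Composition.

Lemma strict_op_comp (k : fieldType) (Q R S : quiver k) (F0 : ob Q -> ob R)
    (G0 : ob R -> ob S)
    (L1 : forall x y n, Q x y n -> R (F0 x) (F0 y) n)
    (L2 : forall x y n, R x y n -> S (G0 x) (G0 y) n) :
  (forall x y n, linear (@L1 x y n)) -> (forall x y n, linear (@L2 x y n)) ->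
  forall w x y n, composable x w y ->
  op_comp (strict_op L2) (strict_op L1) w x y n =
  @strict_op k Q S (fun x => G0 (F0 x)) (fun x y n v => L2 _ _ _ (L1 x y n v)) w x y n.
Proof.
move=> l1 l2 w x y n wP.
rewrite (op_comp_strict _ _ (strict_op_is_op l2) wP).
case: w wP => [|[s t m a] [|b w]] //= [e1 e2].
move: a; rewrite e1 e2 /map_letter /= => a.
have [em|em] := eqVneq m n.
  by move: a; rewrite em => a; rewrite !lcomp_Letter.
have em' : m <> n by apply/eqP.
by rewrite !lcomp_out ?(linear_zero (l1 _ _ _)) // => -[].
Qed.

Lemma strict_op_ext (k : fieldType) (Q R : quiver k) (F0 : ob Q -> ob R)
    (L L' : forall x y n, Q x y n -> R (F0 x) (F0 y) n) w x y n :
  (forall x y n (v : Q x y n), L x y n v = L' x y n v) ->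
  strict_op L w x y n = strict_op L' w x y n.
Proof. by move=> e; case: w => [|a [|b w]] //=. Qed.

Section Functor.
Variables (k : fieldType) (d : int) (A B C : preCY_cat k d).
Variables (f : strict_mor A B) (g : strict_mor B C).
Local Notation h := (strict_comp f g).
Hypothesis hob : forall A : preCY_cat k d,
  is_almost_cyclic_Ainf (@Gamma k d A) (@j_op k d A (@pm k d A)).
Hypothesis hmor : forall (A B : preCY_cat k d) (f : strict_mor A B),
  @is_scyc_mor k d (AcycCat (hob A)) (AcycCat (hob B)) _ (strict_span f).

Lemma strict_span_comp :
  @scyc_comp k d (AcycCat (hob A)) (AcycCat (hob B)) (AcycCat (hob C))
    (existT _ (sob f) (exist _ (strict_span f) (hmor f)))
    (existT _ (sob g) (exist _ (strict_span g) (hmor g)))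
    (existT _ (sob h) (exist _ (strict_span h) (hmor h))).
Proof.
pose chi_l : @op k (ABdual h) (ABdual f) id :=
  @strict_op k (ABdual h) (ABdual f) id (@chi_l_lin k d A B C f g).
pose chi_r : @op k (ABdual h) (ABdual g) (sob f) :=
  @strict_op k (ABdual h) (ABdual g) (sob f) (@chi_r_lin k d A B C f g).
apply: (@ScycComp k d (AcycCat (hob A)) (AcycCat (hob B)) (AcycCat (hob C))
  (sob f) (sob g) (exist _ (strict_span f) (hmor f))
  (exist _ (strict_span g) (hmor g)) (exist _ (strict_span h) (hmor h))
  chi_l chi_r).
- exact: (@strict_Ainf_mor k (ABdual h) (ABdual f) id _ (@chi_l_linear k d A B C f g)
    _ _ (sm_AB_is_op h) (sm_AB_is_op f) (@chi_l_sm k d A B C f g)).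
- exact: (@strict_Ainf_mor k (ABdual h) (ABdual g) (sob f) _
    (@chi_r_linear k d A B C f g)
    _ _ (sm_AB_is_op h) (sm_AB_is_op g) (@chi_r_sm k d A B C f g)).
- move=> w x y n w0 wP.
  apply: (etrans (@strict_op_comp k (ABdual h) (ABdual f) (AAdual d B) id (sob f)
    _ _ (@chi_l_linear k d A B C f g) (@phi_r_linear k d A B f) w x y n wP)).
  exact: (esym (@strict_op_comp k (ABdual h) (ABdual g) (AAdual d B) (sob f) id
    _ _ (@chi_r_linear k d A B C f g) (@phi_l_linear k d B C g) w x y n wP)).
- move=> w x y n w0 wP.
  apply: (etrans _ (esym (@strict_op_comp k (ABdual h) (ABdual f) (AAdual d A) id id
    _ _ (@chi_l_linear k d A B C f g) (@phi_l_linear k d A B f) w x y n wP))).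
  apply: (@strict_op_ext k (ABdual h) (AAdual d A) id) => x' y' n' v.
  by rewrite phi_l_chi_l.
- move=> w x y n w0 wP.
  exact: (esym (@strict_op_comp k (ABdual h) (ABdual g) (AAdual d C) (sob f) (sob g)
    _ _ (@chi_r_linear k d A B C f g) (@phi_r_linear k d B C g) w x y n wP)).
Qed.

End Functor.


(** * Nondegeneracy *)

Section Bidual.
Variables (k : fieldType) (V : lmodType k).

Definition spanned (n : nat) : Prop :=
  exists e : 'I_n -> V, forall v, exists c : 'I_n -> k, v = \sum_i c i *: e i.

(** A minimal spanning family is a basis, so its coordinates are linear. *)
Lemma dual_basis n : spanned n ->
  exists m (e : 'I_m -> V) (e' : 'I_m -> dual V),
    forall v, v = \sum_i e' i v *: e i.
Proof.
move=> sn; have exn : exists n, `[< spanned n >] by exists n; apply/asboolP.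
case: (ex_minnP exn) => m /asboolP [e es] mmin.
have free c : \sum_i c i *: e i = 0 -> forall j, c j = 0.
  move=> c0 j; apply: contrapT => /eqP cj.
  case: m e es mmin c c0 j cj => [|m] e es mmin c c0 j cj; first by case: j {cj}.
  have : (m.+1 <= m)%N; last by rewrite ltnn.
  apply: mmin; apply/asboolP; exists (fun i => e (lift j i)) => v.
  have [b vb] := es v.
  exists (fun i => b (lift j i) - b j * (c j)^-1 * c (lift j i)).
  have ej : e j = - \sum_i ((c j)^-1 * c (lift j i)) *: e (lift j i).
    move: c0; rewrite (bigD1_ord j) //= => /(congr1 (fun w => (c j)^-1 *: w)).
    rewrite scaler0 scalerDr scalerA mulVf // scale1r => /eqP.
    rewrite addr_eq0 => /eqP ->; congr (- _); rewrite scaler_sumr.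
    by apply: eq_bigr => i _; rewrite scalerA.
  rewrite vb (bigD1_ord j) //= ej scalerN scaler_sumr addrC -sumrB.
  by apply: eq_bigr => i _; rewrite scalerBl scalerA mulrA.
have [co coP] := choice es.
have colin i : linear (fun v => co v i : k^o).
  move=> a u v; apply/eqP; rewrite -subr_eq0; apply/eqP.
  apply: (free (fun i => co (a *: u + v) i - (a * co u i + co v i))).
  transitivity (\sum_i co (a *: u + v) i *: e i
    - (a *: (\sum_i co u i *: e i) + \sum_i co v i *: e i)).
    rewrite scaler_sumr -big_split -sumrB.
    by apply: eq_bigr => j _; rewrite scalerBl scalerDl scalerA.
  by rewrite -(coP u) -(coP v) -coP subrr.
exists m, e, (fun i => to_dual (fun v => co v i)) => v.
by rewrite {1}(coP v); apply: eq_bigr => i _; rewrite to_dualE.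
Qed.

(** The preimage of [G] has coordinates [G (e' i)] in a basis [e] with dual basis
    [e']. *)
Lemma bidual n : spanned n -> forall G : dual V -> k^o, linear G ->
  exists! v : V, forall f : dual V, f v = G f.
Proof.
move=> /dual_basis [m [e [e' eP]]] G Gl.
have fl (f : dual V) : linear (f : V -> k^o) by move=> a u v; exact: dual_linear.
exists (\sum_i (G (e' i) : k) *: e i); split=> [f|v vP].
  have -> : f = \sum_i (f (e i) : k) *: e' i.
    apply: dual_ext => v; rewrite {1}(eP v) (linear_comb (fl f)) dual_sumE.
    by apply: eq_bigr => i _; rewrite dual_scaleE; exact: mulrC.
  rewrite (linear_comb Gl).
  set f' := \sum_i (f (e i) : k) *: e' i.
  rewrite (linear_comb (fl f')).
  have -> : f' = f.
    apply: dual_ext => v; rewrite {2}(eP v) (linear_comb (fl f)) dual_sumE.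
    by apply: eq_bigr => i _; rewrite dual_scaleE; exact: mulrC.
  by apply: eq_bigr => i _; exact: mulrC.
by rewrite [RHS]eP; apply: eq_bigr => i _; rewrite vP.
Qed.

End Bidual.

Section Nondegenerate.
Variables (k : fieldType) (d : int) (A : quiver k).
Local Notation AA := (AAdual d A).

Lemma Gamma_nondegenerate : locally_finite A -> Defs.nondegenerate (d - 1) (@Gamma k d A).
Proof.
move=> lf x y m n mn g.
(* The degrees [n] and [n'], [m] and [m'] are equal but not convertible; [lcomp]
   transports elements between them. *)
set n' := - (m + (d - 1)); set m' := - (n + (d - 1)).
have en : n = n' by rewrite /n'; lia.
have em : m = m' by rewrite /m'; lia.
have gl : linear (g : AA y x n -> k^o) by move=> a u v; exact: dual_linear.
pose s1 : k := sgn (m - 1 + 1).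
pose s2 : k := - (sgn ((m - 1) * (n - 1)) * sgn (n - 1 + 1)).
have s11 : s1 * s1 = 1 by rewrite sgn_sq.
have s22 : s2 * s2 = 1 by rewrite /s2 mulrNN -sgnD sgn_sq.
have GE (a : AA x y m) (b : AA y x n) : @Gamma k d A x y m n a b =
    s1 * (a.2 : dual (A y x n')) (lcomp (Letter b.1) y x n')
    + s2 * (b.2 : dual (A x y m')) (lcomp (Letter a.1) x y m').
  by rewrite /Gamma /natural_form /s2 mulNr.
have [v [vP vU]] : exists! v : A x y m', forall f : dual (A x y m'),
    f v = g (0, s2 *: f).
  have [s sP] := lf x y m'.
  apply: (@bidual k _ (size s) _ (fun f => g (0, s2 *: f))).
    by exists (fun i => s`_i) => v; have [c ->] := sP v; exists c.
  move=> c f1 f2; rewrite -gl; congr (g _); apply: sum_dual_ext => /=.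
    by rewrite scaler0 addr0.
  by rewrite scalerDr !scalerA mulrC.
have back (u : A y x n') : lcomp (Letter (lcomp (Letter u) y x n)) y x n' = u.
  by rewrite Letter_lcomp ?lcomp_Letter.
have back' (u : A y x n) : lcomp (Letter (lcomp (Letter u) y x n')) y x n = u.
  by rewrite Letter_lcomp ?lcomp_Letter.
pose h (u : A y x n') : k^o := s1 * g (lcomp (Letter u) y x n, 0).
have hl : linear h.
  move=> c u u'; rewrite /h lcomp_linear.
  have -> : (c *: lcomp (Letter u) y x n + lcomp (Letter u') y x n, 0) =
      c *: ((lcomp (Letter u) y x n, 0) : AA y x n)
      + ((lcomp (Letter u') y x n, 0) : AA y x n).
    by apply: sum_dual_ext => //=; rewrite scaler0 addr0.
  rewrite gl mulrDr; congr (_ + _); exact: mulrCA.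
exists (lcomp (Letter v) x y m, to_dual h); split=> [b|a aP].
  rewrite GE /= to_dualE // /h.
  transitivity (s1 * (s1 * g (b.1, 0))
      + s2 * (b.2 : dual (A x y m')) v).
    congr (s1 * (s1 * g (_, 0)) + s2 * (b.2 : dual (A x y m')) _).
      exact: back'.
    by rewrite Letter_lcomp // lcomp_Letter.
  rewrite vP.
  have gs c z : c * g z = g (c *: z) by symmetry; exact: (linear_scale gl).
  rewrite mulrA s11 mul1r gs -(linear_add gl).
  congr (g _); apply: sum_dual_ext => /=; first by rewrite scaler0 addr0.
  by rewrite add0r scalerA s22 scale1r.
apply: sum_dual_ext => /=; last first.
  apply: dual_ext => u; rewrite to_dualE // /h -aP GE /=.
  have z : s2 * (0 : dual (A x y m')) (lcomp (Letter a.1) x y m') = 0.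
    by rewrite dual_zeroE mulr0.
  by rewrite [X in _ * (_ + X)]z addr0 mulrA s11 mul1r back.
rewrite (vU (lcomp (Letter a.1) x y m')); first by rewrite Letter_lcomp ?lcomp_Letter.
move=> f; rewrite -aP GE /= lcomp0 dual_zero mulr0 add0r.
have z : s2 * (s2 *: f : dual (A x y m')) (lcomp (Letter a.1) x y m') =
    f (lcomp (Letter a.1) x y m').
  by rewrite dual_scaleE mulrA s22 mul1r.
exact: esym z.
Qed.

End Nondegenerate.

Theorem corollary5p21 (k : fieldType)
    (hchar2 : 2%N \notin [pchar k]) (hchar3 : 3%N \notin [pchar k]) (d : int) :
  exists (hob : forall A : preCY_cat k d,
            is_almost_cyclic_Ainf (Gamma (A := A)) (j_op (@pm k d A)))
         (hmor : forall (A B : preCY_cat k d) (f : strict_mor A B),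
            @is_scyc_mor k d (AcycCat (hob A)) (AcycCat (hob B)) _ (strict_span f)),
  let S0 (A : preCY_cat k d) : acyc_cat k d := AcycCat (hob A) in
  let S1 (A B : preCY_cat k d) (f : strict_mor A B) : scyc_mor (S0 A) (S0 B) :=
    existT _ (sob f) (exist _ (strict_span f) (hmor A B f)) in
  is_functor (C := SpCY k d) (D := SacycAinf k d) S1 /\
  exists hcyc : forall A : preCY_cat k d,
      locally_finite A -> is_cyclic (S0 A),
    is_functor (C := @full_sub (SpCY k d) (fun A : preCY_cat k d => locally_finite A))
      (D := ScycAinf k d)
      (S0 := fun A => exist _ (S0 (sval A)) (hcyc _ (svalP A)))
      (fun A B f => S1 _ _ f).
Proof.
have hob A := j_op_almost_cyclic_Ainf (@pmP k d A).
exists hob.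
have hmor A B f := @strict_span_is_scyc_mor k d A B f (hob A) (hob B).
exists hmor => S0 S1; split.
  by move=> A B C f g h /= ->; exact: strict_span_comp.
have hcyc (A : preCY_cat k d) : locally_finite A -> is_cyclic (S0 A).
  move=> lf; exists (d - 1); first exact: Gamma_is_form.
  exact: Gamma_nondegenerate.
exists hcyc => -[A lA] [B lB] [C lC] f g h /= ->.
exact: strict_span_comp.
Qed.
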